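(* Let $d\ge 2$ and let $\mu$ be a positive Borel measure on $\mathbb{R}^d$ whose support $E$ is bounded and with $\mu(E)=1$. Assume there are $0<\alpha\le d$ and $c_0>0$ such that $\mu(B(x,r))\le c_0\,r^{\alpha}$ for every open ball $B(x,r)\subset\mathbb{R}^d$. Let $\Omega\subset\mathbb{R}^d$ be a bounded Borel set with $|\Omega|>0$, and assume there are constants $0<\beta\le 1$ and $\kappa_1>0$ such that for every $h\in\mathbb{R}^d$ with $|h|$ small enough $$|(h+\Omega)\triangle\Omega|\le \kappa_1|h|^{\beta}.$$ Assume moreover that there exist $\kappa_2>0$, $\kappa_3>0$, a unit vector $\overline{\Theta}$ and a decreasing sequence $t_n\to 0$ with $t_n\le\kappa_3 t_{n+1}$ for all $n$, such that for every $n$ $$\kappa_2\,t_n^{\beta}\le |(t_n\overline{\Theta}+\Omega)\triangle\Omega|.$$ Then there exist positive constants $a,b,c$ such that for every $N$ and every point distribution $\mathcal{P}_N=\{z_1,\dots,z_N\}\subset\mathbb{R}^d$, $$\left\{\int_a^b\int_{SO(d)}\int_{\mathbb{R}^d}\left|\mathcal{D}_N(x+\tau\sigma\Omega)\right|^2\,dx\,d\sigma\,d\tau\right\}^{1/2}\ge c\,N^{1/2-\beta/(2\alpha)}.$$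
   Context: $|F|$ denotes Lebesgue measure of $F\subseteq\mathbb{R}^d$ and $A\triangle B=(A\setminus B)\cup(B\setminus A)$. For a point set $\mathcal{P}_N=\{z_1,\dots,z_N\}$ and a Borel set $R$, the discrepancy is $\mathcal{D}_N(R)=\mathrm{card}(\mathcal{P}_N\cap R)-N\mu(R)$. $d\sigma$ is the normalized Haar measure on the rotation group $SO(d)$; $x+\tau\sigma\Omega=\{x+\tau\sigma(y):y\in\Omega\}$. *)

(* Defs.v *)
From HB Require Import structures.
From mathcomp Require Import all_boot all_order all_algebra.
From mathcomp Require Import all_classical all_reals all_analysis.
Set Implicit Arguments. Unset Strict Implicit. Unset Printing Implicit Defensive.
Import Order.TTheory GRing.Theory Num.Theory.
Import numFieldNormedType.Exports.
Local Open Scope classical_set_scope.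
Local Open Scope ring_scope.

Definition Rd (R : realType) (d : nat) := g_sigma_algebraType (@open 'cV[R]_d).

Definition Md (R : realType) (d : nat) := g_sigma_algebraType (@open 'M[R]_d).

Definition enorm (R : realType) (d : nat) (x : 'cV[R]_d) : R :=
  Num.sqrt (\sum_(i < d) x i ord0 ^+ 2).

Definition eball (R : realType) (d : nat) (x : 'cV[R]_d) (r : R) : set 'cV[R]_d :=
  [set y | enorm (y - x) < r].

Definition ebounded (R : realType) (d : nat) (A : set 'cV[R]_d) : Prop :=
  exists M : R, forall x, A x -> enorm x <= M.

Definition msupport (R : realType) (d : nat)
  (mu : {measure set (Rd R d) -> \bar R}) : set 'cV[R]_d :=
  [set x | forall r : R, 0 < r -> (0 < mu (eball x r))%E].

(* Lebesgue measure on R^d: the Borel measure giving every box its volume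
   (it is uniquely determined by this property). *)
Definition is_lebesgue_Rd (R : realType) (d : nat)
  (lam : {measure set (Rd R d) -> \bar R}) : Prop :=
  forall a b : 'cV[R]_d, (forall i, a i ord0 <= b i ord0) ->
    lam [set x : 'cV[R]_d | forall i, a i ord0 <= x i ord0 <= b i ord0]
    = (\prod_(i < d) (b i ord0 - a i ord0))%:E.

Definition SO (R : realType) (d : nat) : set 'M[R]_d :=
  [set s | s^T *m s = 1%:M /\ \det s = 1].

(* normalized Haar measure on SO(d), viewed as a Borel probability measure on
   d x d matrices carried by SO(d) and invariant under left multiplication by
   rotations (this determines it uniquely). *)
Definition is_haar_SO (R : realType) (d : nat)
  (nu : {measure set (Md R d) -> \bar R}) : Prop :=
  nu [set: Md R d] = 1%E /\ nu (@SO R d) = 1%E /\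
  forall rho, @SO R d rho -> forall S : set (Md R d), measurable S ->
    nu ((fun s : 'M[R]_d => rho *m s) @^-1` S) = nu S.

Definition symdiff (T : Type) (A B : set T) : set T := (A `\` B) `|` (B `\` A).

Definition translate (R : realType) (d : nat) (h : 'cV[R]_d) (A : set 'cV[R]_d)
  : set 'cV[R]_d := [set h + y | y in A].

Definition moved (R : realType) (d : nat) (x : 'cV[R]_d) (tau : R)
  (s : 'M[R]_d) (A : set 'cV[R]_d) : set 'cV[R]_d :=
  [set x + tau *: (s *m y) | y in A].

(* discrepancy of the point distribution z_1..z_N (counted with multiplicity)
   relative to mu: card(P_N \cap A) - N mu(A).  mu is a probability
   measure, so mu(A) is finite. *)
Definition discrepancy (R : realType) (d : nat)
  (mu : {measure set (Rd R d) -> \bar R}) (N : nat) (z : 'I_N -> 'cV[R]_d)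
  (A : set 'cV[R]_d) : R :=
  (#|[set i : 'I_N | `[< A (z i) >]]|)%:R - N%:R * fine (mu A).

(* Main.v *)
Require Import Defs.
From HB Require Import structures.
From mathcomp Require Import all_boot all_order all_algebra.
From mathcomp Require Import all_classical all_reals all_analysis.
From mathcomp Require Import measurable_realfun ring lra.
Set Implicit Arguments. Unset Strict Implicit. Unset Printing Implicit Defensive.
Import Order.TTheory GRing.Theory Num.Theory.
Import numFieldNormedType.Exports.
Local Open Scope classical_set_scope.
Local Open Scope ring_scope.

(** The [L^2] norm of [x |-> D_N(x + tau s Omega)] is bounded below by testing its
    Fourier transform, which factors as [tau^d] times the transform of
    [sum_i delta_(z_i) - N mu] at [xi] times that of [1_Omega] at [tau s^T xi],
    against a Gaussian weight; Gaussian weights reduce every Plancherel-type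
    identity to Fubini.  The hypotheses on the translates of [Omega] say that
    [gphi s], the Gaussian mean at scale [sqrt s] of [|(v + Omega) symdiff Omega|],
    is comparable to [s^(beta/2)]; a difference of two such means isolates the
    energy of the transform of [1_Omega] on an annulus [|xi| ~ s^(-1/2)], and
    averaging over rotations and dilations turns this into a pointwise lower
    bound [|xi|^(-d-beta)].  It remains to bound below the Gaussian energy of
    [sum_i delta_(z_i) - N mu] at scale [delta = c N^(-1/alpha)]: the diagonal
    contributes [N], and the cross terms are at most [N^2 delta^alpha] by the
    growth condition on [mu]. *)

(** Positivity replaces Plancherel: testing needs only an upper bound of a Gaussian energy by the
    [L^2] norm, and this holds because an autocorrelation is largest at the origin. The constant
    [Zg s * Zg (4 s)^-1] does not depend on [s]; it is [(2 pi)^d] and is never evaluated. The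
    obstacle is that the lower hypothesis concerns one direction and one sequence. Subadditivity of
    [phi] spreads it to a ball of radius comparable to [t_n] around [t_n Theta], and the ratio
    condition then reaches every small scale. The outcome is energy in a whole annulus, with no
    pointwise information, since the transform of the indicator of [Omega] may vanish at many
    frequencies. Averaging over rotations makes the energy radial; integrating over [tau] in a fixed
    interval then trades the annulus for a segment of a ray. The exponent comes out as follows: a
    weight at scale [delta] costs [delta^(d + beta)] in the pointwise bound, the Gaussian mass
    returns [delta^(-d)], and [delta] may be as large as keeps the cross terms below half of the
    diagonal. The square is thus at least of order [delta^beta N], that is
    [N^(1 - beta / alpha)]. *)

Section PushMeasure.
Context {d1 d2} {T1 : measurableType d1} {T2 : measurableType d2} {R : realType}.
Variables (m : {measure set T1 -> \bar R}) (f : T1 -> T2).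
Hypothesis mf : measurable_fun setT f.

Definition push_measure : {measure set T2 -> \bar R} :=
  measure_function_pushforward__canonical__measure_function_Measure m mf.

Lemma push_measureE A : push_measure A = m (f @^-1` A).
Proof. by []. Qed.

Lemma ge0_integral_push (g : T2 -> \bar R) :
  measurable_fun setT g -> (forall y, 0 <= g y)%E ->
  (\int[push_measure]_y g y = \int[m]_x g (f x))%E.
Proof.
move=> mg g0.
by have := @ge0_integral_pushforward _ _ _ _ _ _ mf m setT g measurableT mg
  (fun y _ => g0 y); rewrite preimage_setT.
Qed.

End PushMeasure.

(** * Integrability of real functions and Fubini theorems *)

Section Monotone.
Context {d} {T : measurableType d} {R : realType} (m : {measure set T -> \bar R}).

(* Unlike [ge0_le_integral], no measurability of the larger function. *)
Lemma ge0_le_integral_weak (D : set T) (f g : T -> \bar R) :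
  (forall x, D x -> 0 <= f x)%E -> (forall x, D x -> f x <= g x)%E ->
  (\int[m]_(x in D) f x <= \int[m]_(x in D) g x)%E.
Proof.
move=> f0 fg; rewrite !ge0_integralE//; last first.
  by move=> x Dx; exact: le_trans (f0 _ Dx) (fg _ Dx).
apply: ge_ereal_sup => _ [h hf <-]; apply: ereal_sup_ubound; exists h => //.
move=> x; apply: le_trans (hf x) _; rewrite /patch; case: ifPn => //.
by rewrite inE => /fg.
Qed.

Lemma integrable_le (f g : T -> R) : measurable_fun setT f ->
  (forall x, `|f x| <= g x) -> m.-integrable setT (EFin \o g) ->
  m.-integrable setT (EFin \o f).
Proof.
move=> mf fg; apply: le_integrable => //; first exact/measurable_EFinP.
by move=> x _; rewrite /= lee_fin (le_trans (fg x))// ler_norm.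
Qed.

Lemma EFin_Rintegral (f : T -> R) : m.-integrable setT (EFin \o f) ->
  ((\int[m]_x f x)%:E = \int[m]_x (f x)%:E)%E.
Proof. by move=> fi; rewrite fineK//; exact: integrable_fin_num. Qed.

Lemma Rintegrable_mull (k : R) (f : T -> R) : m.-integrable setT (EFin \o f) ->
  m.-integrable setT (EFin \o (fun x => k * f x)).
Proof. exact: integrableZl. Qed.

Lemma Rintegrable_mulr (k : R) (f : T -> R) : m.-integrable setT (EFin \o f) ->
  m.-integrable setT (EFin \o (fun x => f x * k)).
Proof. exact: integrableZr. Qed.

Lemma Rintegrable_add (f g : T -> R) : m.-integrable setT (EFin \o f) ->
  m.-integrable setT (EFin \o g) -> m.-integrable setT (EFin \o (fun x => f x + g x)).
Proof. exact: integrableD. Qed.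

Lemma Rintegrable_sub (f g : T -> R) : m.-integrable setT (EFin \o f) ->
  m.-integrable setT (EFin \o g) -> m.-integrable setT (EFin \o (fun x => f x - g x)).
Proof. exact: integrableB. Qed.

Lemma ge0_integrable (f : T -> R) : measurable_fun setT f ->
  (forall x, 0 <= f x) -> (\int[m]_x (f x)%:E < +oo)%E ->
  m.-integrable setT (EFin \o f).
Proof.
move=> mf f0 foo; apply/integrableP; split; first exact/measurable_EFinP.
by under eq_integral do rewrite gee0_abs ?lee_fin//.
Qed.

End Monotone.

Section SigmaFiniteCopy.
Context {d} {T : measurableType d} {R : realType}.
Variable (m : {measure set T -> \bar R}).

(* Carries the sigma-finite instance required by the Fubini theorems. *)
Definition sigma_finite_copy (s : sigma_finite setT m) : set T -> \bar R := m.

Variable s : sigma_finite setT m.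

HB.instance Definition _ := Measure.on (sigma_finite_copy s).
HB.instance Definition _ :=
  Measure_isSigmaFinite.Build d T R (sigma_finite_copy s) s.

End SigmaFiniteCopy.

Section Fubini.
Context {d1 d2} {T1 : measurableType d1} {T2 : measurableType d2} {R : realType}.
Variables (m1 : {measure set T1 -> \bar R}) (m2 : {measure set T2 -> \bar R}).
Hypotheses (s1 : sigma_finite setT m1) (s2 : sigma_finite setT m2).

Let m1' : {sigma_finite_measure set T1 -> \bar R} := sigma_finite_copy s1.
Let m2' : {sigma_finite_measure set T2 -> \bar R} := sigma_finite_copy s2.

Let m1E : (m1' : {measure set T1 -> \bar R}) = m1.
Proof. exact/eq_measure. Qed.

Let m2E : (m2' : {measure set T2 -> \bar R}) = m2.
Proof. exact/eq_measure. Qed.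

Lemma tonelli (f : T1 -> T2 -> \bar R) :
  measurable_fun setT (fun z : T1 * T2 => f z.1 z.2) ->
  (forall x y, 0 <= f x y)%E ->
  (\int[m1]_x \int[m2]_y f x y = \int[m2]_y \int[m1]_x f x y)%E.
Proof.
move=> mf f0; rewrite -m1E -m2E.
exact: (@fubini_tonelli _ _ _ _ _ m1' m2' (fun z => f z.1 z.2)).
Qed.

Lemma measurable_tonelli1 (f : T1 -> T2 -> \bar R) :
  measurable_fun setT (fun z : T1 * T2 => f z.1 z.2) ->
  (forall x y, 0 <= f x y)%E ->
  measurable_fun setT (fun x => \int[m2]_y f x y)%E.
Proof.
move=> mf f0; rewrite -m2E.
exact: (@measurable_fun_fubini_tonelli_F _ _ _ _ _ m2' (fun z => f z.1 z.2)).
Qed.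

Section Iterated.
Variable f : T1 -> T2 -> R.
Hypothesis mf : measurable_fun setT (fun z : T1 * T2 => f z.1 z.2).
Hypothesis sl2 : forall x, m2.-integrable setT (EFin \o f x).
Hypothesis sl1 : forall y, m1.-integrable setT (EFin \o f ^~ y).
Hypothesis ffin : (\int[m1]_x \int[m2]_y `|(f x y)%:E| < +oo)%E.

Let fprod : ((m1' \x m2').-integrable setT (fun z => (f z.1 z.2)%:E))%E.
Proof. by apply/integrable12ltyP; first exact/measurable_EFinP. Qed.

Lemma integrable_iterated1 :
  m1.-integrable setT (EFin \o (fun x => \int[m2]_y f x y)).
Proof.
rewrite (_ : EFin \o _ = fubini_F m2 (fun z => (f z.1 z.2)%:E)).
  exact: integrable_fubini_F fprod.
by apply/funext => x; rewrite /= EFin_Rintegral.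
Qed.

Lemma integrable_iterated2 :
  m2.-integrable setT (EFin \o (fun y => \int[m1]_x f x y)).
Proof.
have mfa : measurable_fun setT (fun z : T1 * T2 => `|(f z.1 z.2)%:E|%E).
  by apply/measurable_EFinP; exact: measurableT_comp.
apply/integrableP; split.
  rewrite (_ : EFin \o _ = fubini_G m1 (fun z => (f z.1 z.2)%:E)).
    exact: measurable_fubini_G fprod.
  by apply/funext => x; rewrite /= EFin_Rintegral.
apply: le_lt_trans ffin; rewrite (tonelli (f := fun x y => `|(f x y)%:E|%E))//.
apply: ge0_le_integral_weak => y _ //=.
rewrite EFin_normr_Rintegral//.
by apply: le_abse_integral => //; have /integrableP[] := sl1 y.
Qed.

(** Every slice is integrable, not only almost every one, so [fine] discards nothing and the real
    iterated integrals coincide pointwise with the extended ones. *)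
Lemma Rfubini_iterated : \int[m1]_x \int[m2]_y f x y = \int[m2]_y \int[m1]_x f x y.
Proof.
have H : (\int[m1]_x \int[m2]_y (f x y)%:E = \int[m2]_y \int[m1]_x (f x y)%:E)%E.
  exact: etrans (integral12_prod_meas1 fprod) (esym (integral21_prod_meas1 fprod)).
apply: EFin_inj; rewrite !EFin_Rintegral; last 2 first.
- exact: integrable_iterated2.
- exact: integrable_iterated1.
under eq_integral do rewrite EFin_Rintegral//.
by rewrite H; apply: eq_integral => y _; rewrite EFin_Rintegral.
Qed.

End Iterated.

Section Dominated.
Variables (f : T1 -> T2 -> R) (u : T1 -> R) (v : T2 -> R).
Hypothesis mf : measurable_fun setT (fun z : T1 * T2 => f z.1 z.2).
Hypothesis iu : m1.-integrable setT (EFin \o u).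
Hypothesis iv : m2.-integrable setT (EFin \o v).
Hypothesis fuv : forall x y, `|f x y| <= u x * v y.

Let mf2 x : measurable_fun setT (f x).
Proof. by have := measurableT_comp mf (pair1_measurable x). Qed.

Let mf1 y : measurable_fun setT (f ^~ y).
Proof. by have := measurableT_comp mf (pair2_measurable y). Qed.

Lemma integrable_slice2 x : m2.-integrable setT (EFin \o f x).
Proof.
apply: (integrable_le (mf2 x) (fuv x)).
exact: (integrableZl measurableT (u x) iv).
Qed.

Lemma integrable_slice1 y : m1.-integrable setT (EFin \o f ^~ y).
Proof.
apply: (integrable_le (mf1 y) (fuv^~ y)).
exact: (integrableZr measurableT (v y) iu).
Qed.

Let ffin : (\int[m1]_x \int[m2]_y `|(f x y)%:E| < +oo)%E.
Proof.
apply: (@le_lt_trans _ _ (\int[m1]_x \int[m2]_y (`|u x| * `|v y|)%:E)%E).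
  apply: ge0_le_integral_weak => x _; first exact: integral_ge0.
  apply: ge0_le_integral_weak => y _ //=.
  by rewrite lee_fin (le_trans (fuv x y))// -normrM ler_norm.
have [mu ioo] := integrableP _ _ _ iu; have [mv joo] := integrableP _ _ _ iv.
have jE x : (\int[m2]_y (`|u x| * `|v y|)%:E = `|u x|%:E * \int[m2]_y `|(v y)%:E|)%E.
  rewrite -ge0_integralZl_EFin//; first exact: measurableT_comp.
under eq_integral do rewrite jE muleC.
rewrite ge0_integralZl//; last 2 first.
- apply/measurable_EFinP; apply: measurableT_comp => //.
  exact/measurable_EFinP.
- exact: integral_ge0.
apply: lte_mul_pinfty => //; first exact: integral_ge0.
by rewrite ge0_fin_numE//; exact: integral_ge0.
Qed.

Lemma integrable_fubini1 :
  m1.-integrable setT (EFin \o (fun x => \int[m2]_y f x y)).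
Proof. exact: (integrable_iterated1 mf integrable_slice2 ffin). Qed.

Lemma integrable_fubini2 :
  m2.-integrable setT (EFin \o (fun y => \int[m1]_x f x y)).
Proof. exact: (integrable_iterated2 mf integrable_slice1 ffin). Qed.

Lemma measurable_fubini1 : measurable_fun setT (fun x => \int[m2]_y f x y).
Proof. by have /integrableP[/measurable_EFinP] := integrable_fubini1. Qed.

(** The product bound [u x * v y] makes all slices and the double integral finite at once. Typically
    a Gaussian weight supplies one factor and an integrable function the other. *)
Lemma Rfubini : \int[m1]_x \int[m2]_y f x y = \int[m2]_y \int[m1]_x f x y.
Proof. exact: (Rfubini_iterated mf integrable_slice2 integrable_slice1 ffin). Qed.

End Dominated.

End Fubini.

(** * Borel structure of matrix spaces and Euclidean geometry *)

Section MatrixBorel.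
Context {R : realType} {m n : nat}.

Definition Mb (R : realType) (m n : nat) :=
  g_sigma_algebraType (@open 'M[R]_(m, n)).

Lemma continuous_entry (i : 'I_m) (j : 'I_n) :
  continuous (fun x : 'M[R]_(m, n) => x i j).
Proof.
move=> x; exact: coord_continuous.
Qed.

Lemma measurable_entry (i : 'I_m) (j : 'I_n) :
  measurable_fun setT (fun x : Mb R m n => x i j).
Proof.
apply: (measurability _ (RGenOpens.measurableE R)) => _ [_ [a [b ->]] <-].
rewrite setTI; apply: sub_sigma_algebra.
move/continuousP: (@continuous_entry i j); exact.
Qed.

End MatrixBorel.

Section MeasurableMatrix.
Context {R : realType} {m n : nat} {dd} {T : measurableType dd}.

(* Opens of a matrix space are countable unions of boxes with rational centres. *)
Lemma measurable_matrixP (f : T -> Mb R m n) :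
  (forall i j, measurable_fun setT (fun t => f t i j)) -> measurable_fun setT f.
Proof.
move=> mf; apply: (@measurability _ _ T (Mb R m n) setT f (@open 'M[R]_(m, n)) erefl).
move=> _ [U oU <-]; rewrite setTI.
pose box (p : 'M[rat]_(m, n) * nat) : set 'M[R]_(m, n) :=
  [set x | forall i j, `|x i j - ratr (p.1 i j)| < p.2.+1%:R^-1].
pose F p := if `[< box p `<=` U >] then f @^-1` box p else set0.
have -> : f @^-1` U = \bigcup_p F p.
  apply/seteqP; split => [t /= Ut|t [p _]]; last first.
    by rewrite /F; case: asboolP => // sU /sU.
  have [e /= e0 eU] : nbhs_ball (f t : 'M[R]_(m, n)) U.
    by rewrite nbhs_ballE; exact: open_nbhs_nbhs.
  have [k ke] : exists k : nat, k.+1%:R^-1 < e / 2.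
    exists (Num.trunc (e / 2)^-1).
    by rewrite invf_plt ?posrE ?divr_gt0// truncnS_gt.
  have hc i j : {c : rat | `|f t i j - ratr c| < k.+1%:R^-1 }.
    apply: cid.
    have : f t i j - k.+1%:R^-1 < f t i j + k.+1%:R^-1.
      by rewrite ltrD2l gtrN// invr_gt0.
    move=> /rat_in_itvoo[q]; rewrite in_itv/= => /andP[q1 q2]; exists q.
    by rewrite ltr_distlC q1 q2.
  exists (\matrix_(i, j) sval (hc i j), k) => //; rewrite /F asboolT; last first.
    move=> y yb; apply: eU; split=> // i j; rewrite -ball_normE /ball_ /=.
    have := yb i j; have := svalP (hc i j); rewrite /= !mxE.
    set c := ratr _; set e2 := _^-1 in ke *; rewrite !ltr_norml => /andP[? ?] /andP[? ?].
    by apply/andP; split; lra.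
  by move=> i j; rewrite mxE; exact: svalP (hc i j).
apply: countable_bigcupT_measurable => // p; rewrite /F; case: asboolP => // _.
have -> : f @^-1` box p = ~` (\bigcup_(q : 'I_m * 'I_n)
    ~` [set t | `|f t q.1 q.2 - ratr (p.1 q.1 q.2)| < p.2.+1%:R^-1]).
  rewrite setC_bigcup; apply/seteqP; split=> [t tb q _|t tb i j].
    by rewrite setCK; exact: tb.
  by have := tb (i, j) I; rewrite setCK.
apply: measurableC; apply: countable_bigcupT_measurable => // q.
apply: measurableC.
have mb : measurable_fun setT
    (fun t => `|f t q.1 q.2 - ratr (p.1 q.1 q.2)| < p.2.+1%:R^-1).
  apply: measurable_fun_ltr => //.
  by apply: measurableT_comp => //; apply: measurable_funB.
have := mb measurableT [set true] I; rewrite setTI; exact.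
Qed.

End MeasurableMatrix.

Section Dot.
Context {R : realType} {d : nat}.
Implicit Types x y z : 'cV[R]_d.

Definition dot (x y : 'cV[R]_d) : R := (x^T *m y) ord0 ord0.

Definition sqn (x : 'cV[R]_d) : R := dot x x.

Lemma dotE x y : dot x y = \sum_(i < d) x i ord0 * y i ord0.
Proof. by rewrite /dot mxE; apply: eq_bigr => i _; rewrite mxE. Qed.

Lemma sqnE x : sqn x = \sum_(i < d) x i ord0 ^+ 2.
Proof. by rewrite /sqn dotE; apply: eq_bigr => i _; rewrite expr2. Qed.

Lemma dotC x y : dot x y = dot y x.
Proof. by rewrite !dotE; apply: eq_bigr => i _; rewrite mulrC. Qed.

Lemma dotDr x y z : dot x (y + z) = dot x y + dot x z.
Proof. by rewrite /dot mulmxDr mxE. Qed.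

Lemma dotDl x y z : dot (x + y) z = dot x z + dot y z.
Proof. by rewrite dotC dotDr !(dotC z). Qed.

Lemma dotZr (c : R) x y : dot x (c *: y) = c * dot x y.
Proof. by rewrite /dot -scalemxAr mxE. Qed.

Lemma dotZl (c : R) x y : dot (c *: x) y = c * dot x y.
Proof. by rewrite dotC dotZr dotC. Qed.

Lemma dotNr x y : dot x (- y) = - dot x y.
Proof. by rewrite -scaleN1r dotZr mulN1r. Qed.

Lemma dotNl x y : dot (- x) y = - dot x y.
Proof. by rewrite dotC dotNr dotC. Qed.

Lemma dotBl x y z : dot (x - y) z = dot x z - dot y z.
Proof. by rewrite dotDl dotNl. Qed.

Lemma dot_mull (s : 'M[R]_d) x y : dot (s *m x) y = dot x (s^T *m y).
Proof. by rewrite /dot trmx_mul mulmxA. Qed.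

Lemma sqn_ge0 x : 0 <= sqn x.
Proof. by rewrite sqnE sumr_ge0// => i _; rewrite sqr_ge0. Qed.

Lemma sqnZ (c : R) x : sqn (c *: x) = c ^+ 2 * sqn x.
Proof. by rewrite /sqn dotZl dotZr mulrA expr2. Qed.

Lemma sqnN x : sqn (- x) = sqn x.
Proof. by rewrite /sqn dotNl dotNr opprK. Qed.

Lemma sqnD x y : sqn (x + y) = sqn x + 2 * dot x y + sqn y.
Proof. by rewrite /sqn !dotDl !dotDr (dotC y x); ring. Qed.

Lemma sqn0 : sqn 0 = 0.
Proof. by rewrite -(scale0r 0) sqnZ expr0n mul0r. Qed.

Lemma sqnB_sym x y : sqn (x - y) = sqn (y - x).
Proof. by rewrite -opprB sqnN. Qed.

Lemma sqn_orthogonal (s : 'M[R]_d) x : s^T *m s = 1%:M -> sqn (s *m x) = sqn x.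
Proof. by move=> ss; rewrite /sqn dot_mull mulmxA ss mul1mx. Qed.

Lemma entry_le_sqn x i : x i ord0 ^+ 2 <= sqn x.
Proof.
by rewrite sqnE (bigD1 i)//= lerDl sumr_ge0// => j _; rewrite sqr_ge0.
Qed.

Lemma enormE x : enorm x = Num.sqrt (sqn x).
Proof. by rewrite sqnE. Qed.

Lemma enorm_sqr x : enorm x ^+ 2 = sqn x.
Proof. by rewrite enormE sqr_sqrtr ?sqn_ge0. Qed.

Lemma enorm_ge0 x : 0 <= enorm x.
Proof. by rewrite enormE sqrtr_ge0. Qed.

Lemma enorm_ltE x r : 0 <= r -> (enorm x < r) = (sqn x < r ^+ 2).
Proof.
by move=> r0; rewrite -enorm_sqr ltr_pXn2r// nnegrE ?enorm_ge0.
Qed.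

(** Expand [sqn (k x - u y) >= 0] for both signs [u]. It takes the place of Cauchy-Schwarz and keeps
    all estimates in squared norms. *)
Lemma dot_young x y (k : R) : 0 < k -> 2 * `|dot x y| <= k * sqn x + k^-1 * sqn y.
Proof.
move=> k0.
have P (u : R) : u ^+ 2 = 1 -> 2 * (u * dot x y) <= k * sqn x + k^-1 * sqn y.
  move=> u2; have := sqn_ge0 (k *: x - u *: y).
  rewrite sqnD sqnN !sqnZ u2 dotNr dotZl dotZr mul1r => H.
  rewrite -subr_ge0 -(pmulr_rge0 _ k0); apply: le_trans H _.
  by rewrite le_eqVlt; apply/orP; left; apply/eqP; field; exact: lt0r_neq0.
case: ger0P => _; first by have := P 1 (expr1n _ _); rewrite mul1r.
by have := P (- 1) (etrans (sqrrN 1) (expr1n _ _)); rewrite mulN1r.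
Qed.

End Dot.

Section MeasurableRd.
Context {R : realType} {d : nat} {dd} {T : measurableType dd}.
Implicit Types f g : T -> Rd R d.

Lemma measurable_RdP f :
  (forall i, measurable_fun setT (fun t => f t i ord0)) -> measurable_fun setT f.
Proof.
move=> mf; apply: (@measurable_matrixP R d 1) => i j.
by rewrite (ord1 j).
Qed.

Lemma measurable_Rd_entry f i :
  measurable_fun setT f -> measurable_fun setT (fun t => f t i ord0).
Proof. by move=> mf; apply: (measurableT_comp (@measurable_entry R d 1 i ord0)). Qed.

Lemma measurable_dot f g : measurable_fun setT f -> measurable_fun setT g ->
  measurable_fun setT (fun t => dot (f t) (g t)).
Proof.
move=> mf mg; under eq_fun do rewrite dotE.
apply: measurable_sum => i.
by apply: measurable_funM; exact: measurable_Rd_entry.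
Qed.

Lemma measurable_sqn f : measurable_fun setT f ->
  measurable_fun setT (fun t => sqn (f t)).
Proof. by move=> mf; apply: measurable_dot. Qed.

Lemma measurable_addRd f g : measurable_fun setT f -> measurable_fun setT g ->
  measurable_fun setT (fun t => (f t : 'cV[R]_d) + g t : Rd R d).
Proof.
move=> mf mg; apply: measurable_RdP => i; under eq_fun do rewrite mxE.
by apply: measurable_funD; exact: measurable_Rd_entry.
Qed.

Lemma measurable_scaleRd (c : T -> R) f :
  measurable_fun setT c -> measurable_fun setT f ->
  measurable_fun setT (fun t => c t *: (f t : 'cV[R]_d) : Rd R d).
Proof.
move=> mc mf; apply: measurable_RdP => i; under eq_fun do rewrite mxE.
by apply: measurable_funM => //; exact: measurable_Rd_entry.
Qed.

Lemma measurable_oppRd f : measurable_fun setT f ->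
  measurable_fun setT (fun t => - (f t : 'cV[R]_d) : Rd R d).
Proof.
move=> mf; apply: measurable_RdP => i; under eq_fun do rewrite mxE.
by apply: measurableT_comp => //; exact: measurable_Rd_entry.
Qed.

Lemma measurable_subRd f g : measurable_fun setT f -> measurable_fun setT g ->
  measurable_fun setT (fun t => (f t : 'cV[R]_d) - g t : Rd R d).
Proof. by move=> mf mg; apply: measurable_addRd => //; exact: measurable_oppRd. Qed.

Lemma measurable_mulmxRd (s : T -> Md R d) f :
  measurable_fun setT s -> measurable_fun setT f ->
  measurable_fun setT (fun t => (s t : 'M[R]_d) *m f t : Rd R d).
Proof.
move=> ms mf; apply: measurable_RdP => i; under eq_fun do rewrite mxE.
apply: measurable_sum => j; apply: measurable_funM.
  exact: (measurableT_comp (@measurable_entry R d d i j)).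
exact: measurable_Rd_entry.
Qed.

Lemma measurable_trmxRd (s : T -> Md R d) : measurable_fun setT s ->
  measurable_fun setT (fun t => (s t : 'M[R]_d)^T : Md R d).
Proof.
move=> ms; apply: (@measurable_matrixP R d d) => i j; under eq_fun do rewrite mxE.
exact: (measurableT_comp (@measurable_entry R d d j i)).
Qed.

End MeasurableRd.

(** * Lebesgue measure on R^d: uniqueness and invariances *)

Section MeasurePreserving.
Context {dd} {T : measurableType dd} {R : realType}.
Variables (m : {measure set T -> \bar R}) (f : T -> T).
Hypothesis mf : measurable_fun setT f.
Hypothesis fm : forall A, measurable A -> m (f @^-1` A) = m A.

Lemma integral_preserving (g : T -> \bar R) : measurable_fun setT g ->
  (\int[m]_x g (f x) = \int[m]_x g x)%E.
Proof.
have H (h : T -> \bar R) : measurable_fun setT h -> (forall x, 0 <= h x)%E ->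
    (\int[m]_x h (f x) = \int[m]_x h x)%E.
  move=> mh h0; rewrite -(ge0_integral_push m mf mh h0).
  by apply: eq_measure_integral => A mA _; exact: fm.
move=> mg; rewrite [LHS]integralE [RHS]integralE.
congr (_ - _)%E.
- transitivity (\int[m]_x g^\+ (f x))%E.
    by apply: eq_integral => x _; rewrite (funepos_comp g f).
  by apply: (H g^\+%E) => //; exact: measurable_funepos.
- transitivity (\int[m]_x g^\- (f x))%E.
    by apply: eq_integral => x _; rewrite (funeneg_comp g f).
  by apply: (H g^\-%E) => //; exact: measurable_funeneg.
Qed.

Lemma Rintegral_preserving (g : T -> R) : measurable_fun setT g ->
  \int[m]_x g (f x) = \int[m]_x g x.
Proof.
move=> mg; congr fine.
by apply: (integral_preserving (g := EFin \o g)); exact/measurable_EFinP.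
Qed.

Lemma integrable_preserving (g : T -> R) : measurable_fun setT g ->
  m.-integrable setT (EFin \o g) -> m.-integrable setT (EFin \o (g \o f)).
Proof.
move=> mg /integrableP[mg' goo]; apply/integrableP; split.
  by apply/measurable_EFinP; exact: measurableT_comp.
have := integral_preserving (g := abse \o (EFin \o g)) => /= -> //.
exact: measurableT_comp.
Qed.

End MeasurePreserving.

Section Boxes.
Context {R : realType} {d : nat}.
Implicit Types a b x : 'cV[R]_d.

Definition cbox a b : set (Rd R d) :=
  [set x : 'cV[R]_d | forall i, a i ord0 <= x i ord0 <= b i ord0].

Lemma measurable_cbox a b : measurable (cbox a b).
Proof.
have -> : cbox a b = ~` (\bigcup_(i : 'I_d)
    ~` [set x : Rd R d | a i ord0 <= x i ord0 <= b i ord0]).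
  rewrite setC_bigcup; apply/seteqP; split => [x xb i _|x xb i].
    by rewrite setCK; exact: xb.
  by have := xb i I; rewrite setCK.
apply: measurableC; apply: countable_bigcupT_measurable => // i; apply: measurableC.
rewrite (_ : [set x | _] =
  (fun x : Rd R d => x i ord0) @^-1` `[a i ord0, b i ord0]%classic); last first.
  by apply/seteqP; split => x /=; rewrite in_itv.
rewrite -[X in measurable X]setTI.
by apply: (@measurable_entry R d 1) => //; exact: measurable_itv.
Qed.

(** Boxes form a pi-system: the intersection of two boxes has the maxima and minima of the corners
    as its corners, possibly in the wrong order and then empty. Hence [G] admits all pairs of
    corners, although agreement is assumed only for ordered ones. *)
Lemma Rd_measure_unique (m1 m2 : {measure set (Rd R d) -> \bar R}) :
  (forall a b, (forall i, a i ord0 <= b i ord0) -> m1 (cbox a b) = m2 (cbox a b)) ->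
  (forall a b, (m1 (cbox a b) < +oo)%E) ->
  forall A, measurable A -> m1 A = m2 A.
Proof.
move=> m12 moo.
have cbox0 a b i : b i ord0 < a i ord0 -> cbox a b = set0.
  move=> ba; apply/seteqP; split => // x /(_ i) /andP[ax xb].
  by have := le_trans ax xb; rewrite leNgt ba.
have m12' a b : m1 (cbox a b) = m2 (cbox a b).
  have [ab|] := pselect (forall i, a i ord0 <= b i ord0); first exact: m12.
  move=> /existsNP[i /negP]; rewrite -ltNge => /cbox0 ->.
  by rewrite !measure0.
pose G : set (set (Rd R d)) := [set A | exists a b, A = cbox a b].
pose g (n : nat) : set (Rd R d) := cbox (const_mx (- n%:R)) (const_mx n%:R).
have gE : \bigcup_k g k = setT.
  apply/seteqP; split=> // x _.
  exists (Num.trunc (\sum_i `|x i ord0|)).+1 => // i; rewrite !mxE -ler_norml.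
  apply: le_trans (ltW (truncnS_gt _)).
  by rewrite (bigD1 i)//= lerDl sumr_ge0.
(* Boxes generate the Borel sets: the identity is measurable from their sigma-algebra, because each
   half-space [c <= x_i] is a countable union of boxes. *)
have mG (A : set (Rd R d)) : measurable A -> <<s G >> A.
  move=> mA.
  have : measurable_fun (T := g_sigma_algebraType G) setT (id : _ -> Rd R d).
    apply: measurable_RdP => i.
    apply: (measurability _ (RGenCInfty.measurableE R)) => _ [_ [c ->] <-].
    rewrite setTI.
    pose F n : set (Rd R d) :=
      cbox (\col_j if j == i then c else - n%:R) (const_mx n%:R).
    have -> : (fun t : 'cV[R]_d => t i ord0) @^-1` `[c, +oo[%classic = \bigcup_n F n.
      apply/seteqP; split => [x /= |x [n _] /(_ i)]; last first.
        by rewrite !mxE eqxx /= in_itv/= andbT => /andP[].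
      rewrite in_itv/= andbT => cx.
      exists (Num.trunc (\sum_i `|x i ord0|)).+1 => // j; rewrite !mxE.
      have : `|x j ord0| <= (Num.trunc (\sum_i0 `|x i0 ord0|)).+1%:R.
        apply: le_trans (ltW (truncnS_gt _)).
        by rewrite (bigD1 j)//= lerDl sumr_ge0.
      rewrite ler_norml => /andP[x1 x2].
      by apply/andP; split => //; case: eqVneq => [->|_].
    by apply: bigcupT_measurable => n; apply: sub_sigma_algebra; eexists; eexists.
  by move=> /(_ measurableT A mA); rewrite setTI.
move=> A mA; apply: (g_sigma_algebra_measure_unique G _ g) => //.
- by move=> _ [a [b ->]]; exact: measurable_cbox.
- by move=> i; eexists; eexists.
- move=> _ _ [a [b ->]] [a' [b' ->]].
  exists (\col_i Num.max (a i ord0) (a' i ord0)), (\col_i Num.min (b i ord0) (b' i ord0)).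
  apply/seteqP; split => [x [h1 h2] i|x h].
    rewrite !mxE ge_max le_min; have /andP[-> ->] := h1 i.
    by have /andP[-> ->] := h2 i.
  by split => i; have := h i; rewrite !mxE ge_max le_min =>
    /andP[/andP[? ?] /andP[? ?]]; apply/andP.
- by move=> _ [a [b ->]].
- by move=> k; exact: moo.
- exact: mG.
Qed.

End Boxes.

Section LebesgueInvariance.
Context {R : realType} {d : nat} (lam : {measure set (Rd R d) -> \bar R}).
Hypothesis hlam : is_lebesgue_Rd lam.
Implicit Types a b h x : 'cV[R]_d.

Lemma lebesgue_cbox a b : (forall i, a i ord0 <= b i ord0) ->
  lam (cbox a b) = (\prod_(i < d) (b i ord0 - a i ord0))%:E.
Proof. exact: hlam. Qed.

Lemma lebesgue_cbox_lty a b : (lam (cbox a b) < +oo)%E.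
Proof.
have [ab|] := pselect (forall i, a i ord0 <= b i ord0).
  by rewrite lebesgue_cbox// ltry.
move=> /existsNP[i /negP]; rewrite -ltNge => ba.
rewrite (_ : cbox a b = set0) ?measure0//.
apply/seteqP; split => // x /(_ i) /andP[ax xb].
by have := le_trans ax xb; rewrite leNgt ba.
Qed.

Lemma measurable_addl h : measurable_fun setT (fun x : Rd R d => h + x : Rd R d).
Proof. exact: measurable_addRd. Qed.

Lemma measurable_opp : measurable_fun setT (fun x : Rd R d => - (x : 'cV[R]_d) : Rd R d).
Proof. exact: measurable_oppRd. Qed.

Lemma measurable_scale (c : R) :
  measurable_fun setT (fun x : Rd R d => c *: (x : 'cV[R]_d) : Rd R d).
Proof. exact: measurable_scaleRd. Qed.

Lemma measurable_mul (s : 'M[R]_d) :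
  measurable_fun setT (fun x : Rd R d => s *m (x : 'cV[R]_d) : Rd R d).
Proof. exact: (@measurable_mulmxRd _ _ _ _ (cst s : _ -> Md R d)). Qed.

(** Translations, the reflection [x -> - x] and dilations send boxes to boxes, so uniqueness on
    boxes settles them. Rotations do not, and are treated by another argument below. *)
Lemma lebesgue_translate h (A : set (Rd R d)) : measurable A ->
  lam ((fun x : Rd R d => h + x : Rd R d) @^-1` A) = lam A.
Proof.
have E a b : (fun x : Rd R d => h + x : Rd R d) @^-1` cbox a b = cbox (a - h) (b - h).
  apply/seteqP; split => x H i; have := H i; rewrite !mxE.
    by rewrite lerBlDr lerBrDr !(addrC (x i ord0)).
  by rewrite lerBlDr lerBrDr !(addrC (x i ord0)).
move: A; apply: (Rd_measure_unique (m1 := push_measure lam (measurable_addl h))).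
  move=> a b ab; rewrite push_measureE E !lebesgue_cbox//; last first.
    by move=> i; rewrite !mxE lerD2r.
  by congr EFin; apply: eq_bigr => i _; rewrite !mxE opprB addrA subrK.
by move=> a b; rewrite push_measureE E lebesgue_cbox_lty.
Qed.

Lemma lebesgue_opp (A : set (Rd R d)) : measurable A ->
  lam ((fun x : Rd R d => - (x : 'cV[R]_d) : Rd R d) @^-1` A) = lam A.
Proof.
have E a b : (fun x : Rd R d => - (x : 'cV[R]_d) : Rd R d) @^-1` cbox a b = cbox (- b) (- a).
  apply/seteqP; split => x H i; have := H i; rewrite !mxE.
    by move=> /andP[h1 h2]; rewrite lerNl h2 lerNr.
  by move=> /andP[h1 h2]; rewrite lerNr h2 lerNl.
move: A; apply: (Rd_measure_unique (m1 := push_measure lam measurable_opp)).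
  move=> a b ab; rewrite push_measureE E !lebesgue_cbox//; last first.
    by move=> i; rewrite !mxE lerN2.
  by congr EFin; apply: eq_bigr => i _; rewrite !mxE opprK addrC.
by move=> a b; rewrite push_measureE E lebesgue_cbox_lty.
Qed.

Lemma lebesgue_scale (c : R) (A : set (Rd R d)) : 0 < c -> measurable A ->
  lam ((fun x : Rd R d => c *: (x : 'cV[R]_d) : Rd R d) @^-1` A) =
  ((c ^- d)%:E * lam A)%E.
Proof.
move=> c0.
have E a b : (fun x : Rd R d => c *: (x : 'cV[R]_d) : Rd R d) @^-1` cbox a b =
    cbox (c^-1 *: a) (c^-1 *: b).
  apply/seteqP; split => x H i; have := H i; rewrite !mxE.
    by rewrite ler_pdivrMl// ler_pdivlMl.
  by rewrite ler_pdivrMl// ler_pdivlMl.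
have cd0 : 0 <= c ^- d by rewrite invr_ge0 exprn_ge0// ltW.
move: A; apply: (Rd_measure_unique (m1 := push_measure lam (measurable_scale c))
   (m2 := mscale (NngNum cd0) lam)).
  move=> a b ab; rewrite push_measureE E.
  rewrite [RHS](_ : _ = ((c ^- d)%:E * lam (cbox a b))%E)// !lebesgue_cbox//; last first.
    by move=> i; rewrite !mxE ler_pM2l ?invr_gt0.
  rewrite -EFinM; congr EFin; rewrite -exprVn -[in c^-1 ^+ _](card_ord d).
  rewrite -prodr_const -big_split/=.
  by apply: eq_bigr => i _; rewrite !mxE mulrBr.
by move=> a b; rewrite push_measureE E lebesgue_cbox_lty.
Qed.

Lemma lebesgue_sigma_finite : sigma_finite setT lam.
Proof.
exists (fun n => cbox (const_mx (- n%:R)) (const_mx n%:R)).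
  apply/esym/seteqP; split=> // x _.
  exists (Num.trunc (\sum_i `|x i ord0|)).+1 => // i; rewrite !mxE -ler_norml.
  apply: le_trans (ltW (truncnS_gt _)).
  by rewrite (bigD1 i)//= lerDl sumr_ge0.
by move=> n; split; [exact: measurable_cbox|exact: lebesgue_cbox_lty].
Qed.

(** The parameter is the squared radius, so a dilation by [c] multiplies it by [c ^+ 2]. *)
Definition sball (r : R) : set (Rd R d) := [set x : 'cV[R]_d | sqn x < r].

Lemma measurable_sball r : measurable (sball r).
Proof.
have mb : measurable_fun setT (fun x : Rd R d => sqn x < r).
  by apply: measurable_fun_ltr => //; exact: measurable_sqn.
by have := mb measurableT [set true] I; rewrite setTI; exact.
Qed.

Lemma lebesgue_sball_lty r : (lam (sball r) < +oo)%E.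
Proof.
apply: le_lt_trans (lebesgue_cbox_lty (const_mx (- (r + 1))) (const_mx (r + 1))).
apply: le_measure; rewrite ?inE; [exact: measurable_sball|exact: measurable_cbox|].
move=> x xr i; rewrite !mxE -ler_norml.
have [r0|r0] := leP 0 r; last by have := sqn_ge0 x; rewrite leNgt (lt_trans xr r0).
have : `|x i ord0| ^+ 2 <= (r + 1) ^+ 2.
  rewrite -normrX ger0_norm ?sqr_ge0//; apply: le_trans (entry_le_sqn _ _) _.
  by apply: le_trans (ltW xr) _; rewrite sqrrD; nra.
by rewrite ler_pXn2r// nnegrE// addr_ge0.
Qed.

Lemma lebesgue_sball_gt0 r : 0 < r -> (0 < lam (sball r))%E.
Proof.
move=> r0; pose e := Num.sqrt (r / (d.+1)%:R).
have e0 : 0 < e by rewrite sqrtr_gt0 divr_gt0.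
apply: (@lt_le_trans _ _ (lam (cbox (const_mx 0) (const_mx e)))).
  rewrite lebesgue_cbox; last by move=> i; rewrite !mxE ltW.
  by rewrite lte_fin prodr_gt0// => i _; rewrite !mxE subr0.
apply: le_measure; rewrite ?inE; [exact: measurable_cbox|exact: measurable_sball|].
move=> x xe; rewrite /sball/= sqnE.
apply: (@le_lt_trans _ _ (\sum_(i < d) (r / (d.+1)%:R))).
  apply: ler_sum => i _; have := xe i; rewrite !mxE => /andP[x0 xle].
  have <- : e ^+ 2 = r / (d.+1)%:R by rewrite sqr_sqrtr// divr_ge0// ltW.
  by rewrite ler_pXn2r// nnegrE// ltW.
rewrite sumr_const card_ord -[X in X < _]mulr_natr -mulrA gtr_pMr// ltr_pdivrMl// mulr1.
by rewrite ltr_nat.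
Qed.

(** A convolution argument using only translation invariance. The unit ball [B] is preserved by [s],
    and computing the double integral of [1_A (s x) 1_B (y - s x)] in both orders gives
    [lam (s^-1 A) * lam B = lam A * lam B]; the factor [lam B] is positive and finite. *)
Lemma lebesgue_orthogonal (s : 'M[R]_d) (A : set (Rd R d)) : s^T *m s = 1%:M ->
  measurable A ->
  lam ((fun x : Rd R d => s *m (x : 'cV[R]_d) : Rd R d) @^-1` A) = lam A.
Proof.
move=> ss mA; have ss' : s *m s^T = 1%:M by exact: mulmx1C.
set B := sball 1; have mB : measurable B := measurable_sball 1.
pose f (x y : Rd R d) : \bar R := ((\1_A (s *m x))%:E * (\1_B y)%:E)%E.
pose h (x y : Rd R d) : \bar R := ((\1_A (s *m x))%:E * (\1_B (y - s *m x))%:E)%E.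
pose k (x y : Rd R d) : \bar R := ((\1_A (s *m x + y))%:E * (\1_B x)%:E)%E.
have mI (C : set (Rd R d)) : measurable C ->
   measurable_fun setT (fun x : Rd R d => (\1_C x)%:E : \bar R).
  by move=> mC; apply/measurable_EFinP; exact: measurable_indic.
have mh : measurable_fun setT (fun z : Rd R d * Rd R d => h z.1 z.2).
  apply: emeasurable_funM.
    by apply: (measurableT_comp (mI _ mA)); apply: measurable_mulmxRd.
  apply: (measurableT_comp (mI _ mB)); apply: measurable_subRd => //.
  exact: measurable_mulmxRd.
have mk : measurable_fun setT (fun z : Rd R d * Rd R d => k z.1 z.2).
  apply: emeasurable_funM; last exact: (measurableT_comp (mI _ mB)).
  apply: (measurableT_comp (mI _ mA)); apply: measurable_addRd => //.
  exact: measurable_mulmxRd.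
have S := lebesgue_sigma_finite.
have msA : measurable ((fun x : Rd R d => s *m (x : 'cV[R]_d) : Rd R d) @^-1` A).
  by rewrite -[X in measurable X]setTI; exact: measurable_mul.
have B0 : lam B != 0%E by rewrite gt_eqF// lebesgue_sball_gt0.
have Boo : (lam B < +oo)%E := lebesgue_sball_lty 1.
suff : (lam ((fun x : Rd R d => s *m (x : 'cV[R]_d) : Rd R d) @^-1` A) * lam B =
        lam A * lam B)%E.
  have Bf : lam B \is a fin_num by rewrite ge0_fin_numE.
  rewrite -(fineK Bf) => /(congr1 (fun z => z * ((fine (lam B))^-1)%:E)%E).
  have fB : fine (lam B) != 0 by rewrite fine_eq0.
  by rewrite -!muleA -!EFinM divff// !mule1.
transitivity (\int[lam]_x \int[lam]_y f x y)%E.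
  rewrite -(setIT (_ @^-1` A)) -integral_indic//.
  rewrite -ge0_integralZr//; last first.
    exact: (measurableT_comp (mI _ mA) (measurable_mul s)).
  apply: eq_integral => x _.
  rewrite /f ge0_integralZl//; last exact: mI.
  by rewrite integral_indic// setIT.
transitivity (\int[lam]_x \int[lam]_y h x y)%E.
  apply: eq_integral => x _.
  rewrite -(integral_preserving (measurable_addl (- (s *m x)))
     (fun C => lebesgue_translate (- (s *m x)) (A := C)) (g := f x)); last first.
    by apply: emeasurable_funM => //; exact: mI.
  by apply: eq_integral => y _; rewrite /f /h addrC.
have h0 x y : (0 <= h x y)%E by rewrite mule_ge0.
have k0 x y : (0 <= k x y)%E by rewrite mule_ge0.
rewrite (tonelli S S mh h0).
(* Shifting [x] by [s^T y] turns [s x] into [s x + y] and [y - s x] into [- s x], which lies in [B]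
   exactly when [x] does. *)
transitivity (\int[lam]_y \int[lam]_x k x y)%E.
  apply: eq_integral => y _.
  rewrite -(integral_preserving (measurable_addl (s^T *m y))
     (fun C => lebesgue_translate (s^T *m y) (A := C)) (g := h ^~ y)); last first.
    exact: (measurableT_comp mh (pair2_measurable y)).
  apply: eq_integral => x _; rewrite /h /k mulmxDr mulmxA ss' mul1mx.
  rewrite opprD addrA subrr add0r (addrC y); congr (_ * (_)%:E)%E.
  have BE u : (u \in B) = (sqn u < 1) by apply/idP/idP; rewrite inE.
  by rewrite !indicE !BE sqnN sqn_orthogonal.
rewrite -(tonelli S S mk k0).
transitivity (\int[lam]_x (lam A * (\1_B x)%:E))%E; last first.
  by rewrite ge0_integralZl// ?integral_indic// ?setIT//; exact: mI.
apply: eq_integral => x _.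
transitivity (\int[lam]_y ((\1_A y)%:E * (\1_B x)%:E))%E; last first.
  by rewrite ge0_integralZr// ?integral_indic// ?setIT//; exact: mI.
rewrite -(integral_preserving (measurable_addl (s *m x))
     (fun C => lebesgue_translate (s *m x) (A := C)) (g := fun y : Rd R d => ((\1_A y)%:E * (\1_B x)%:E)%E)) //.
by apply: emeasurable_funM => //; exact: mI.
Qed.

End LebesgueInvariance.

(** A positive factor preserves infinities, so the identity survives indeterminate differences;
    [integral_scale] applies it to functions that may fail to be integrable. *)
Lemma muleB_gt0 {R : realType} (k : R) (A B : \bar R) : 0 < k ->
  (k%:E * A - k%:E * B = k%:E * (A - B))%E.
Proof.
move=> k0; move: A B => [a| |] [b| |].
- by rewrite -!EFinM -EFinB -mulrBr.
all: by rewrite /= ?gt0_mulye ?gt0_mulNye ?gt0_muley ?gt0_muleNy ?lte_fin//= ?gt0_muley ?gt0_muleNy ?lte_fin.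
Qed.

Section LebesgueIntegral.
Context {R : realType} {d : nat} (lam : {measure set (Rd R d) -> \bar R}).
Hypothesis hlam : is_lebesgue_Rd lam.

Lemma integral_translate (h : 'cV[R]_d) (g : Rd R d -> \bar R) :
  measurable_fun setT g -> (\int[lam]_x g (h + x : 'cV[R]_d)%R = \int[lam]_x g x)%E.
Proof.
exact: (integral_preserving (measurable_addl h)
  (fun C => lebesgue_translate hlam h (A := C))).
Qed.

Lemma Rintegral_translate (h : 'cV[R]_d) (g : Rd R d -> R) :
  measurable_fun setT g -> \int[lam]_x g (h + x : 'cV[R]_d) = \int[lam]_x g x.
Proof.
exact: (Rintegral_preserving (measurable_addl h)
  (fun C => lebesgue_translate hlam h (A := C))).
Qed.

Lemma Rintegral_opp (g : Rd R d -> R) :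
  measurable_fun setT g -> \int[lam]_x g (- x : 'cV[R]_d) = \int[lam]_x g x.
Proof.
exact: (Rintegral_preserving measurable_opp (fun C => lebesgue_opp hlam (A := C))).
Qed.

Lemma integral_orthogonal (s : 'M[R]_d) (g : Rd R d -> \bar R) :
  s^T *m s = 1%:M ->
  measurable_fun setT g -> (\int[lam]_x g (s *m x : 'cV[R]_d) = \int[lam]_x g x)%E.
Proof.
move=> ss; exact: (integral_preserving (measurable_mul s)
  (fun C => lebesgue_orthogonal hlam (A := C) ss)).
Qed.

Lemma Rintegral_orthogonal (s : 'M[R]_d) (g : Rd R d -> R) :
  s^T *m s = 1%:M ->
  measurable_fun setT g -> \int[lam]_x g (s *m x : 'cV[R]_d) = \int[lam]_x g x.
Proof.
move=> ss; exact: (Rintegral_preserving (measurable_mul s)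
  (fun C => lebesgue_orthogonal hlam (A := C) ss)).
Qed.

Lemma integral_scale (c : R) (g : Rd R d -> \bar R) : 0 < c ->
  measurable_fun setT g ->
  (\int[lam]_x g (c *: x : 'cV[R]_d) = (c ^- d)%:E * \int[lam]_x g x)%E.
Proof.
move=> c0; have cd0 : 0 <= c ^- d by rewrite invr_ge0 exprn_ge0// ltW.
have H (h : Rd R d -> \bar R) : measurable_fun setT h -> (forall x, 0 <= h x)%E ->
    (\int[lam]_x h (c *: x : 'cV[R]_d) = (c ^- d)%:E * \int[lam]_x h x)%E.
  move=> mh h0; rewrite -(ge0_integral_push lam (measurable_scale c) mh h0).
  have H := ge0_integral_mscale lam measurableT (NngNum cd0) mh (fun x _ => h0 x).
  rewrite -[RHS]H.
  by apply: eq_measure_integral => A mA _; exact: (lebesgue_scale hlam c0 mA).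
move=> mg; rewrite integralE [in RHS]integralE.
have -> : (\int[lam]_x (fun x : Rd R d => g (c *: x : 'cV[R]_d))^\+ x =
    (c ^- d)%:E * \int[lam]_x g^\+ x)%E.
  rewrite -H//; last exact: measurable_funepos.
  apply: eq_integral => x _.
  by rewrite (funepos_comp g (fun x : Rd R d => c *: x : 'cV[R]_d)).
have -> : (\int[lam]_x (fun x : Rd R d => g (c *: x : 'cV[R]_d))^\- x =
    (c ^- d)%:E * \int[lam]_x g^\- x)%E.
  rewrite -H//; last exact: measurable_funeneg.
  apply: eq_integral => x _.
  by rewrite (funeneg_comp g (fun x : Rd R d => c *: x : 'cV[R]_d)).
by rewrite muleB_gt0// invr_gt0 exprn_gt0.
Qed.

Lemma Rintegral_scale (c : R) (g : Rd R d -> R) : 0 < c ->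
  measurable_fun setT g ->
  \int[lam]_x g (c *: x : 'cV[R]_d) = c ^- d * \int[lam]_x g x.
Proof.
move=> c0 mg; rewrite /Rintegral.
rewrite (integral_scale c0 (g := EFin \o g)); last exact/measurable_EFinP.
have cd0 : 0 < c ^- d by rewrite invr_gt0 exprn_gt0.
(* An infinite integral stays infinite after multiplication by [c ^- d], and [fine] sends both sides
   to 0. *)
case: (\int[lam]_x (g x)%:E)%E => [r| |] //=.
- by rewrite mulry gtr0_sg// mul1e mulr0.
- by rewrite mulrNy gtr0_sg// mul1e mulr0.
Qed.

End LebesgueIntegral.

(** * Gaussian integrals and the Fourier transform of a Gaussian *)

Section Gauss.
Context {R : realType} {d : nat} (lam : {measure set (Rd R d) -> \bar R}).
Hypothesis hlam : is_lebesgue_Rd lam.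
Implicit Types (x : 'cV[R]_d) (s : R).

Definition gauss s x : R := expR (- (s * sqn x)).

Lemma gauss_ge0 s x : 0 <= gauss s x. Proof. exact: expR_ge0. Qed.

Lemma gauss_gt0 s x : 0 < gauss s x. Proof. exact: expR_gt0. Qed.

Lemma gauss_le1 s x : 0 <= s -> gauss s x <= 1.
Proof.
by move=> s0; rewrite -expR0 ler_expR oppr_le0 mulr_ge0// sqn_ge0.
Qed.

Lemma gauss_decr s s' x : s <= s' -> gauss s' x <= gauss s x.
Proof. by move=> ss; rewrite ler_expR lerN2 ler_wpM2r// sqn_ge0. Qed.

(** Half of the exponent absorbs the polynomial factor, by [1 + u <= expR u] at
    [u = s / 2 * sqn x]. *)
Lemma sqn_gauss s x : 0 < s -> sqn x * gauss s x <= 2 / s * gauss (s / 2) x.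
Proof.
move=> s0; have -> : gauss s x = gauss (s / 2) x * gauss (s / 2) x.
  by rewrite -expRD; congr expR; field.
rewrite mulrA ler_wpM2r ?gauss_ge0// ler_pdivlMr// mulrC mulrA.
rewrite -ler_pdivlMr ?gauss_gt0// /gauss expRN invrK.
have := expR_ge1Dx (s / 2 * sqn x); rewrite -(ler_pM2l (ltr0n R 2)).
by apply: le_trans; rewrite mulrDr; lra.
Qed.

Lemma measurable_gauss s : measurable_fun setT (gauss s : Rd R d -> R).
Proof.
apply: measurableT_comp; first exact: measurable_expR.
apply: measurableT_comp => //; apply: measurable_funM => //; exact: measurable_sqn.
Qed.

(** Dilation by 2 relates the integral [I n.+1] over the ball of radius [2 ^+ n.+1] to that of the
    narrower [gauss 4] over the ball of radius [2 ^+ n]. The latter is a small multiple of [gauss 1]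
    away from a fixed ball, so [I] satisfies a contracting recursion, stays bounded, and monotone
    convergence concludes. *)
Lemma gauss1_integral_lty : (\int[lam]_x (gauss 1 x)%:E < +oo)%E.
Proof.
pose I n := (\int[lam]_x (\1_(@sball R d ((2 ^+ n) ^+ 2)) x * gauss 1 x)%:E)%E.
have mI (r : R) : measurable_fun setT (fun x : Rd R d => \1_(@sball R d r) x * gauss 1 x).
  by apply: measurable_funM; [apply: measurable_indic; exact: measurable_sball|exact: measurable_gauss].
have ind0 (A : set (Rd R d)) x : 0 <= \1_A x :> R by rewrite indicE.
have ig0 (A : set (Rd R d)) x : 0 <= \1_A x * gauss 1 x by rewrite mulr_ge0// gauss_ge0.
have Ioo n : (I n < +oo)%E.
  apply: le_lt_trans (lebesgue_sball_lty hlam ((2 ^+ n) ^+ 2)).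
  rewrite -(setIT (@sball R d _)) -integral_indic//; last exact: measurable_sball.
  apply: ge0_le_integral_weak => x _; rewrite lee_fin//.
  by rewrite ler_piMr// gauss_le1.
(* One power of 2 above the Jacobian [2 ^+ d] of the doubling, so that the recursion contracts by
   [2^-1]. *)
pose q : R := 2 ^+ d.+1.
have q1 : 1 <= q by rewrite exprn_ege1// ler1n.
have q0 : 0 < q by rewrite exprn_gt0.
have pw x : gauss 4 x <= q^-1 * gauss 1 x + \1_(@sball R d q) x.
  have [xq|xq] := ltP (sqn x) q.
    rewrite [\1_ _ _]indicE mem_set// -[leLHS]add0r lerD// ?gauss_le1//.
    by rewrite mulr_ge0 ?invr_ge0 ?gauss_ge0// ltW.
  rewrite -[leLHS]addr0 lerD//.
  have -> : gauss 4 x = expR (- (3 * sqn x)) * gauss 1 x.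
    by rewrite -expRD; congr expR; ring.
  rewrite ler_wpM2r ?gauss_ge0// expRN lef_pV2 ?posrE ?expR_gt0//.
  apply: le_trans xq _; apply: le_trans (expR_ge1Dx _).
  by have := sqn_ge0 x; lra.
pose V := fine (lam (@sball R d q)).
have VE : lam (@sball R d q) = V%:E.
  by rewrite fineK// ge0_fin_numE// lebesgue_sball_lty.
have step n : (I n.+1 <= 2^-1%:E * I n + (2 ^+ d * V)%:E)%E.
  have -> : I n.+1 = ((2 ^+ d)%:E * \int[lam]_x (\1_(@sball R d ((2 ^+ n) ^+ 2)) x * gauss 4 x)%:E)%E.
    have := integral_scale hlam (c := 2) (g := fun x : Rd R d =>
      (\1_(@sball R d ((2 ^+ n.+1) ^+ 2)) x * gauss 1 x)%:E) (ltr0n _ 2).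
    move=> /(_ _)/(congr1 (fun z => (2 ^+ d)%:E * z)%E) H.
    rewrite muleA -EFinM divff ?expf_neq0// mul1e in H.
    rewrite /I -H; last exact/measurable_EFinP.
    congr (_ * _)%E; apply: eq_integral => x _; congr (_%:E).
    congr (_ * _); last by rewrite /gauss sqnZ; congr expR; ring.
    rewrite !indicE; congr (nat_of_bool _)%:R; apply/idP/idP; rewrite !inE /sball/= sqnZ.
      by rewrite (exprS 2 n) exprMn ltr_pM2l// exprn_gt0.
    by rewrite (exprS 2 n) exprMn ltr_pM2l// exprn_gt0.
  apply: (@le_trans _ _ ((2 ^+ d)%:E * \int[lam]_x (q^-1 * (\1_(@sball R d ((2 ^+ n) ^+ 2)) x * gauss 1 x) + \1_(@sball R d q) x)%:E)%E).
    apply: lee_wpmul2l; first by rewrite lee_fin exprn_ge0.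
    apply: ge0_le_integral_weak => x _; rewrite lee_fin.
      by rewrite mulr_ge0 ?gauss_ge0.
    rewrite indicE; case: (_ \in _); last by rewrite !mul0r mulr0 add0r.
    by rewrite !mul1r.
  under eq_integral do rewrite EFinD.
  rewrite ge0_integralD//; last 3 first.
  - by move=> x _; rewrite lee_fin mulr_ge0 ?invr_ge0 ?ig0// ltW.
  - by apply/measurable_EFinP; apply: measurable_funM.
  - apply/measurable_EFinP; apply: measurable_indic; exact: measurable_sball.
  rewrite integral_indic ?setIT//; last exact: measurable_sball.
  under eq_integral do rewrite EFinM.
  rewrite ge0_integralZl_EFin//; last 3 first.
  - by move=> x _; rewrite lee_fin.
  - exact/measurable_EFinP.
  - by rewrite invr_ge0 ltW.
  rewrite VE ge0_muleDr; last 2 first.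
  - apply: mule_ge0; first by rewrite lee_fin invr_ge0 ltW.
    by apply: integral_ge0 => x _; rewrite lee_fin.
  - by rewrite lee_fin fine_ge0.
  rewrite muleA -!EFinM (_ : 2 ^+ d * q^-1 = 2^-1)//.
  by rewrite /q exprS invfM mulrC -mulrA mulVf ?mulr1// expf_neq0.
(* Any [M] at least twice the additive term is preserved by [I -> I / 2 + 2 ^+ d * V]. *)
pose M := Num.max (fine (I 0%N)) (2 * (2 ^+ d * V)).
have I0 n : (0 <= I n)%E by apply: integral_ge0 => x _; rewrite lee_fin.
have bound n : (I n <= M%:E)%E.
  elim: n => [|n IH].
    by rewrite -(fineK (_ : I 0%N \is a fin_num)) ?lee_fin ?le_max ?lexx// ge0_fin_numE.
  apply: le_trans (step n) _.
  apply: (@le_trans _ _ ((2^-1)%:E * M%:E + (2 ^+ d * V)%:E)%E).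
    by apply: leeD2r; apply: lee_wpmul2l => //; rewrite lee_fin invr_ge0.
  rewrite -EFinM -EFinD lee_fin.
  have : 2 * (2 ^+ d * V) <= M by rewrite le_max lexx orbT.
  by lra.
suff : (\int[lam]_x (gauss 1 x)%:E <= M%:E)%E by move=> /le_lt_trans; apply; rewrite ltry.
pose g n (x : Rd R d) := (\1_(@sball R d ((2 ^+ n) ^+ 2)) x * gauss 1 x)%:E.
have gl x : limn (g ^~ x) = (gauss 1 x)%:E.
  apply/cvg_lim => //; apply: cvg_near_cst.
  near=> n; rewrite /g indicE mem_set ?mul1r//=.
  rewrite /sball/=; apply: (@lt_le_trans _ _ (Num.trunc (sqn x)).+1%:R).
    exact: truncnS_gt.
  apply: (@le_trans _ _ (2 ^+ n)).
    rewrite -natrX ler_nat; apply: (leq_trans _ (ltnW (ltn_expl n (leqnn 2)))).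
    by near: n; exact: nbhs_infty_ge.
  by rewrite -[leLHS]expr1 ler_weXn2l// exprn_ege1// ler1n.
have gnd x n m : (n <= m)%N -> (g n x <= g m x)%E.
  move=> nm; rewrite lee_fin ler_wpM2r ?gauss_ge0// !indicE ler_nat.
  have [|] := boolP (x \in @sball R d _) => //; rewrite inE => xn.
  rewrite mem_set//; apply: lt_le_trans xn _.
  by rewrite -!exprM ler_weXn2l ?ler1n// leq_mul2r nm.
have -> : (\int[lam]_x (gauss 1 x)%:E = \int[lam]_x limn (g ^~ x))%E.
  by apply: eq_integral => x _; rewrite gl.
rewrite monotone_convergence//; last 3 first.
- by move=> n; exact/measurable_EFinP.
- by move=> n x _; rewrite lee_fin.
- by move=> x _ n m; exact: gnd.
apply: lime_le; last by apply: nearW => n; exact: bound.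
apply: ereal_nondecreasing_is_cvgn => n m nm.
by apply: ge0_le_integral_weak => x _; [rewrite lee_fin|exact: gnd].
Unshelve. all: by end_near. Qed.

(** Equal to [(pi / s)^(d / 2)]; only its positivity and its scaling law enter. *)
Definition Zg s : R := \int[lam]_x gauss s x.

Lemma gauss_scale c s x : gauss s (c *: x) = gauss (c ^+ 2 * s) x.
Proof. by rewrite /gauss sqnZ; congr expR; ring. Qed.

Lemma integrable_gauss s : 0 < s -> lam.-integrable setT (EFin \o gauss s).
Proof.
move=> s0; apply: ge0_integrable => [|x|]; [exact: measurable_gauss|exact: gauss_ge0|].
have s2 : 0 < Num.sqrt s by rewrite sqrtr_gt0.
have := integral_scale hlam s2 (g := EFin \o gauss 1).
move=> /(_ _)/= H.
have E x : gauss s x = gauss 1 (Num.sqrt s *: x).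
  by rewrite gauss_scale sqr_sqrtr ?mulr1// ltW.
under eq_integral do rewrite E.
rewrite H; last by apply/measurable_EFinP; exact: measurable_gauss.
apply: lte_mul_pinfty => //.
exact: gauss1_integral_lty.
Qed.

Lemma Zg_scale c s : 0 < c -> Zg (c ^+ 2 * s) = c ^- d * Zg s.
Proof.
move=> c0; rewrite -(Rintegral_scale hlam c0); last exact: measurable_gauss.
by apply: eq_Rintegral => x _; rewrite gauss_scale.
Qed.

Lemma EFin_Zg s : 0 < s -> (\int[lam]_x (gauss s x)%:E)%E = (Zg s)%:E.
Proof. by move=> s0; rewrite EFin_Rintegral//; exact: integrable_gauss. Qed.

Lemma Zg_gt0 s : 0 < s -> 0 < Zg s.
Proof.
move=> s0; rewrite -lte_fin -EFin_Zg//.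
apply: (@lt_le_trans _ _ (\int[lam]_x (expR (- s) * \1_(@sball R d 1) x)%:E)%E).
  under eq_integral do rewrite EFinM.
  rewrite ge0_integralZl_EFin ?expR_ge0//; last first.
    by apply/measurable_EFinP; apply: measurable_indic; exact: measurable_sball.
  rewrite integral_indic ?setIT//; last exact: measurable_sball.
  by rewrite mule_gt0 ?lte_fin ?expR_gt0 ?lebesgue_sball_gt0.
apply: ge0_le_integral_weak => x _; rewrite lee_fin ?mulr_ge0 ?expR_ge0//.
rewrite indicE; have [|] := boolP (x \in _); last by rewrite mulr0 gauss_ge0.
rewrite inE /sball/= => x1; rewrite mulr1 ler_expR lerN2.
by rewrite ler_piMr// ltW.
Qed.

End Gauss.

Lemma is_derive_Rintegral {R : realType} {dd} {T : measurableType dd}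
  (m : {measure set T -> \bar R}) (f f' : R -> T -> R) (G : T -> R) (t : R) :
  (forall r, r \in `]t - 1, t + 1[ -> m.-integrable setT (EFin \o f r)) ->
  (forall (r : R) (y : T), is_derive r (1 : R) (f ^~ y) (f' r y)) ->
  (forall y, 0 <= G y) -> m.-integrable setT (EFin \o G) ->
  (forall r y, r \in `]t - 1, t + 1[ -> `|f' r y| <= G y) ->
  is_derive t (1 : R) (fun r => \int[m]_y f r y) (\int[m]_y f' t y).
Proof.
move=> fi df G0 Gi fG.
have pf r y : partial1of2 f r y = f' r y.
  by rewrite partial1of2E; have /@derive_val := df r y.
have Ia : (`]t - 1, t + 1[%classic : set R) t.
  by rewrite /= in_itv/=; apply/andP; split; lra.
have I1 r : (`]t - 1, t + 1[%classic : set R) r -> m.-integrable setT (EFin \o f r).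
  by move=> tr; exact: fi.
have I2 r y : (`]t - 1, t + 1[%classic : set R) r -> [set: T] y -> derivable (f ^~ y) r 1.
  by move=> _ _; have /@ex_derive := df r y.
have I4 r y : (`]t - 1, t + 1[%classic : set R) r -> [set: T] y -> `|partial1of2 f r y| <= G y.
  by move=> tr _; rewrite pf; exact: fG.
apply: DeriveDef; first exact: (derivable_under_integral measurableT Ia I1 I2 G0 Gi I4).
rewrite -derive1E (differentiation_under_integral measurableT Ia I1 I2 G0 Gi I4).
by apply: eq_Rintegral => y _; rewrite pf.
Qed.

Section GaussFourier.
Context {R : realType} {d : nat} (lam : {measure set (Rd R d) -> \bar R}).
Hypothesis hlam : is_lebesgue_Rd lam.
Implicit Types (s : R).

Section Fixed.
Variables (s : R) (x : 'cV[R]_d).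
Hypothesis s0 : 0 < s.
Let a := sqn x.
Let a0 : 0 <= a. Proof. exact: sqn_ge0. Qed.
(** Along the line [t x] the transform [F] satisfies [F' = - S], while [S] is a multiple of [t F] by
    [shift]; [cos_gauss] is the solution of this linear differential equation. *)
Let F (t : R) := \int[lam]_y (cos (t * dot x y) * gauss s y).
Let S (t : R) := \int[lam]_y (dot x y * sin (t * dot x y) * gauss s y).

Let mdot : measurable_fun setT (fun y : Rd R d => dot x y).
Proof. exact: (@measurable_dot _ _ _ _ (cst x : _ -> Rd R d)). Qed.

Let msin (t : R) : measurable_fun setT (fun y : Rd R d => sin (t * dot x y)).
Proof.
apply: measurableT_comp; last exact: measurable_funM.
by apply: continuous_measurable_fun; exact: continuous_sin.
Qed.

Let mcos (t : R) : measurable_fun setT (fun y : Rd R d => cos (t * dot x y)).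
Proof.
apply: measurableT_comp; last exact: measurable_funM.
by apply: continuous_measurable_fun; exact: continuous_cos.
Qed.

Let cos_le1 (u : R) : `|cos u| <= 1.
Proof. by rewrite ler_norml cos_geN1 cos_le1. Qed.

Let sin_le1 (u : R) : `|sin u| <= 1.
Proof. by rewrite ler_norml sin_geN1 sin_le1. Qed.

Let iF (t : R) : lam.-integrable setT (EFin \o (fun y => cos (t * dot x y) * gauss s y)).
Proof.
apply: integrable_le (integrable_gauss hlam s0).
  by apply: measurable_funM => //; exact: measurable_gauss.
by move=> y; rewrite normrM (ger0_norm (gauss_ge0 _ _)) ler_piMl ?gauss_ge0.
Qed.

Let dot_bound y : `|dot x y| <= a + sqn y.
Proof.
have := dot_young x y ltr01; rewrite invr1 !mul1r -/a => H.
by have := normr_ge0 (dot x y); lra.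
Qed.

Let G (y : Rd R d) := (a + 2 / s) * gauss (s / 2) y.

Let G_ub y : `|dot x y| * gauss s y <= G y.
Proof.
apply: (@le_trans _ _ ((a + sqn y) * gauss s y)); first by rewrite ler_wpM2r ?gauss_ge0.
rewrite /G [leLHS]mulrDl [leRHS]mulrDl; apply: lerD; last exact: sqn_gauss.
apply: ler_wpM2l => //; apply: gauss_decr.
by rewrite ler_pdivrMr// ler_peMr ?ltW// ltr1n.
Qed.

Let iG : lam.-integrable setT (EFin \o G).
Proof.
by apply: Rintegrable_mull; apply: integrable_gauss => //; rewrite divr_gt0.
Qed.

Let iS (t : R) : lam.-integrable setT
  (EFin \o (fun y => dot x y * sin (t * dot x y) * gauss s y)).
Proof.
apply: integrable_le iG.
  by apply: measurable_funM; [exact: measurable_funM|exact: measurable_gauss].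
move=> y; rewrite !normrM (ger0_norm (gauss_ge0 _ _)).
apply: le_trans (G_ub y); rewrite ler_wpM2r ?gauss_ge0//.
by rewrite ler_piMr.
Qed.

Let derF (t : R) : is_derive t (1 : R) F (- S t).
Proof.
pose f' (r : R) (y : Rd R d) := - 1 * (dot x y * sin (r * dot x y) * gauss s y).
have mf' : measurable_fun setT (fun y : Rd R d => dot x y * sin (t * dot x y) * gauss s y).
  by apply: measurable_funM; [exact: measurable_funM|exact: measurable_gauss].
have bnd r y : `|dot x y * sin (r * dot x y) * gauss s y| <= G y.
  rewrite !normrM (ger0_norm (gauss_ge0 _ _)).
  apply: le_trans (G_ub y); rewrite ler_wpM2r ?gauss_ge0//.
  by rewrite ler_piMr.
apply: is_derive_eq.
  apply: (@is_derive_Rintegral _ _ _ lam (fun r y => cos (r * dot x y) * gauss s y) f' G).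
  - by move=> r _; exact: iF.
  - move=> r y; rewrite /f'; apply: is_derive_eq; rewrite /GRing.scale/=; ring.
  - by move=> y; rewrite mulr_ge0 ?gauss_ge0// addr_ge0// divr_ge0// ltW.
  - exact: iG.
  - by move=> r y _; rewrite /f' mulN1r normrN.
by rewrite /f' RintegralZl ?mulN1r//; apply: integrable_le iG.
Qed.

(** This is integration by parts in the direction [x]. The integral of the shifted function [q h] is
    constant in [h] by translation invariance, and differentiating it at [h = 0] under the integral
    gives the relation. *)
Let shift (t : R) : 2 * s * S t = t * a * F t.
Proof.
pose q (h : R) (y : Rd R d) := sin (t * dot x (y + h *: x)) * gauss s (y + h *: x).
pose q' (h : R) (y : Rd R d) :=
  (t * a * cos (t * dot x (y + h *: x))
   - s * (2 * dot x y + 2 * h * a) * sin (t * dot x (y + h *: x))) * gauss s (y + h *: x).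
pose C := expR (2 * s * a) * (`|t| * a + s * (2 * a + 2 * a)).
pose D := expR (2 * s * a) * (2 * s).
pose K (y : Rd R d) := C * gauss (s / 2) y + D * (sqn y * gauss (s / 2) y).
have mK0 : lam.-integrable setT (EFin \o (fun y : Rd R d => sqn y * gauss (s / 2) y)).
  have s4 : 0 < s / 2 / 2 by rewrite !divr_gt0.
  apply: (integrable_le _ _ (Rintegrable_mull (2 / (s / 2)) (integrable_gauss hlam s4))).
    by apply: measurable_funM; [exact: measurable_sqn|exact: measurable_gauss].
  move=> y; rewrite ger0_norm ?mulr_ge0 ?sqn_ge0 ?gauss_ge0//.
  by apply: sqn_gauss; rewrite divr_gt0.
have s2 : 0 < s / 2 by rewrite divr_gt0.
have iK : lam.-integrable setT (EFin \o K).
  by apply: Rintegrable_add; apply: Rintegrable_mull => //; exact: integrable_gauss.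
(* Young's inequality with weight 2 gives [|y + h x|^2 >= |y|^2 / 2 - 2 a] for [|h| <= 1], a bound
   uniform in [h] as domination requires. *)
have gb h y : `|h| <= 1 -> gauss s (y + h *: x) <= expR (2 * s * a) * gauss (s / 2) y.
  move=> h1; rewrite -expRD ler_expR sqnD dotZr sqnZ.
  have := dot_young x y (ltr0n R 2); rewrite -/a (dotC y x) => Y.
  have := ler_normr (h * dot x y) (- (h * dot x y)).
  have H1 : `|h * dot x y| <= `|dot x y| by rewrite normrM ler_piMl.
  have H2 : - (h * dot x y) <= `|h * dot x y| by rewrite ler_normr lexx orbT.
  have H3 : 0 <= h ^+ 2 * a by rewrite mulr_ge0 ?sqr_ge0.
  by move=> _; nra.
have mq h : measurable_fun setT (q h).
  apply: (measurableT_comp (f := fun z : Rd R d => sin (t * dot x z) * gauss s z)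
    (g := fun y : Rd R d => (y : 'cV[R]_d) + h *: x : Rd R d)).
    by apply: measurable_funM => //; exact: measurable_gauss.
  exact: measurable_addRd.
have in1 (h : R) : h \in `](0 - 1 : R), 0 + 1[ -> `|h| <= 1.
  by rewrite in_itv/= !add0r ler_norml => /andP[/ltW -> /ltW ->].
have q0 : is_derive (0 : R) (1 : R) (fun h => \int[lam]_y q h y) (\int[lam]_y q' 0 y).
  apply: (is_derive_Rintegral (G := K)).
  - move=> h /in1 h1.
    apply: integrable_le (Rintegrable_mull (expR (2 * s * a)) (integrable_gauss hlam s2)) => // y.
    rewrite normrM (ger0_norm (gauss_ge0 _ _)).
    by apply: le_trans (gb h y h1); rewrite ler_piMl ?gauss_ge0.
  - move=> h y; rewrite /q /q'.
    rewrite (_ : (fun h => _) = (fun h => sin (t * (dot x y + h * a)) *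
       expR (- (s * (sqn y + 2 * (h * dot x y) + h ^+ 2 * a))))); last first.
      by apply/funext => r; rewrite /gauss sqnD dotZr sqnZ dotDr dotZr (dotC y).
    rewrite /gauss sqnD dotZr sqnZ dotDr dotZr (dotC y) -/a.
    apply: is_derive_eq; rewrite /GRing.scale/=; ring.
  - have C0 : 0 <= C.
      apply: mulr_ge0; first exact: expR_ge0.
      apply: addr_ge0; first exact: mulr_ge0.
      by apply: mulr_ge0; [exact: ltW|rewrite addr_ge0// mulr_ge0].
    have D0 : 0 <= D by rewrite mulr_ge0 ?expR_ge0// mulr_ge0// ltW.
    move=> y; apply: addr_ge0; first by apply: mulr_ge0 => //; exact: gauss_ge0.
    by apply: mulr_ge0 => //; apply: mulr_ge0; [exact: sqn_ge0|exact: gauss_ge0].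
  - exact: iK.
  - move=> h y /in1 h1; rewrite /q' normrM (ger0_norm (gauss_ge0 _ _)).
    have s1 := ltW s0.
    have Y := dot_young x y ltr01; rewrite invr1 !mul1r -/a in Y.
    apply: (@le_trans _ _ ((`|t| * a + s * (3 * a + sqn y)) * (expR (2 * s * a) * gauss (s / 2) y))).
      apply: ler_pM; rewrite ?gauss_ge0 ?normr_ge0//; last exact: gb.
      apply: le_trans (ler_normB _ _) _; apply: lerD.
        by rewrite !normrM (ger0_norm a0) ler_piMr// mulr_ge0.
      rewrite normrM; apply: (@le_trans _ _ `|s * (2 * dot x y + 2 * h * a)|).
        by rewrite ler_piMr.
      rewrite normrM (ger0_norm s1) ler_wpM2l//.
      apply: le_trans (ler_normD _ _) _; rewrite !normrM (ger0_norm a0) ger0_norm//.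
      have : `|h| * a <= a by rewrite ler_piMl.
      by lra.
    rewrite /K /C /D -subr_ge0.
    rewrite (_ : _ - _ = expR (2 * s * a) * gauss (s / 2) y * (s * (a + sqn y))); last by ring.
    apply: mulr_ge0; first by apply: mulr_ge0; [exact: expR_ge0|exact: gauss_ge0].
    by apply: mulr_ge0 => //; apply: addr_ge0 => //; exact: sqn_ge0.
have qc h : \int[lam]_y q h y = \int[lam]_y q 0 y.
  have <- := Rintegral_translate hlam (- (h *: x)) (mq h).
  apply: eq_Rintegral => y _; rewrite /q scale0r addr0.
  by rewrite (_ : - (h *: x) + y + h *: x = y)// addrC addNKr.
have : \int[lam]_y q' 0 y = 0.
  have /@derive_val <- := q0.
  have -> : (fun h => \int[lam]_y q h y) = cst (\int[lam]_y q 0 y) by apply/funext.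
  exact: derive_cst.
have -> : \int[lam]_y q' 0 y =
    \int[lam]_y (t * a * (cos (t * dot x y) * gauss s y) - 2 * s * (dot x y * sin (t * dot x y) * gauss s y)).
  by apply: eq_Rintegral => y _; rewrite /q' scale0r addr0; ring.
rewrite RintegralB//; [|exact: Rintegrable_mull|by apply: Rintegrable_mull; exact: iS].
rewrite (RintegralZl (t * a) measurableT (iF t)) (RintegralZl (2 * s) measurableT (iS t)).
by move/eqP; rewrite subr_eq0 => /eqP.
Qed.

(** The exponential is the integrating factor of the equation; [H] is constant, and comparing
    [t = 0] with [t = 1] yields the transform. *)
Let H (t : R) := expR (a * t ^+ 2 / (4 * s)) * F t.

Let dH (t : R) : is_derive t (1 : R) H 0.
Proof.
have E : is_derive t (1 : R) (fun r => expR (a * r ^+ 2 / (4 * s)))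
    (expR (a * t ^+ 2 / (4 * s)) * (a * t / (2 * s))).
  by apply: is_derive_eq; rewrite /GRing.scale/=; field; exact: lt0r_neq0.
have M := is_deriveM E (derF t).
apply: (is_derive_eq M); rewrite /GRing.scale/=.
have -> : S t = t * a * F t / (2 * s) by rewrite -shift; field; exact: lt0r_neq0.
by field; exact: lt0r_neq0.
Qed.

Lemma cos_gauss : \int[lam]_y (cos (dot x y) * gauss s y) =
  Zg lam s * expR (- (sqn x / (4 * s))).
Proof.
have := is_derive_0_is_cst 1 0 dH; rewrite /H expr0n mulr0 mul0r expR0 mul1r expr1n mulr1.
rewrite -/a expRN.
have -> : F 0 = Zg lam s.
  by apply: eq_Rintegral => y _; rewrite mul0r cos0 mul1r.
move=> <-; rewrite mulrC mulKf ?gt_eqF ?expR_gt0//.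
by apply: eq_Rintegral => y _; rewrite mul1r.
Qed.

End Fixed.
End GaussFourier.

(** * Cosine and sine transforms, Gaussian Parseval identity and Bessel inequality *)

Lemma measurable_cos {R : realType} {dd} {T : measurableType dd} (f : T -> R) :
  measurable_fun setT f -> measurable_fun setT (fun t => cos (f t)).
Proof.
move=> mf; apply: measurableT_comp => //.
by apply: continuous_measurable_fun; exact: continuous_cos.
Qed.

Lemma measurable_sin {R : realType} {dd} {T : measurableType dd} (f : T -> R) :
  measurable_fun setT f -> measurable_fun setT (fun t => sin (f t)).
Proof.
move=> mf; apply: measurableT_comp => //.
by apply: continuous_measurable_fun; exact: continuous_sin.
Qed.

Lemma normr_cos_le1 {R : realType} (u : R) : `|cos u| <= 1.
Proof. by rewrite ler_norml cos_geN1 cos_le1. Qed.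

Lemma normr_sin_le1 {R : realType} (u : R) : `|sin u| <= 1.
Proof. by rewrite ler_norml sin_geN1 sin_le1. Qed.

Section CosSinTransform.
Context {R : realType} {d : nat} (lam : {measure set (Rd R d) -> \bar R}).
Hypothesis hlam : is_lebesgue_Rd lam.

(** With [sin_transform], the real and imaginary parts of the Fourier transform, with kernel
    [exp (i y.xi)], of the measure of density [w] against [m]. The pair [(m, w)] covers functions on
    R^d ([m = lam]) as well as arbitrary finite measures ([w = cst 1]). *)
Definition cos_transform (m : {measure set (Rd R d) -> \bar R}) (w : Rd R d -> R)
  (xi : 'cV[R]_d) : R := \int[m]_y (w y * cos (dot y xi)).

Definition sin_transform (m : {measure set (Rd R d) -> \bar R}) (w : Rd R d -> R)
  (xi : 'cV[R]_d) : R := \int[m]_y (w y * sin (dot y xi)).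

Let slam := lebesgue_sigma_finite hlam.

Section One.
Variables (m : {measure set (Rd R d) -> \bar R}) (w : Rd R d -> R).
Hypothesis sm : sigma_finite setT m.
Hypothesis wi : m.-integrable setT (EFin \o w).

Let mw : measurable_fun setT w.
Proof. by have /integrableP[/measurable_EFinP] := wi. Qed.

Let wn : m.-integrable setT (EFin \o (fun y => `|w y|)).
Proof. exact: integrable_norm. Qed.

Let mdot2 : measurable_fun setT (fun z : Rd R d * Rd R d => dot z.2 z.1).
Proof. exact: measurable_dot. Qed.

Let mdot1 xi : measurable_fun setT (fun y : Rd R d => dot y xi).
Proof. exact: (@measurable_dot _ _ _ _ id (cst xi : _ -> Rd R d)). Qed.

Lemma integrable_cos_transform xi :
  m.-integrable setT (EFin \o (fun y => w y * cos (dot y xi))).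
Proof.
apply: integrable_le wn; first by apply: measurable_funM => //; exact: measurable_cos.
by move=> y; rewrite normrM ler_piMr// normr_cos_le1.
Qed.

Lemma integrable_sin_transform xi :
  m.-integrable setT (EFin \o (fun y => w y * sin (dot y xi))).
Proof.
apply: integrable_le wn; first by apply: measurable_funM => //; exact: measurable_sin.
by move=> y; rewrite normrM ler_piMr// normr_sin_le1.
Qed.

(** The factor [gauss 1 xi] makes the integrand integrable in both variables, so that Fubini yields
    measurability; being positive, the factor can then be divided out. *)
Lemma measurable_cos_transform :
  measurable_fun setT (cos_transform m w : Rd R d -> R).
Proof.
rewrite (_ : cos_transform m w = fun xi => (gauss 1 xi)^-1 *
    \int[m]_y (gauss 1 xi * (w y * cos (dot y xi)))); last first.
  apply/funext => xi; rewrite RintegralZl//; last exact: integrable_cos_transform.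
  by rewrite mulKf// gt_eqF// gauss_gt0.
apply: measurable_funM.
  rewrite (_ : (fun x => _) = gauss (-1)); first exact: measurable_gauss.
  by apply/funext => x; rewrite /gauss -expRN; congr expR; ring.
apply: (measurable_fubini1 slam sm (u := gauss 1) (v := fun y => `|w y|)) => //.
- apply: measurable_funM.
    by apply: (measurableT_comp (measurable_gauss _)).
  apply: measurable_funM; first exact: measurableT_comp.
  exact: measurable_cos.
- exact: integrable_gauss.
- move=> xi y; rewrite normrM (ger0_norm (gauss_ge0 _ _)) ler_wpM2l ?gauss_ge0//.
  by rewrite normrM ler_piMr// normr_cos_le1.
Qed.

Lemma measurable_sin_transform :
  measurable_fun setT (sin_transform m w : Rd R d -> R).
Proof.
rewrite (_ : sin_transform m w = fun xi => (gauss 1 xi)^-1 *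
    \int[m]_y (gauss 1 xi * (w y * sin (dot y xi)))); last first.
  apply/funext => xi; rewrite RintegralZl//; last exact: integrable_sin_transform.
  by rewrite mulKf// gt_eqF// gauss_gt0.
apply: measurable_funM.
  rewrite (_ : (fun x => _) = gauss (-1)); first exact: measurable_gauss.
  by apply/funext => x; rewrite /gauss -expRN; congr expR; ring.
apply: (measurable_fubini1 slam sm (u := gauss 1) (v := fun y => `|w y|)) => //.
- apply: measurable_funM.
    by apply: (measurableT_comp (measurable_gauss _)).
  apply: measurable_funM; first exact: measurableT_comp.
  exact: measurable_sin.
- exact: integrable_gauss.
- move=> xi y; rewrite normrM (ger0_norm (gauss_ge0 _ _)) ler_wpM2l ?gauss_ge0//.
  by rewrite normrM ler_piMr// normr_sin_le1.
Qed.

Lemma cos_transform_le xi : `|cos_transform m w xi| <= \int[m]_y `|w y|.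
Proof.
apply: le_trans (le_normr_Rintegral measurableT (integrable_cos_transform xi)) _.
apply: le_Rintegral => //; first exact/integrable_norm/integrable_cos_transform.
by move=> y _; rewrite normrM ler_piMr// normr_cos_le1.
Qed.

Lemma sin_transform_le xi : `|sin_transform m w xi| <= \int[m]_y `|w y|.
Proof.
apply: le_trans (le_normr_Rintegral measurableT (integrable_sin_transform xi)) _.
apply: le_Rintegral => //; first exact/integrable_norm/integrable_sin_transform.
by move=> y _; rewrite normrM ler_piMr// normr_sin_le1.
Qed.

End One.

Section Two.
Variables (m1 m2 : {measure set (Rd R d) -> \bar R}) (w1 w2 : Rd R d -> R).
Hypotheses (sm1 : sigma_finite setT m1) (sm2 : sigma_finite setT m2).
Hypothesis wi1 : m1.-integrable setT (EFin \o w1).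
Hypothesis wi2 : m2.-integrable setT (EFin \o w2).
Variable s : R.
Hypothesis s0 : 0 < s.

Let mw1 : measurable_fun setT w1.
Proof. by have /integrableP[/measurable_EFinP] := wi1. Qed.
Let mw2 : measurable_fun setT w2.
Proof. by have /integrableP[/measurable_EFinP] := wi2. Qed.
Let C1 := cos_transform m1 w1.
Let S1 := sin_transform m1 w1.
Let C2 := cos_transform m2 w2.
Let S2 := sin_transform m2 w2.
Let W2 := \int[m2]_y `|w2 y|.

Let inner y : \int[lam]_xi (gauss s xi * (cos (dot y xi) * C2 xi + sin (dot y xi) * S2 xi))
  = Zg lam s * \int[m2]_z (w2 z * gauss (4 * s)^-1 (y - z)).
Proof.
pose f (xi z : Rd R d) := gauss s xi * (w2 z * cos (dot (y - z) xi)).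
have fb xi z : `|f xi z| <= gauss s xi * `|w2 z|.
  rewrite /f normrM (ger0_norm (gauss_ge0 _ _)); apply: ler_wpM2l; first exact: gauss_ge0.
  by rewrite normrM ler_piMr// normr_cos_le1.
have mf : measurable_fun setT (fun z : Rd R d * Rd R d => f z.1 z.2).
  apply: measurable_funM; first by apply: (measurableT_comp (measurable_gauss _)).
  apply: measurable_funM; first exact: measurableT_comp.
  apply: measurable_cos; apply: measurable_dot => //.
  by apply: measurable_subRd.
have ig := integrable_gauss hlam s0.
have wn2 : m2.-integrable setT (EFin \o (fun y => `|w2 y|)) by exact: integrable_norm.
transitivity (\int[lam]_xi \int[m2]_z f xi z).
  apply: eq_Rintegral => xi _.
  rewrite /f RintegralZl//; last first.
    apply: integrable_le wn2 => [|z]; last by rewrite normrM ler_piMr// normr_cos_le1.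
    apply: measurable_funM => //; apply: measurable_cos.
    apply: (@measurable_dot _ _ _ _ (fun z : Rd R d => y - (z : 'cV[R]_d) : Rd R d) (cst xi : _ -> Rd R d)) => //.
    exact: measurable_subRd.
  congr (_ * _); rewrite /C2 /S2 /cos_transform /sin_transform.
  rewrite -!RintegralZl//; try exact: integrable_cos_transform; try exact: integrable_sin_transform.
  rewrite -RintegralD//; last 2 first.
  - by apply: Rintegrable_mull; exact: integrable_cos_transform.
  - by apply: Rintegrable_mull; exact: integrable_sin_transform.
  by apply: eq_Rintegral => z _; rewrite dotBl cosB; ring.
rewrite (Rfubini slam sm2 mf ig wn2 fb) -RintegralZl//; last first.
  apply: integrable_le wn2 => [|z].
    apply: measurable_funM => //; apply: (measurableT_comp (measurable_gauss _)).
    exact: measurable_subRd.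
  by rewrite normrM ler_piMr// ger0_norm ?gauss_ge0// gauss_le1// invr_ge0 mulr_ge0// ltW.
apply: eq_Rintegral => z _; rewrite /f.
under eq_Rintegral do rewrite mulrCA (mulrC (gauss _ _)).
rewrite RintegralZl//; last first.
  apply: integrable_le ig => [|xi].
    apply: measurable_funM; last exact: measurable_gauss.
    by apply: measurable_cos; exact: (@measurable_dot _ _ _ _ (cst (y - z) : _ -> Rd R d)).
  by rewrite normrM (ger0_norm (gauss_ge0 _ _)) ler_piMl ?gauss_ge0// normr_cos_le1.
rewrite cos_gauss// mulrCA; congr (_ * (_ * _)).
by rewrite /gauss mulrC.
Qed.

(** A Gaussian-weighted Parseval identity. The integrand is the real part of one transform times the
    conjugate of the other; by Fubini the integral in [xi] falls on [cos (dot (y - z) xi)], and a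
    Gaussian of rate [s] transforms into one of rate [(4 s)^-1]. Allowing two different measures
    lets the identity serve point masses, [mu] and [lam] alike. *)
Lemma gauss_transform_bilinear :
  \int[lam]_xi (gauss s xi * (C1 xi * C2 xi + S1 xi * S2 xi)) =
  Zg lam s * \int[m1]_y (w1 y * \int[m2]_z (w2 z * gauss (4 * s)^-1 (y - z))).
Proof.
pose f (xi y : Rd R d) := gauss s xi *
   (w1 y * (cos (dot y xi) * C2 xi + sin (dot y xi) * S2 xi)).
have W20 : 0 <= W2 by exact: Rintegral_ge0.
have hb xi y : `|cos (dot y xi) * C2 xi + sin (dot y xi) * S2 xi| <= 2 * W2.
  rewrite mulr2n mulrDl mul1r; apply: le_trans (ler_normD _ _) _; apply: lerD.
    rewrite normrM; apply: le_trans (cos_transform_le wi2 xi).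
    by rewrite ler_piMl// normr_cos_le1.
  rewrite normrM; apply: le_trans (sin_transform_le wi2 xi).
  by rewrite ler_piMl// normr_sin_le1.
have fb xi y : `|f xi y| <= (gauss s xi * (2 * W2)) * `|w1 y|.
  rewrite /f normrM (ger0_norm (gauss_ge0 _ _)) -mulrA; apply: ler_wpM2l; first exact: gauss_ge0.
  by rewrite normrM mulrC ler_wpM2r.
have mC : measurable_fun setT (C2 : Rd R d -> R) by exact: measurable_cos_transform.
have mS : measurable_fun setT (S2 : Rd R d -> R) by exact: measurable_sin_transform.
have mf : measurable_fun setT (fun z : Rd R d * Rd R d => f z.1 z.2).
  apply: measurable_funM; first by apply: (measurableT_comp (measurable_gauss _)).
  apply: measurable_funM; first exact: measurableT_comp.
  apply: measurable_funD; apply: measurable_funM.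
  - by apply: measurable_cos; exact: measurable_dot.
  - exact: (measurableT_comp mC).
  - by apply: measurable_sin; exact: measurable_dot.
  - exact: (measurableT_comp mS).
have ig : lam.-integrable setT (EFin \o (fun xi => gauss s xi * (2 * W2))).
  by apply: Rintegrable_mulr; exact: integrable_gauss.
have wn1 : m1.-integrable setT (EFin \o (fun y => `|w1 y|)) by exact: integrable_norm.
transitivity (\int[lam]_xi \int[m1]_y f xi y).
  apply: eq_Rintegral => xi _; rewrite /f.
  have iC := integrable_cos_transform wi1 xi.
  have iS := integrable_sin_transform wi1 xi.
  rewrite -(RintegralZr (C2 xi) measurableT iC) -(RintegralZr (S2 xi) measurableT iS).
  rewrite -RintegralD//; last 2 first.
  - exact: Rintegrable_mulr.
  - exact: Rintegrable_mulr.
  rewrite -RintegralZl//; last by apply: Rintegrable_add; exact: Rintegrable_mulr.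
  by apply: eq_Rintegral => y _; ring.
have E y : \int[lam]_xi f xi y =
    Zg lam s * (w1 y * \int[m2]_z (w2 z * gauss (4 * s)^-1 (y - z))).
  rewrite mulrCA -inner -RintegralZl//; last first.
    apply: (integrable_le _ _ ig) => [|xi].
      apply: measurable_funM; first exact: measurable_gauss.
      have my := @measurable_dot _ _ _ _ (cst y : _ -> Rd R d) id (measurable_cst _) (@measurable_id _ _ _).
      apply: measurable_funD; apply: measurable_funM => //.
      - exact: measurable_cos.
      - exact: measurable_sin.
    rewrite normrM (ger0_norm (gauss_ge0 _ _)).
    by apply: ler_wpM2l; first exact: gauss_ge0.
  by apply: eq_Rintegral => xi _; rewrite /f; ring.
have Z0 : Zg lam s != 0 by rewrite gt_eqF// Zg_gt0.
rewrite (Rfubini slam sm1 mf ig wn1 fb) -RintegralZl//; last first.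
  have := Rintegrable_mull (Zg lam s)^-1 (integrable_fubini2 slam sm1 mf ig wn1 fb).
  rewrite (_ : (fun y => _) = fun y => w1 y * \int[m2]_z (w2 z * gauss (4 * s)^-1 (y - z)))//.
  by apply/funext => y; rewrite E mulKf.
by apply: eq_Rintegral => y _; rewrite E.
Qed.

End Two.
End CosSinTransform.

Section Autocorrelation.
Context {R : realType} {d : nat} (lam : {measure set (Rd R d) -> \bar R}).
Hypothesis hlam : is_lebesgue_Rd lam.
Variables (f : Rd R d -> R) (M : R).
Hypothesis fi : lam.-integrable setT (EFin \o f).
Hypothesis fM : forall x, `|f x| <= M.

Let slam := lebesgue_sigma_finite hlam.

Let mf : measurable_fun setT f.
Proof. by have /integrableP[/measurable_EFinP] := fi. Qed.

Let msub : measurable_fun setT (fun z : Rd R d * Rd R d => (z.1 : 'cV[R]_d) - z.2 : Rd R d).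
Proof. exact: measurable_subRd. Qed.

Let msub1 v : measurable_fun setT (fun y : Rd R d => (y : 'cV[R]_d) - v : Rd R d).
Proof. exact: measurable_subRd. Qed.

Definition autocorr (v : 'cV[R]_d) : R := \int[lam]_y (f y * f (y - v)).

Lemma Rintegral_subr (g : Rd R d -> R) (v : 'cV[R]_d) : measurable_fun setT g ->
  \int[lam]_y g (y - v : 'cV[R]_d) = \int[lam]_y g y.
Proof.
move=> mg; rewrite -[RHS](Rintegral_translate hlam (- v) mg).
by apply: eq_Rintegral => y _; rewrite addrC.
Qed.

Lemma integrable_subr (g : Rd R d -> R) (v : 'cV[R]_d) :
  lam.-integrable setT (EFin \o g) ->
  lam.-integrable setT (EFin \o (fun y : Rd R d => g (y - v : 'cV[R]_d))).
Proof.
move=> gi; have mg : measurable_fun setT g by have /integrableP[/measurable_EFinP] := gi.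
have := integrable_preserving (measurable_addl (- v))
  (fun C => lebesgue_translate hlam (- v) (A := C)) mg gi.
rewrite (_ : g \o _ = fun y : Rd R d => g (y - v : 'cV[R]_d))//.
by apply/funext => y /=; rewrite addrC.
Qed.

Lemma integrable_sqr : lam.-integrable setT (EFin \o (fun y => f y ^+ 2)).
Proof.
apply: integrable_le (Rintegrable_mull M (integrable_norm fi)) => [|y].
  exact: measurable_funX.
by rewrite normrX expr2 ler_wpM2r.
Qed.

Lemma autocorr_le v : autocorr v <= \int[lam]_y (f y ^+ 2).
Proof.
have i1 := integrable_sqr.
have i2 : lam.-integrable setT (EFin \o (fun y : Rd R d => f (y - v : 'cV[R]_d) ^+ 2)).
  exact: (integrable_subr v i1).
apply: (@le_trans _ _ (\int[lam]_y (2^-1 * (f y ^+ 2 + f (y - v) ^+ 2)))).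
  apply: le_Rintegral => //; last 2 first.
  - by apply: Rintegrable_mull; exact: Rintegrable_add i1 i2.
  - by move=> y _; have := sqr_ge0 (f y - f (y - v)); rewrite sqrrB; lra.
  apply: integrable_le (Rintegrable_mull M (integrable_subr v (integrable_norm fi))) => [|y].
    by apply: measurable_funM => //; exact: (measurableT_comp mf (msub1 v)).
  by rewrite normrM ler_wpM2r.
rewrite RintegralZl//; last exact: (Rintegrable_add i1 i2).
rewrite RintegralD// (Rintegral_subr (g := fun y => f y ^+ 2)); last exact: measurable_funX.
by rewrite le_eqVlt; apply/orP; left; apply/eqP; field.
Qed.

(** The bilinear identity of [f] with itself, after the substitution [z = y - v] and an exchange of
    integrals. *)
Lemma gauss_transform_autocorr (s : R) : 0 < s ->
  \int[lam]_xi (gauss s xi * (cos_transform lam f xi ^+ 2 + sin_transform lam f xi ^+ 2)) =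
  Zg lam s * \int[lam]_v (gauss (4 * s)^-1 v * autocorr v).
Proof.
move=> s0; pose k := gauss (d := d) (4 * s)^-1.
have s4 : 0 < (4 * s)^-1 by rewrite invr_gt0 mulr_gt0.
have mk : measurable_fun setT (k : Rd R d -> R) by exact: measurable_gauss.
under eq_Rintegral do rewrite !expr2.
rewrite (gauss_transform_bilinear hlam slam slam fi fi s0); congr (Zg lam s * _).
pose F (y v : Rd R d) := f y * (f (y - v : 'cV[R]_d) * k v).
have mF : measurable_fun setT (fun z : Rd R d * Rd R d => F z.1 z.2).
  apply: measurable_funM; first exact: (measurableT_comp mf).
  by apply: measurable_funM; [exact: (measurableT_comp mf msub)|exact: (measurableT_comp mk)].
have fb y v : `|F y v| <= `|f y| * (M * k v).
  by rewrite /F !normrM ler_wpM2l// (ger0_norm (gauss_ge0 _ _)) ler_wpM2r ?gauss_ge0.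
have ik : lam.-integrable setT (EFin \o (fun v : Rd R d => M * k v)).
  by apply: Rintegrable_mull; exact: integrable_gauss.
have slice y := integrable_slice2 mF ik fb y.
have msub' y : measurable_fun setT (fun z : Rd R d => y - (z : 'cV[R]_d) : Rd R d).
  exact: measurable_subRd.
have kf y : lam.-integrable setT (EFin \o (fun v : Rd R d => f (y - v : 'cV[R]_d) * k v)).
  apply: integrable_le ik => [|v].
    by apply: measurable_funM => //; exact: (measurableT_comp mf (msub' y)).
  by rewrite normrM (ger0_norm (gauss_ge0 _ _)) ler_wpM2r ?gauss_ge0.
transitivity (\int[lam]_y \int[lam]_v F y v).
  apply: eq_Rintegral => y _.
  rewrite /F.
  rewrite (RintegralZl (f y) measurableT (kf y)).
  congr (f y * _).
  have mg : measurable_fun setT (fun z : Rd R d => f z * k (y - z : 'cV[R]_d)).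
    by apply: measurable_funM => //; exact: (measurableT_comp mk (msub' y)).
  rewrite -(Rintegral_translate hlam y mg).
  rewrite -(Rintegral_opp hlam (g := fun z : Rd R d => f (y + z : 'cV[R]_d) * k (y - (y + z) : 'cV[R]_d))).
    by apply: eq_Rintegral => v _; congr (_ * k _); rewrite opprB addrCA subrr addr0.
  exact: (measurableT_comp mg (measurable_addl y)).
rewrite (Rfubini slam slam mF (integrable_norm fi) ik fb).
apply: eq_Rintegral => v _; rewrite /autocorr -RintegralZl//.
  by apply: eq_Rintegral => y _; rewrite /F mulrA mulrC.
apply: integrable_le (Rintegrable_mulr M (integrable_norm fi)) => [|y].
  by apply: measurable_funM => //; exact: (measurableT_comp mf (msub1 v)).
by rewrite normrM ler_wpM2l.
Qed.

Lemma measurable_autocorr : measurable_fun setT (autocorr : Rd R d -> R).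
Proof.
rewrite (_ : autocorr = fun v => (gauss 1 v)^-1 *
    \int[lam]_y (gauss 1 v * (f y * f (y - v)))); last first.
  apply/funext => v; rewrite RintegralZl//; first by rewrite mulKf// gt_eqF// gauss_gt0.
  apply: integrable_le (Rintegrable_mulr M (integrable_norm fi)) => [|y].
    by apply: measurable_funM => //; exact: (measurableT_comp mf (msub1 v)).
  by rewrite normrM ler_wpM2l.
apply: measurable_funM.
  rewrite (_ : (fun x => _) = gauss (-1)); first exact: measurable_gauss.
  by apply/funext => x; rewrite /gauss -expRN; congr expR; ring.
apply: (measurable_fubini1 slam slam (u := gauss 1) (v := fun y => M * `|f y|)) => //.
- apply: measurable_funM; first by apply: (measurableT_comp (measurable_gauss _)).
  apply: measurable_funM; first exact: (measurableT_comp mf).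
  by apply: (measurableT_comp mf); exact: measurable_subRd.
- exact: integrable_gauss.
- by apply: Rintegrable_mull; exact: integrable_norm.
- move=> v y; rewrite normrM (ger0_norm (gauss_ge0 _ _)); apply: ler_wpM2l; first exact: gauss_ge0.
  by rewrite normrM mulrC ler_wpM2r.
Qed.

(** The autocorrelation never exceeds its value at 0, hence neither does its Gaussian average. This
    is the only passage between transforms and the [L^2] norm. *)
Lemma bessel (s : R) : 0 < s ->
  \int[lam]_xi (gauss s xi * (cos_transform lam f xi ^+ 2 + sin_transform lam f xi ^+ 2)) <=
  Zg lam s * Zg lam (4 * s)^-1 * \int[lam]_y (f y ^+ 2).
Proof.
move=> s0; have s4 : 0 < (4 * s)^-1 by rewrite invr_gt0 mulr_gt0.
rewrite gauss_transform_autocorr// -mulrA ler_wpM2l ?(ltW (Zg_gt0 _ _))//.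
have ig := integrable_gauss hlam s4.
rewrite /Zg -(RintegralZr _ measurableT ig).
apply: le_Rintegral => //.
- have [B HB] : exists B, forall v, `|autocorr v| <= B.
    exists (\int[lam]_y (M * `|f y|)) => v.
    have iM := Rintegrable_mull M (integrable_norm fi).
    have ia : lam.-integrable setT (EFin \o (fun y : Rd R d => f y * f (y - v : 'cV[R]_d))).
      apply: integrable_le iM => [|y].
        by apply: measurable_funM => //; exact: (measurableT_comp mf (msub1 v)).
      by rewrite normrM mulrC ler_wpM2r.
    apply: le_trans (le_normr_Rintegral measurableT ia) _.
    apply: le_Rintegral => //; first exact: integrable_norm.
    by move=> y _; rewrite normrM mulrC ler_wpM2r.
  apply: integrable_le (Rintegrable_mulr B ig) => [|v].
    by apply: measurable_funM; [exact: measurable_gauss|exact: measurable_autocorr].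
  by rewrite normrM (ger0_norm (gauss_ge0 _ _)) ler_wpM2l ?gauss_ge0.
- exact: Rintegrable_mulr.
- by move=> v _; rewrite ler_wpM2l ?gauss_ge0// autocorr_le.
Qed.

End Autocorrelation.

(** * The translation modulus of a set and the energy of its transform *)

Section SetModulus.
Context {R : realType} {d : nat} (lam : {measure set (Rd R d) -> \bar R}).
Hypothesis hlam : is_lebesgue_Rd lam.
Variable Om : set (Rd R d).
Hypothesis mOm : measurable Om.
Hypothesis Omoo : (lam Om < +oo)%E.

Definition vol : R := fine (lam Om).

Definition power (xi : 'cV[R]_d) : R :=
  cos_transform lam \1_Om xi ^+ 2 + sin_transform lam \1_Om xi ^+ 2.

(** An integral rather than the measure of a symmetric difference, so that sums, shifts and the
    triangle inequality apply directly; [phiE] identifies the two. *)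
Definition phi (v : 'cV[R]_d) : R :=
  \int[lam]_y `|\1_Om y - \1_Om (y - v : 'cV[R]_d)|.

Lemma integrable_indicR : lam.-integrable setT (EFin \o (\1_Om : Rd R d -> R)).
Proof.
apply: ge0_integrable => [|x|]; [exact: measurable_indic|by rewrite indicE|].
by rewrite integral_indic// setIT.
Qed.

Let i1 := integrable_indicR.

Let i2 v : lam.-integrable setT (EFin \o (fun y : Rd R d => \1_Om (y - v : 'cV[R]_d) : R)).
Proof. exact: integrable_subr. Qed.

Lemma normr_indic_le1 (x : Rd R d) : `|\1_Om x| <= 1 :> R.
Proof. by rewrite indicE ger0_norm//; case: (_ \in _). Qed.

Lemma Rintegral_indicR : \int[lam]_y \1_Om y = vol.
Proof. by rewrite /Rintegral integral_indic// setIT. Qed.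

Let i3 v : lam.-integrable setT
  (EFin \o (fun y : Rd R d => `|\1_Om y - \1_Om (y - v : 'cV[R]_d)| : R)).
Proof. by apply: integrable_norm; apply: Rintegrable_sub. Qed.

(** For [p] and [q] in [{0, 1}] one has [p q = (p + q - |p - q|) / 2]. *)
Lemma autocorr_indic v : autocorr lam \1_Om v = vol - phi v / 2.
Proof.
have -> : autocorr lam \1_Om v = \int[lam]_y (2^-1 *
  ((\1_Om y + \1_Om (y - v)) - `|\1_Om y - \1_Om (y - v)|)).
  apply: eq_Rintegral => y _; rewrite !indicE.
  case: (_ \in _); case: (_ \in _); rewrite /= ?subrr ?normr0 ?subr0 ?normr1 ?sub0r ?normrN1; lra.
rewrite RintegralZl//; last by apply: Rintegrable_sub => //; exact: Rintegrable_add.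
rewrite RintegralB//; last exact: Rintegrable_add.
rewrite RintegralD// (Rintegral_subr hlam)// Rintegral_indicR -/(phi v).
by field.
Qed.

Lemma phiE v : lam (symdiff (translate v Om) Om) = (phi v)%:E.
Proof.
rewrite EFin_Rintegral//.
have -> : symdiff (translate v Om) Om =
    [set y : Rd R d | (\1_Om y : R) != \1_Om (y - v : 'cV[R]_d)].
  have tE y : translate v Om y <-> Om (y - v).
    split=> [[z Oz <-]|Oy]; first by rewrite addrC addKr.
    by exists (y - v) => //; rewrite addrC subrK.
  apply/seteqP; split => y; rewrite /symdiff /= !indicE.
    case=> [[/tE Oy nOy]|[Oy ntO]].
      by rewrite [y - v \in _]mem_set// memNset// eq_sym oner_eq0.
    rewrite mem_set// [y - v \in _]memNset ?oner_eq0//.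
    by move/tE.
  have [yO|yO] := boolP (y \in Om); have [tO|tO] := boolP (y - v \in Om);
    rewrite ?eqxx//= => _.
    right; split; first by rewrite inE in yO.
    by move/tE => h; move: tO; rewrite mem_set.
  left; split; first by apply/tE; rewrite inE in tO.
  by move=> h; move: yO; rewrite mem_set.
set S := [set y | _].
have mS : measurable S.
  have mb : measurable_fun setT (fun y : Rd R d => (\1_Om y : R) != \1_Om (y - v : 'cV[R]_d)).
    apply: measurable_neg; apply: measurable_fun_eqr; first exact: measurable_indic.
    apply: (measurableT_comp (f := \1_Om : Rd R d -> R)); first exact: measurable_indic.
    exact: measurable_subRd.
  by have := mb measurableT [set true] I; rewrite setTI; exact.
rewrite -[in LHS](setIT S) -integral_indic//; apply: eq_integral => y _.
congr (_%:E); rewrite [LHS]indicE.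
have -> : (y \in S) = ((\1_Om y : R) != \1_Om (y - v : 'cV[R]_d)).
  by apply/idP/idP; rewrite inE.
rewrite !indicE; case: (_ \in _); case: (_ \in _);
  by rewrite /= ?subrr ?normr0 ?subr0 ?normr1 ?sub0r ?normrN1 ?eqxx ?oner_eq0 // eq_sym oner_eq0.
Qed.

Lemma phi_ge0 v : 0 <= phi v.
Proof. exact: Rintegral_ge0. Qed.

Lemma phi_le v : phi v <= 2 * vol.
Proof.
have -> : 2 * vol = \int[lam]_y (\1_Om y + \1_Om (y - v : 'cV[R]_d)).
  by rewrite RintegralD// (Rintegral_subr hlam)// Rintegral_indicR; ring.
apply: le_Rintegral => //; first exact: Rintegrable_add.
by move=> y _; apply: le_trans (ler_normB _ _) _; rewrite !ger0_norm// indicE.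
Qed.

(** The triangle inequality through the translate by [w]. It is what carries a lower bound at one
    vector over to its neighbours. *)
Lemma phiD v w : phi (v + w) <= phi v + phi w.
Proof.
have i4 : lam.-integrable setT (EFin \o (fun y : Rd R d =>
   `|\1_Om (y - w : 'cV[R]_d) - \1_Om (y - w - v : 'cV[R]_d)| : R)).
  exact: (integrable_subr hlam w (i3 v)).
have -> : phi v = \int[lam]_y `|\1_Om (y - w : 'cV[R]_d) - \1_Om (y - w - v : 'cV[R]_d)|.
  have /integrableP[/measurable_EFinP m3 _] := i3 v.
  by rewrite (Rintegral_subr hlam w m3).
rewrite [leRHS]addrC -RintegralD//; apply: le_Rintegral => //; first exact: Rintegrable_add.
move=> y _; have -> : y - (v + w) = y - w - v by rewrite opprD addrCA addrC.
rewrite (_ : \1_Om y - \1_Om (y - w - v) =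
  (\1_Om y - \1_Om (y - w)) + (\1_Om (y - w) - \1_Om (y - w - v))) ?ler_normD//.
by rewrite addrA subrK.
Qed.

Lemma measurable_phi : measurable_fun setT (phi : Rd R d -> R).
Proof.
rewrite (_ : phi = fun v => 2 * (vol - autocorr lam \1_Om v)).
  apply: measurable_funM => //; apply: measurable_funB => //.
  exact: (measurable_autocorr hlam i1 normr_indic_le1).
by apply/funext => v; rewrite autocorr_indic; field.
Qed.

(** Because [Zg s * Zg (4 s)^-1] equals [gconst], this is [gconst] times the mean of [phi] for the
    Gaussian probability of rate [(4 s)^-1]. *)
Definition gphi (s : R) : R := Zg lam s * \int[lam]_v (gauss (4 * s)^-1 v * phi v).

Lemma integrable_gauss_phi s : 0 < s ->
  lam.-integrable setT (EFin \o (fun v : Rd R d => gauss s v * phi v)).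
Proof.
move=> s0; apply: integrable_le (Rintegrable_mulr (2 * vol) (integrable_gauss hlam s0)) => [|v].
  by apply: measurable_funM; [exact: measurable_gauss|exact: measurable_phi].
by rewrite normrM !ger0_norm ?phi_ge0 ?gauss_ge0// ler_wpM2l ?gauss_ge0// phi_le.
Qed.

Lemma Zg_mul s c : 0 < s -> Zg lam s * Zg lam (c / s) = Zg lam 1 * Zg lam c.
Proof.
move=> s0; have r0 : 0 < Num.sqrt s by rewrite sqrtr_gt0.
have r2 : Num.sqrt s ^+ 2 = s by rewrite sqr_sqrtr// ltW.
have e1 : s = Num.sqrt s ^+ 2 * 1 by rewrite r2 mulr1.
have e2 : c / s = (Num.sqrt s)^-1 ^+ 2 * c by rewrite exprVn r2 mulrC.
rewrite {1}e1 e2 !(Zg_scale hlam) ?invr_gt0// exprVn invrK.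
rewrite mulrACA mulVf ?mul1r// expf_neq0// gt_eqF//.
Qed.

(** The Plancherel constant [(2 pi)^d]. *)
Definition gconst : R := Zg lam 1 * Zg lam 4^-1.

(** The main term is free of [s], so it cancels in a difference of two scales and only values of
    [gphi] remain. *)
Lemma gauss_power s : 0 < s ->
  \int[lam]_xi (gauss s xi * power xi) = gconst * vol - gphi s / 2.
Proof.
move=> s0; rewrite (gauss_transform_autocorr hlam i1 normr_indic_le1 s0).
have s4 : 0 < (4 * s)^-1 by rewrite invr_gt0 mulr_gt0.
under eq_Rintegral do rewrite autocorr_indic mulrBr mulrA.
have ig := integrable_gauss hlam s4.
rewrite RintegralB//; [|exact: Rintegrable_mulr|by apply: Rintegrable_mulr; exact: integrable_gauss_phi].
rewrite !RintegralZr//; last exact: integrable_gauss_phi.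
have zm := Zg_mul 4^-1 s0; rewrite -invfM in zm.
by rewrite -/(Zg lam _) /gphi mulrBr /gconst -zm !mulrA.
Qed.

Lemma measurable_power : measurable_fun setT (power : Rd R d -> R).
Proof.
have S := lebesgue_sigma_finite hlam.
apply: measurable_funD; apply: measurable_funX.
- exact: (measurable_cos_transform hlam S i1).
- exact: (measurable_sin_transform hlam S i1).
Qed.

Lemma power_ge0 xi : 0 <= power xi.
Proof. by rewrite addr_ge0// sqr_ge0. Qed.

Lemma power_le xi : power xi <= 2 * vol ^+ 2.
Proof.
have vE : \int[lam]_y `|\1_Om y : R| = vol.
  by rewrite -Rintegral_indicR; apply: eq_Rintegral => y _; rewrite ger0_norm// indicE.
have := cos_transform_le i1 xi; have := sin_transform_le i1 xi; rewrite vE => h1 h2.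
have sq (u : R) : `|u| <= vol -> u ^+ 2 <= vol ^+ 2.
  by move=> h; rewrite -real_normK ?num_real// ler_pXn2r ?nnegrE ?normr_ge0// (le_trans _ h).
by rewrite mulr2n mulrDl mul1r lerD// sq.
Qed.

Lemma integrable_gauss_power s : 0 < s ->
  lam.-integrable setT (EFin \o (fun v : Rd R d => gauss s v * power v)).
Proof.
move=> s0; apply: integrable_le (Rintegrable_mulr (2 * vol ^+ 2) (integrable_gauss hlam s0)) => [|v].
  by apply: measurable_funM; [exact: measurable_gauss|exact: measurable_power].
by rewrite normrM !ger0_norm ?power_ge0 ?gauss_ge0// ler_wpM2l ?gauss_ge0// power_le.
Qed.

End SetModulus.

(** * Two-sided bounds for the Gaussian modulus and energy in an annulus *)

Section PowerLemmas.
Context {R : realType}.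
Implicit Types b e x r : R.

Lemma powR_small b e : 0 < b -> 0 < e ->
  exists2 r, 0 < r <= 1 & forall x, 0 <= x <= r -> x `^ b <= e.
Proof.
move=> b0 e0; exists (Num.min 1 (e `^ b^-1)).
  by rewrite lt_min ltr01 powR_gt0//= ge_min lexx.
move=> x /andP[x0]; rewrite le_min => /andP[_ xe].
have -> : e = (e `^ b^-1) `^ b by rewrite -powRrM mulVf ?gt_eqF// powRr1// ltW.
by apply: ge0_ler_powR => //; rewrite ?nnegrE ?powR_ge0// ltW.
Qed.

Lemma powR_le1D b x : 0 <= b <= 1 -> 0 <= x -> x `^ b <= 1 + x.
Proof.
move=> /andP[b0 b1] x0; have [x1|x1] := leP x 1.
  apply: (@le_trans _ _ 1); last by rewrite lerDl.
  have -> : 1 = (1 : R) `^ b by rewrite powR1.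
  by apply: ge0_ler_powR => //; rewrite nnegrE.
apply: (@le_trans _ _ x); last by rewrite lerDr.
by apply: ler1_powR => //; exact: ltW.
Qed.

Lemma one_sub_expR x : 0 <= x -> x / (1 + x) <= 1 - expR (- x).
Proof.
move=> x0; have x1 : 0 < 1 + x by rewrite ltr_wpDr.
have -> : x / (1 + x) = 1 - (1 + x)^-1 by field; exact: lt0r_neq0.
by rewrite lerD2l lerN2 expRN lef_pV2 ?posrE ?expR_gt0// expR_ge1Dx.
Qed.

(* Splits a difference of two Gaussians at scales [eps] and [1] into the mass of
   the annulus [P <= x <= Q] and two tails, each dominated by a difference of
   Gaussians at a scale adapted to that tail. *)
Lemma gauss_split (eps P Q x : R) : 0 < P <= 2^-1 -> 1 <= Q ->
  0 < eps -> 2 * Q * eps <= 1 -> 0 <= x ->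
  expR (- (eps * x)) - expR (- x) <= ((P <= x <= Q)%R : bool)%:R +
    4 * P * (expR (- (eps * x)) - expR (- (x / P))) +
    3 * (expR (- (eps * x)) - expR (- (x / Q))).
Proof.
move=> /andP[P0 P2] Q1 e0 eQ x0.
have Q0 : 0 < Q by exact: lt_le_trans Q1.
have e1 : eps <= 2^-1 by nra.
have eP : eps * x <= x / P / 2.
  rewrite [leRHS]mulrAC ler_pdivlMr//.
  by rewrite mulrAC mulrC ler_wpM2l//; nra.
have eQ' : eps * x <= x / Q / 2.
  rewrite [leRHS]mulrAC ler_pdivlMr//.
  by rewrite mulrAC mulrC ler_wpM2l//; nra.
have xP : 0 <= x / P by rewrite divr_ge0// ltW.
have xQ : 0 <= x / Q by rewrite divr_ge0// ltW.
have ge y : eps * x <= y -> 0 <= expR (- (eps * x)) - expR (- y).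
  by move=> h; rewrite subr_ge0 ler_expR lerN2.
have gP : 0 <= 4 * P * (expR (- (eps * x)) - expR (- (x / P))).
  by apply: mulr_ge0; [rewrite mulr_ge0// ltW|apply: ge; lra].
have gQ : 0 <= 3 * (expR (- (eps * x)) - expR (- (x / Q))).
  by apply: mulr_ge0 => //; apply: ge; lra.
have factor y : expR (- (eps * x)) - expR (- y) =
    expR (- (eps * x)) * (1 - expR (- (y - eps * x))).
  by rewrite mulrBr mulr1 -expRD; congr (_ - expR _); ring.
(* Below [P], the left side is at most [x] times the common factor [expR (- (eps * x))]. With
   [y = x / P <= 1] and [eps * x <= y / 2], the first tail is at least [4 * P * (y / 4) = x] times
   that factor. *)
have [xltP|Px] := ltP x P.
  rewrite add0r; apply: (@le_trans _ _ (4 * P * (expR (- (eps * x)) - expR (- (x / P))))); last by rewrite lerDl.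
  rewrite !factor mulrCA ler_pM2l ?expR_gt0//.
  set y := x / P in eP xP *.
  have y1 : y <= 1 by rewrite /y ler_pdivrMr// mul1r ltW.
  have H := one_sub_expR (_ : 0 <= y - eps * x).
  apply: (@le_trans _ _ x).
    have := expR_ge1Dx (- (x - eps * x)); have : 0 <= eps * x by rewrite mulr_ge0// ltW.
    by lra.
  have {}H : (y - eps * x) / (1 + (y - eps * x)) <= 1 - expR (- (y - eps * x)) by apply: H; lra.
  have h2 : y / 4 <= (y - eps * x) / (1 + (y - eps * x)).
    have ex0 : 0 <= eps * x by rewrite mulr_ge0// ltW.
    rewrite ler_pdivlMr; last by lra.
    by nra.
  apply: (@le_trans _ _ (4 * P * (y / 4))).
    by rewrite le_eqVlt; apply/orP; left; apply/eqP; rewrite /y; field; exact: lt0r_neq0.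
  by apply: ler_wpM2l; [rewrite mulr_ge0// ltW|exact: le_trans h2 H].
have [xQle|Qx] := leP x Q.
  rewrite /=; apply: (@le_trans _ _ 1%:R); last by rewrite -addrA lerDl addr_ge0.
  rewrite -[leRHS]subr0 lerB ?expR_ge0// -expR0 ler_expR oppr_le0 mulr_ge0// ltW//.
(* Above [Q], [y = x / Q >= 1] and [eps * x <= y / 2] give [1 - expR (- (y - eps * x)) >= 1 / 3];
   the coefficient 3 brings this back to 1. *)
rewrite /= add0r; apply: (@le_trans _ _ (3 * (expR (- (eps * x)) - expR (- (x / Q))))); last by rewrite lerDr.
rewrite !factor mulrCA ler_pM2l ?expR_gt0//.
have xQ1 : 1 <= x / Q by rewrite ler_pdivlMr// mul1r ltW.
set y := x / Q in eQ' xQ xQ1 *.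
have H := one_sub_expR (_ : 0 <= y - eps * x).
have {}H : (y - eps * x) / (1 + (y - eps * x)) <= 1 - expR (- (y - eps * x)) by apply: H; lra.
have h2 : 3^-1 <= (y - eps * x) / (1 + (y - eps * x)).
  rewrite ler_pdivlMr; last by lra.
  by lra.
have := expR_ge0 (- (x - eps * x)).
by lra.
Qed.

End PowerLemmas.

Section ModulusBounds.
Context {R : realType} {d : nat} (lam : {measure set (Rd R d) -> \bar R}).
Hypothesis hlam : is_lebesgue_Rd lam.
Variable Om : set (Rd R d).
Hypothesis mOm : measurable Om.
Hypothesis Omoo : (lam Om < +oo)%E.

Local Notation phi := (phi lam Om).
Local Notation gphi := (gphi lam Om).
Local Notation power := (power lam Om).

Lemma enorm_powR (h : 'cV[R]_d) (beta : R) :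
  enorm h `^ beta = sqn h `^ (beta / 2).
Proof.
rewrite enormE -powR12_sqrt ?sqn_ge0// -powRrM; congr (_ `^ _); exact: mulrC.
Qed.

(** Beyond [delta] the trivial bound [2 vol] is itself at most a multiple of [|h|^beta]. The
    estimate must hold for all [h], since Gaussian means see every vector. *)
Lemma phi_upper (beta kappa1 delta : R) : 0 < beta -> 0 < kappa1 -> 0 < delta ->
  (forall h : 'cV[R]_d, enorm h < delta ->
    (lam (symdiff (translate h Om) Om) <= (kappa1 * enorm h `^ beta)%:E)%E) ->
  exists2 k, 0 < k & forall h, phi h <= k * sqn h `^ (beta / 2).
Proof.
move=> b0 k0 d0 H; have db : 0 < delta `^ beta by rewrite powR_gt0.
have v0 : 0 <= vol lam Om by rewrite fine_ge0.
exists (kappa1 + 2 * vol lam Om / delta `^ beta).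
  by rewrite ltr_wpDr// divr_ge0// ?mulr_ge0// ltW.
move=> h; rewrite -enorm_powR; have [hd|hd] := ltP (enorm h) delta.
  have := H _ hd; rewrite (phiE hlam)// lee_fin => /le_trans; apply.
  by rewrite ler_wpM2r ?powR_ge0// lerDl divr_ge0 ?mulr_ge0// ltW.
apply: le_trans (phi_le hlam mOm Omoo h) _.
apply: (@le_trans _ _ (2 * vol lam Om / delta `^ beta * enorm h `^ beta)); last first.
  by rewrite ler_wpM2r ?powR_ge0// lerDr ltW.
rewrite mulrAC ler_pdivlMr// ler_wpM2l// ?mulr_ge0//.
by apply: ge0_ler_powR => //; rewrite ?nnegrE ?enorm_ge0// ltW.
Qed.

(** With [x = |v|^2 / s], the bound [x^b <= 1 + x <= 8 expR (x / 8)] uses up half of the exponent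
    [x / 4]. The remaining rate [8^-1 / s] is paired with [s] by [Zg_mul], which removes the
    dependence on the scale. *)
Lemma gphi_upper (b k : R) : 0 <= b <= 1 -> 0 < k ->
  (forall h, phi h <= k * sqn h `^ b) ->
  exists2 C, 0 < C & forall s, 0 < s -> gphi s <= C * s `^ b.
Proof.
move=> b01 k0 H.
have Z1 := Zg_gt0 hlam (@ltr01 R).
have Z8 : 0 < Zg lam 8^-1 by apply: Zg_gt0 => //; rewrite invr_gt0.
exists (8 * k * (Zg lam 1 * Zg lam 8^-1)); first by rewrite !mulr_gt0.
move=> s s0; rewrite -(Zg_mul hlam _ s0) /gphi.
have s4 : 0 < (4 * s)^-1 by rewrite invr_gt0 mulr_gt0.
have s8 : 0 < 8^-1 / s by rewrite divr_gt0// invr_gt0.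
rewrite (_ : 8 * k * _ * _ = Zg lam s * (8 * k * s `^ b * Zg lam (8^-1 / s))); last by ring.
rewrite ler_wpM2l ?(ltW (Zg_gt0 hlam s0))// -RintegralZl//; last exact: integrable_gauss.
apply: le_Rintegral => //.
- exact: integrable_gauss_phi.
- by apply: Rintegrable_mull; exact: integrable_gauss.
move=> v _; apply: (@le_trans _ _ (gauss (4 * s)^-1 v * (k * (s `^ b * (8 * expR (8^-1 / s * sqn v)))))).
  rewrite ler_wpM2l ?gauss_ge0//; apply: le_trans (H v) _; rewrite ler_wpM2l ?(ltW k0)//.
  have -> : sqn v = s * (sqn v / s) by field; exact: lt0r_neq0.
  have x0 : 0 <= sqn v / s by rewrite divr_ge0 ?sqn_ge0// ltW.
  rewrite powRM//; last exact: ltW.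
  rewrite ler_wpM2l ?powR_ge0//; apply: le_trans (powR_le1D b01 x0) _.
  rewrite (_ : 8^-1 / s * _ = sqn v / s / 8); last by field; exact: lt0r_neq0.
  have := expR_ge1Dx (sqn v / s / 8); lra.
have -> : gauss (8^-1 / s) v = gauss (4 * s)^-1 v * expR (8^-1 / s * sqn v).
  by rewrite /gauss -expRD; congr expR; field; exact: lt0r_neq0.
by rewrite le_eqVlt; apply/orP; left; apply/eqP; ring.
Qed.

Lemma sball_scale (c r : R) : 0 < c ->
  lam (@sball R d (c ^+ 2 * r)) = ((c ^+ d)%:E * lam (@sball R d r))%E.
Proof.
move=> c0; have := lebesgue_scale hlam c0 (measurable_sball (d := d) (c ^+ 2 * r)).
rewrite (_ : _ @^-1` _ = @sball R d r); last first.
  by apply/seteqP; split => x; rewrite /sball/= sqnZ ltr_pM2l// exprn_gt0.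
move=> ->; rewrite muleA -EFinM divff ?mul1e//.
by rewrite expf_neq0// gt_eqF.
Qed.

(** Only a ball around [u Theta], with [u = t n] comparable to [sqrt s], is kept in the Gaussian
    mean. There subadditivity leaves half of the lower bound at [u Theta], the Gaussian is bounded
    below, and the volume of order [u^d] compensates the normalisation [Zg s] of order
    [s^(-d/2)]. *)
Lemma gphi_lower (b k kappa2 kappa3 : R) (Theta : 'cV[R]_d) (t : nat -> R) :
  0 < b -> 0 < k -> (forall h, phi h <= k * sqn h `^ b) ->
  0 < kappa2 -> 0 < kappa3 -> sqn Theta = 1 ->
  (forall n, t n.+1 < t n) -> t @ \oo --> 0 ->
  (forall n, t n <= kappa3 * t n.+1) ->
  (forall n, kappa2 * (t n ^+ 2) `^ b <= phi (t n *: Theta)) ->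
  exists c s0, [/\ 0 < c, 0 < s0 & forall s, 0 < s <= s0 -> c * s `^ b <= gphi s].
Proof.
move=> b0 k0 up k20 k30 T1 tdec tlim trat low.
have t0 n : 0 < t n.
  apply: le_lt_trans (tdec n).
  have nt : nonincreasing_seq t by apply/nonincreasing_seqP => m; exact: ltW.
  have := nonincreasing_cvgn_ge nt (cvgP _ tlim) n.+1.
  by rewrite (cvg_lim (@Rhausdorff R) tlim).
(* Chosen so that [k * rho^b <= kappa2 / 2]: moving by less than [sqrt rho * u] from [u Theta] loses
   at most half of [phi]. *)
have [rho /andP[r0 r1] hrho] := powR_small b0 (divr_gt0 k20 (mulr_gt0 (ltr0n R 2) k0)).
pose B := fine (lam (@sball R d rho)).
have BE : lam (@sball R d rho) = B%:E by rewrite fineK// ge0_fin_numE// lebesgue_sball_lty.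
have B0 : 0 < B by rewrite -lte_fin -BE; exact: lebesgue_sball_gt0.
have Z1 := Zg_gt0 hlam (@ltr01 R).
pose c := Zg lam 1 * kappa3 ^- d * (expR (-1) * (kappa2 / 2)) * B * (kappa3 ^- 2) `^ b.
exists c, (t 0%N ^+ 2); split.
- by rewrite !mulr_gt0 ?expR_gt0 ?powR_gt0 ?invr_gt0 ?exprn_gt0.
- by rewrite exprn_gt0.
move=> s /andP[s0 st]; set r := Num.sqrt s.
have rs : r ^+ 2 = s by rewrite sqr_sqrtr// ltW.
have rp : 0 < r by rewrite sqrtr_gt0.
(* Take the first index with [t n <= r]: the preceding term exceeds [r] and is at most
   [kappa3 * t n]. At index 0 the restriction [s <= t 0 ^+ 2] plays the part of the missing
   predecessor. *)
have [n [ur ru]] : exists n, t n <= r /\ r <= kappa3 * t n.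
  have ex : exists n, t n <= r.
    have [N _ HN] := cvgr_lt _ tlim _ rp.
    by exists N; apply: ltW; apply: HN => /=.
  case: (ex_minnP ex) => -[|n] tn min.
    exists 0%N; split => //; apply: (@le_trans _ _ (t 0%N)).
      by rewrite -(ler_pXn2r (n := 2)) ?nnegrE ?(ltW (t0 _)) ?(ltW rp)// rs.
    by apply: le_trans (trat 0%N) _; rewrite ler_wpM2l// ltW.
  exists n.+1; split => //; apply: le_trans (trat n).
  by apply: ltW; rewrite ltNge; apply/negP => /min; rewrite ltnn.
set u := t n in ur ru; have u0 : 0 < u := t0 n.
have key v : sqn (u *: Theta - v) < rho * u ^+ 2 ->
    expR (-1) * (kappa2 / 2) * (u ^+ 2) `^ b <= gauss (4 * s)^-1 v * phi v.
  move=> vu; have u2 : 0 < u ^+ 2 by rewrite exprn_gt0.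
  rewrite -mulrA; apply: ler_pM; rewrite ?expR_ge0//.
  - by rewrite mulr_ge0 ?powR_ge0// ltW// divr_gt0.
  (* Here [|v|^2 <= 2 |u Theta|^2 + 2 |v - u Theta|^2 <= 4 u^2 <= 4 s], so the exponent is at least
     [-1]. *)
  - rewrite /gauss ler_expR lerN2 mulrC ler_pdivrMr ?mulr_gt0// mul1r.
    have := sqnD (u *: Theta) (- (u *: Theta - v)); rewrite opprB addrC subrK => ->.
    rewrite sqnB_sym.
    have := dot_young (u *: Theta) (v - u *: Theta) ltr01; rewrite invr1 !mul1r sqnZ T1 mulr1.
    have h1 : dot (u *: Theta) (v - u *: Theta) <= `|dot (u *: Theta) (v - u *: Theta)| by exact: ler_norm.
    have h2 : u ^+ 2 <= s by rewrite -rs ler_pXn2r// nnegrE ltW.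
    rewrite (sqnB_sym v) => h3.
    have h4 : rho * u ^+ 2 <= u ^+ 2 by rewrite ler_piMl// ltW.
    by lra.
  - have := phiD hlam mOm Omoo v (u *: Theta - v); rewrite addrC subrK.
    have := low n; rewrite -/u.
    have := up (u *: Theta - v).
    have : sqn (u *: Theta - v) `^ b <= (rho * u ^+ 2) `^ b.
      apply: ge0_ler_powR; rewrite ?nnegrE ?sqn_ge0 ?mulr_ge0 ?ltW//.
    rewrite powRM ?(ltW r0) ?(ltW u2)//.
    have h5 : k * (rho `^ b * (u ^+ 2) `^ b) <= kappa2 / 2 * (u ^+ 2) `^ b.
      rewrite mulrA ler_wpM2r ?powR_ge0//.
      have : rho `^ b <= kappa2 / (2 * k) by apply: hrho; rewrite lexx (ltW r0).
      by rewrite ler_pdivlMr ?mulr_gt0//; move: (rho `^ b) => x; lra.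
    move=> h6; have : k * sqn (u *: Theta - v) `^ b <= k * (rho `^ b * (u ^+ 2) `^ b) by rewrite ler_wpM2l// ltW.
    move: h5 h6; move: (phi _) (phi _) (phi _) ((u ^+ 2) `^ b) (k * _) (k * _) => x1 x2 x3 x4 x5 x6; lra.
have s4 : 0 < (4 * s)^-1 by rewrite invr_gt0 mulr_gt0.
have int : expR (-1) * (kappa2 / 2) * (u ^+ 2) `^ b * (u ^+ d * B) <=
    \int[lam]_v (gauss (4 * s)^-1 v * phi v).
  set q := expR (-1) * (kappa2 / 2) * (u ^+ 2) `^ b.
  have q0 : 0 <= q by rewrite !mulr_ge0 ?expR_ge0 ?powR_ge0// ltW.
  rewrite -lee_fin EFin_Rintegral; last exact: integrable_gauss_phi.
  have -> : (q * (u ^+ d * B))%:E = (\int[lam]_v (q * \1_(@sball R d (rho * u ^+ 2)) v)%:E)%E.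
    under eq_integral do rewrite EFinM.
    rewrite ge0_integralZl_EFin//; last first.
      by apply/measurable_EFinP; apply: measurable_indic; exact: measurable_sball.
    rewrite integral_indic ?setIT//; last exact: measurable_sball.
    by rewrite (mulrC rho) sball_scale// BE -!EFinM.
  rewrite -(integral_translate hlam (- (u *: Theta))); last first.
    apply/measurable_EFinP; apply: measurable_funM => //.
    apply: measurable_indic; exact: measurable_sball.
  apply: ge0_le_integral_weak => v _; rewrite lee_fin indicE; first exact: mulr_ge0.
  have [|] := boolP (_ \in _).
    by rewrite inE /sball/= mulr1 addrC sqnB_sym => /key.
  by rewrite mulr0 mulr_ge0 ?gauss_ge0 ?phi_ge0.
apply: (@le_trans _ _ (Zg lam s * (expR (-1) * (kappa2 / 2) * (u ^+ 2) `^ b * (u ^+ d * B)))); last first.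
  by rewrite ler_wpM2l// (ltW (Zg_gt0 hlam s0)).
rewrite -{2}rs -[r ^+ 2]mulr1 (Zg_scale hlam)//.
have ur' : r / kappa3 <= u by rewrite ler_pdivrMr// mulrC.
have h1 : (kappa3 ^- 2) `^ b * s `^ b <= (u ^+ 2) `^ b.
  rewrite -powRM ?invr_ge0 ?exprn_ge0 ?(ltW s0) ?(ltW k30)//.
  apply: ge0_ler_powR; rewrite ?nnegrE ?mulr_ge0 ?invr_ge0 ?exprn_ge0 ?(ltW s0) ?(ltW k30) ?(ltW b0) ?(ltW u0)//.
  by rewrite -rs mulrC -exprVn -exprMn; apply: lerXn2r => //; rewrite nnegrE ltW// divr_gt0.
have h2 : kappa3 ^- d * r ^+ d <= u ^+ d.
  by rewrite mulrC -exprVn -exprMn; apply: lerXn2r => //; rewrite nnegrE ltW// divr_gt0.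
rewrite /c.
have rd : 0 < r ^+ d by rewrite exprn_gt0.
have h3 : kappa3 ^- d * ((kappa3 ^- 2) `^ b * s `^ b) <= r ^- d * u ^+ d * (u ^+ 2) `^ b.
  apply: ler_pM; rewrite ?mulr_ge0 ?powR_ge0 ?invr_ge0 ?exprn_ge0 ?(ltW k30)//.
  by rewrite mulrC ler_pdivlMr.
set X := expR (-1) * (kappa2 / 2).
have X0 : 0 < X by rewrite mulr_gt0 ?expR_gt0// divr_gt0.
rewrite [leLHS](_ : _ = Zg lam 1 * X * B * (kappa3 ^- d * ((kappa3 ^- 2) `^ b * s `^ b))); last by ring.
rewrite [leRHS](_ : _ = Zg lam 1 * X * B * (r ^- d * u ^+ d * (u ^+ 2) `^ b)); last by ring.
by rewrite ler_wpM2l// ltW// !mulr_gt0.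
Qed.

End ModulusBounds.

Section Annulus.
Context {R : realType} {d : nat} (lam : {measure set (Rd R d) -> \bar R}).
Hypothesis hlam : is_lebesgue_Rd lam.
Variable Om : set (Rd R d).
Hypothesis mOm : measurable Om.
Hypothesis Omoo : (lam Om < +oo)%E.

Local Notation gphi := (gphi lam Om).
Local Notation power := (power lam Om).

Definition annulus (P Q s : R) (xi : 'cV[R]_d) : R :=
  ((P <= s * sqn xi <= Q)%R : bool)%:R.

Lemma annulus_ge0 P Q s xi : 0 <= annulus P Q s xi.
Proof. exact: ler0n. Qed.

Lemma measurable_annulus P Q s :
  measurable_fun setT (annulus P Q s : Rd R d -> R).
Proof.
have ms : measurable_fun setT (fun xi : Rd R d => s * sqn xi).
  by apply: measurable_funM => //; exact: measurable_sqn.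
rewrite (_ : annulus P Q s =
  \1_([set xi : Rd R d | (P <= s * sqn xi) && (s * sqn xi <= Q)])); last first.
  apply/funext => xi; rewrite indicE /annulus.
  by congr (nat_of_bool _)%:R; apply/idP/idP; rewrite inE.
apply: measurable_indic.
have mb : measurable_fun setT (fun xi : Rd R d => (P <= s * sqn xi) && (s * sqn xi <= Q)).
  by apply: measurable_and; apply: measurable_fun_ler.
by have := mb measurableT [set true] I; rewrite setTI; exact.
Qed.

Lemma integrable_annulus_power P Q s : 0 < s ->
  lam.-integrable setT (EFin \o (fun xi : Rd R d => annulus P Q s xi * power xi)).
Proof.
move=> s0; apply: integrable_le (Rintegrable_mull (expR Q) (integrable_gauss_power hlam mOm Omoo s0)) => [|xi].
  by apply: measurable_funM; [exact: measurable_annulus|exact: measurable_power].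
rewrite ger0_norm; last by rewrite mulr_ge0 ?annulus_ge0 ?power_ge0.
rewrite mulrA ler_wpM2r ?power_ge0// /annulus /gauss -expRD.
case: (boolP (_ && _)) => [/andP[_ h]|_]; last exact: expR_ge0.
by rewrite -expR0 ler_expR subr_ge0.
Qed.

(** Integrate [gauss_split] against [power]. Only differences of Gaussians occur, so the constant
    term of [gauss_power] cancels; the values [gphi (eps * s)] coming from the two tails have a
    favourable sign and are dropped. *)
Lemma annulus_power_ge (P Q eps s : R) : 0 < P <= 2^-1 -> 1 <= Q -> 0 < eps ->
  2 * Q * eps <= 1 -> 0 < s ->
  gphi s - gphi (eps * s) - 4 * P * gphi (s / P) - 3 * gphi (s / Q) <=
  2 * \int[lam]_xi (annulus P Q s xi * power xi).
Proof.
move=> hP Q1 e0 eQ s0; have /andP[P0 _] := hP.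
have Q0 : 0 < Q by exact: lt_le_trans Q1.
have es : 0 < eps * s by rewrite mulr_gt0.
have sP : 0 < s / P by rewrite divr_gt0.
have sQ : 0 < s / Q by rewrite divr_gt0.
have gi u : 0 < u -> lam.-integrable setT (EFin \o (fun xi : Rd R d => gauss u xi * power xi)).
  by move=> u0; exact: integrable_gauss_power.
have gphi_ge0 u : 0 < u -> 0 <= gphi u.
  move=> u0; apply: mulr_ge0; first by apply: ltW; exact: Zg_gt0.
  apply: Rintegral_ge0 => v _.
  by rewrite mulr_ge0 ?gauss_ge0 ?phi_ge0.
have ia := @integrable_annulus_power P Q s s0.
have H : \int[lam]_xi (gauss (eps * s) xi * power xi - gauss s xi * power xi) <=
   \int[lam]_xi (annulus P Q s xi * power xi +
     4 * P * (gauss (eps * s) xi * power xi - gauss (s / P) xi * power xi) +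
     3 * (gauss (eps * s) xi * power xi - gauss (s / Q) xi * power xi)).
  apply: le_Rintegral => //.
  - by apply: Rintegrable_sub; exact: gi.
  - apply: Rintegrable_add; last by apply: Rintegrable_mull; apply: Rintegrable_sub; exact: gi.
    by apply: Rintegrable_add => //; apply: Rintegrable_mull; apply: Rintegrable_sub; exact: gi.
  move=> xi _; have x0 : 0 <= s * sqn xi by rewrite mulr_ge0 ?sqn_ge0// ltW.
  have := gauss_split hP Q1 e0 eQ x0.
  rewrite /annulus /gauss => h; have := ler_wpM2r (power_ge0 lam Om xi) h.
  rewrite !mulrA (mulrAC _ _ P^-1) (mulrAC _ _ Q^-1) => {}h.
  by apply: le_trans (le_trans _ h) _; rewrite le_eqVlt; apply/orP; left; apply/eqP; ring.
move: H.
rewrite RintegralB//; [|exact: gi|exact: gi].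
rewrite RintegralD//; last 2 first.
- by apply: Rintegrable_add => //; apply: Rintegrable_mull; apply: Rintegrable_sub; exact: gi.
- by apply: Rintegrable_mull; apply: Rintegrable_sub; exact: gi.
rewrite RintegralD//; last by apply: Rintegrable_mull; apply: Rintegrable_sub; exact: gi.
rewrite RintegralZl//; last by apply: Rintegrable_sub; exact: gi.
rewrite RintegralZl//; last by apply: Rintegrable_sub; exact: gi.
rewrite RintegralB//; [|exact: gi|exact: gi].
rewrite RintegralB//; [|exact: gi|exact: gi].
rewrite !gauss_power//.
have g1 := gphi_ge0 _ es.
have : 0 <= P * gphi (eps * s) by rewrite mulr_ge0// ltW.
move: g1; move: (\int[lam]_xi _) (gconst lam * vol lam Om) => X Y.
move: (gphi _) (gphi _) (gphi _) (gphi _) => g1 g2 g3 g4; nra.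
Qed.

(** Each of the three error terms is made at most a quarter of [c * s^b], which leaves a quarter for
    twice the energy, whence [c / 8]. The low-frequency tail costs [P (s / P)^b = P^(1 - b) s^b],
    small with [P] because [b < 1]. *)
Lemma annulus_power (b c C s0 : R) : 0 < b <= 2^-1 -> 0 < c -> 0 < C -> 0 < s0 ->
  (forall s, 0 < s <= s0 -> c * s `^ b <= gphi s) ->
  (forall s, 0 < s -> gphi s <= C * s `^ b) ->
  exists P Q c', [/\ 0 < P <= 2^-1, 1 <= Q, 0 < c' &
    forall s, 0 < s <= s0 ->
      c' * s `^ b <= \int[lam]_xi (annulus P Q s xi * power xi)].
Proof.
move=> /andP[b0 b2] c0 C0 s00 lo up.
have b1 : 0 < 1 - b by lra.
have [rP /andP[rP0 rP1] hP] := powR_small b1 (divr_gt0 c0 (mulr_gt0 (ltr0n R 16) C0)).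
have [rQ /andP[rQ0 rQ1] hQ] := powR_small b0 (divr_gt0 c0 (mulr_gt0 (ltr0n R 12) C0)).
have [re /andP[re0 re1] he] := powR_small b0 (divr_gt0 c0 (mulr_gt0 (ltr0n R 4) C0)).
(* The second entry of [eps] secures [2 * Q * eps <= 1], required by [gauss_split]. *)
pose P := Num.min 2^-1 rP; pose Q := rQ^-1; pose eps := Num.min re (rQ / 2).
have P0 : 0 < P by rewrite lt_min invr_gt0 ltr0n.
have PP : 0 < P <= 2^-1 by rewrite P0 ge_min lexx.
have Q1 : 1 <= Q by rewrite invf_ge1.
have e0 : 0 < eps by rewrite lt_min re0 divr_gt0.
have eQ : 2 * Q * eps <= 1.
  rewrite (_ : 2 * Q * eps = eps / (rQ / 2)); last by rewrite /Q; field; exact: lt0r_neq0.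
  by rewrite ler_pdivrMr ?divr_gt0// mul1r ge_min lexx orbT.
exists P, Q, (c / 8); split => //; first by rewrite divr_gt0.
move=> s /andP[sp ss].
have := annulus_power_ge PP Q1 e0 eQ sp.
have h1 : c * s `^ b <= gphi s by apply: lo; rewrite sp.
have sb : 0 < s `^ b by rewrite powR_gt0.
have h2 : gphi (eps * s) <= c / 4 * s `^ b.
  apply: le_trans (up _ _) _; first by rewrite mulr_gt0.
  rewrite powRM ?(ltW e0) ?(ltW sp)// mulrA ler_wpM2r ?(ltW sb)//.
  have : eps `^ b <= c / (4 * C) by apply: he; rewrite (ltW e0) ge_min lexx.
  by rewrite ler_pdivlMr ?mulr_gt0//; move: (_ `^ b) => x; lra.
have h3 : 4 * P * gphi (s / P) <= c / 4 * s `^ b.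
  have -> : c / 4 * s `^ b = 4 * P * (c / 16 / P * s `^ b).
    by field; exact: lt0r_neq0.
  rewrite ler_wpM2l ?mulr_ge0 ?(ltW P0)//.
  apply: le_trans (up _ _) _; first by rewrite divr_gt0.
  rewrite powRM ?invr_ge0 ?(ltW P0) ?(ltW sp)// mulrCA mulrC ler_wpM2r ?(ltW sb)//.
  have : P `^ (1 - b) <= c / (16 * C) by apply: hP; rewrite (ltW P0) ge_min lexx orbT.
  have -> : P `^ (1 - b) = P * (P `^ b)^-1.
    rewrite powRB ?powRr1 ?(ltW P0)//; apply/implyP => _; by rewrite gt_eqF.
  rewrite ler_pdivlMr ?mulr_gt0//.
  have -> : P^-1 `^ b = (P `^ b)^-1.
    by rewrite -(powR_inv1 (ltW P0)) -powRrM mulN1r powRN.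
  move=> h; rewrite ler_pdivlMr//.
  by move: h; move: ((P `^ b)^-1) => Pb; lra.
have h4 : 3 * gphi (s / Q) <= c / 4 * s `^ b.
  rewrite -ler_pdivlMl//.
  apply: le_trans (up _ _) _; first by rewrite divr_gt0// (lt_le_trans _ Q1).
  rewrite /Q invrK powRM ?(ltW rQ0) ?(ltW sp)// mulrCA mulrC mulrA ler_wpM2r ?(ltW sb)//.
  have : rQ `^ b <= c / (12 * C) by apply: hQ; rewrite (ltW rQ0) lexx.
  by rewrite ler_pdivlMr ?mulr_gt0//; move: (_ `^ b) => x; lra.
move: h1 h2 h3 h4; move: (gphi s) (gphi (eps * s)) (4 * P * _) (3 * _) (\int[lam]_xi _) (s `^ b).
by move=> x1 x2 x3 x4 x5 x6; lra.
Qed.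

End Annulus.

(** * Rotations, Haar measure and averages over rotations *)

Section Rotations.
Context {R : realType} {d : nat}.
Hypothesis hd : (2 <= d)%N.
Implicit Types x y : 'cV[R]_d.

Lemma colmul_dot (v x : 'cV[R]_d) : v *m (v^T *m x) = dot v x *: v.
Proof.
by rewrite [v^T *m x]mx11_scalar mul_mx_scalar.
Qed.

(** The reflection in the hyperplane orthogonal to [v = x - y]; equal norms give [|v|^2 = 2 v.x],
    which is exactly what sends [x] to [y]. *)
Lemma householder x y : sqn x = sqn y ->
  exists H : 'M[R]_d, H^T *m H = 1%:M /\ H *m x = y.
Proof.
move=> xy; have [->|nxy] := eqVneq x y; first by exists 1%:M; rewrite trmx1 !mul1mx.
pose v := x - y; pose n := sqn v.
have nE : n = 2 * dot v x.
  rewrite /n /v sqnD sqnN -xy dotNr dotBl -/(sqn x) (dotC y x); ring.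
have n0 : n != 0.
  apply: contra nxy => /eqP n0; rewrite -subr_eq0; apply/eqP/matrixP => i j.
  have : v i ord0 ^+ 2 == 0 by rewrite eq_le sqr_ge0 -n0 entry_le_sqn.
  by rewrite sqrf_eq0 (ord1 j) [RHS]mxE => /eqP.
pose H := 1%:M - (2 / n) *: (v *m v^T).
have Hz z : H *m z = z - (2 / n * dot v z) *: v.
  by rewrite mulmxBl mul1mx -scalemxAl -mulmxA colmul_dot scalerA.
have HT : H^T = H.
  by rewrite /H linearB/= trmx1 linearZ/= trmx_mul trmxK.
exists H; split; last first.
  rewrite Hz nE mulrAC divff; last by rewrite -nE.
  by rewrite scale1r /v opprB addrC subrK.
have Hv : H *m v = - v.
  rewrite Hz -/(sqn v) -/n divfK// -[X in X - _]scale1r -scalerBl.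
  by rewrite (_ : 1 - 2 = -1) ?scaleN1r//; ring.
rewrite HT {2}/H mulmxBr mulmx1 -scalemxAr mulmxA Hv mulNmx scalerN opprK.
by rewrite /H subrK.
Qed.

Lemma sqn_scale_delta x (i : 'I_d) :
  sqn (Num.sqrt (sqn x) *: delta_mx i ord0) = sqn x.
Proof.
rewrite sqnZ sqr_sqrtr ?sqn_ge0// (sqnE (delta_mx i ord0)) (bigD1 i)//= big1 ?addr0 => [|j ji].
  by rewrite mxE !eqxx expr1n mulr1.
by rewrite mxE (negPf ji) expr0n.
Qed.

Lemma det_orthogonal (H : 'M[R]_d) : H^T *m H = 1%:M -> \det H = 1 \/ \det H = -1.
Proof.
move=> HH; have : \det H ^+ 2 = 1 by rewrite expr2 -{1}det_tr -det_mulmx HH det1.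
by move/eqP; rewrite sqrf_eq1 => /orP[] /eqP; [left|right].
Qed.

(* A reflection fixing [x] exists because [2 <= d]; it corrects the sign of the
   determinant. *)
Lemma SO_transitive x y : sqn x = sqn y -> exists2 s, SO s & s *m x = y.
Proof.
move=> xy; have [H [HH Hx]] := householder xy.
have [dH|dH] := det_orthogonal HH; first by exists H.
have d0 : (0 < d)%N by exact: ltn_trans hd.
pose e : 'cV[R]_d := Num.sqrt (sqn x) *: delta_mx (Ordinal d0) ord0.
have [K [KK Ke]] := householder (sqn_scale_delta x (Ordinal d0)).
(* Read as [1 < d], [hd] names the second coordinate. Changing its sign fixes [e], which lies on the
   first axis, and conjugation by [K] makes this a reflection fixing [x]. *)
pose D := diag_mx (\row_(j < d) if j == Ordinal hd then -1 else 1 : R).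
have De : D *m e = e.
  rewrite /e -scalemxAr; congr (_ *: _); apply/matrixP => i j.
  rewrite mul_diag_mx !mxE; case: (i =P Ordinal d0) => [->|_]; last by rewrite mulr0.
  by rewrite mul1r.
have DD : D *m D = 1%:M.
  rewrite mulmx_diag; apply/matrixP => i j; rewrite !mxE.
  by case: ifP => _; rewrite ?mulrNN ?mulr1.
have DT : D^T = D by rewrite /D tr_diag_mx.
have dD : \det D = -1.
  rewrite det_diag (bigD1 (Ordinal hd))//= big1 ?mulr1 => [|j jd]; last by rewrite mxE (negPf jd).
  by rewrite mxE eqxx.
have KK' : K *m K^T = 1%:M by exact: mulmx1C.
exists (H *m (K *m D *m K^T)); last first.
  have KTx : K^T *m x = e by rewrite -Ke mulmxA KK mul1mx.
  by rewrite -mulmxA -!mulmxA KTx De Ke Hx.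
split.
  rewrite !trmx_mul trmxK DT -!mulmxA (mulmxA H^T) HH mul1mx.
  by rewrite (mulmxA K^T) KK mul1mx (mulmxA D) DD mul1mx.
have dK : \det K * \det K = 1 by rewrite -{1}det_tr -det_mulmx KK det1.
by rewrite !det_mulmx det_tr dH dD mulrAC dK; ring.
Qed.

End Rotations.

Section Haar.
Context {R : realType} {d : nat}.
Hypothesis hd : (2 <= d)%N.
Variable nu : {measure set (Md R d) -> \bar R}.
Hypothesis hnu : is_haar_SO nu.

(** The defining equations are polynomial in the entries, and the sum of their squares has [SO] as
    its zero set. *)
Lemma measurable_SO : measurable (@SO R d : set (Md R d)).
Proof.
have ment i j : measurable_fun setT (fun s : Md R d => s i j) := measurable_entry i j.
pose g (s : Md R d) : R := \sum_i \sum_j (((s : 'M[R]_d)^T *m s) i j - (1%:M : 'M[R]_d) i j) ^+ 2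
   + (\det (s : 'M[R]_d) - 1) ^+ 2.
have mg : measurable_fun setT g.
  apply: measurable_funD; last first.
    apply: measurable_funX; apply: measurable_funB => //.
    rewrite /determinant; apply: measurable_sum => p; apply: measurable_funM => //.
    exact: measurable_prod.
  apply: measurable_sum => i; apply: measurable_sum => j; apply: measurable_funX.
  apply: measurable_funB => //; under eq_fun do rewrite mxE.
  apply: measurable_sum => k; under eq_fun do rewrite mxE.
  exact: measurable_funM.
have -> : (@SO R d : set (Md R d)) = g @^-1` [set 0].
  apply/seteqP; split => [s [ss ds]|s /= /eqP]; rewrite /g/=.
    rewrite ds subrr expr0n addr0 big1// => i _; rewrite big1// => j _.
    by rewrite ss subrr expr0n.
  have nn i j : 0 <= (((s : 'M[R]_d)^T *m s) i j - (1%:M : 'M[R]_d) i j) ^+ 2 by exact: sqr_ge0.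
  rewrite paddr_eq0 ?sqr_ge0//; last by apply: sumr_ge0 => i _; apply: sumr_ge0.
  move=> /andP[]; rewrite sqrf_eq0 subr_eq0 => h /eqP ds; split => //.
  apply/matrixP => i j; move: h; rewrite psumr_eq0; last by move=> k _; exact: sumr_ge0.
  move=> /allP/(_ i (mem_index_enum _)) /=; rewrite psumr_eq0//.
  by move=> /allP/(_ j (mem_index_enum _)) /=; rewrite sqrf_eq0 subr_eq0 => /eqP.
by rewrite -[X in measurable X]setTI; exact: mg.
Qed.

Lemma haar_sigma_finite : sigma_finite setT nu.
Proof.
exists (fun=> setT); first by rewrite bigcup_const//; exists 0%N.
by move=> _; split => //; rewrite hnu.1 ltry.
Qed.

Lemma haar_integral_SO (h : Md R d -> \bar R) :
  measurable_fun setT h -> (forall s, 0 <= h s)%E ->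
  (\int[nu]_s h s = \int[nu]_(s in @SO R d) h s)%E.
Proof.
move=> mh h0; have mS := measurable_SO.
have nS : nu (~` @SO R d) = 0%E.
  have H : (nu (@SO R d `|` ~` @SO R d) = nu (@SO R d) + nu (~` @SO R d))%E.
    by apply: measureU => //; [exact: measurableC|exact: setICr].
  have {}H : (1 = 1 + nu (~` @SO R d))%E.
    by rewrite -{1}hnu.1 -hnu.2.1 -H setUv.
  move: H; case: (nu _) => [r| |] //= [] H.
  by congr (_%:E); lra.
by rewrite (ge0_negligible_integral (measurableC mS) measurableT mh _ nS)// setTD setCK.
Qed.

Lemma haar_cst_SO (h : Md R d -> \bar R) (c : \bar R) :
  measurable_fun setT h -> (forall s, 0 <= h s)%E ->
  (forall s, SO s -> h s = c) -> (\int[nu]_s h s = c)%E.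
Proof.
move=> mh h0 hc; rewrite haar_integral_SO//.
rewrite (eq_integral (cst c)); last by move=> s /set_mem /hc.
by rewrite integral_cst// ?hnu.2.1 ?mule1//; exact: measurable_SO.
Qed.

(** The comparison is made on rotations only, which carry all the mass. The larger function [h] is
    arbitrary because it will be an [L^2] integral of the discrepancy, whose measurability in the
    rotation is never established. *)
Lemma haar_integral_le (g h : Md R d -> \bar R) :
  measurable_fun setT g -> (forall s, 0 <= g s)%E -> (forall s, 0 <= h s)%E ->
  (forall s, SO s -> (g s <= h s)%E) -> (\int[nu]_s g s <= \int[nu]_s h s)%E.
Proof.
move=> mg g0 h0 gh; rewrite haar_integral_SO// integral_mkcond.
apply: ge0_le_integral_weak => s _; first by apply: erestrict_ge0 => u _.
by rewrite /patch; case: ifPn => // /set_mem /gh.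
Qed.

Lemma haar_orthogonal_invariant (r : 'M[R]_d) (h : Md R d -> \bar R) : SO r ->
  measurable_fun setT h ->
  (\int[nu]_s h (r *m (s : 'M[R]_d)) = \int[nu]_s h s)%E.
Proof.
move=> rS mh.
have mr : measurable_fun setT (fun s : Md R d => r *m (s : 'M[R]_d) : Md R d).
  apply: (@measurable_matrixP R d d) => i j; under eq_fun do rewrite mxE.
  by apply: measurable_sum => k; apply: measurable_funM => //; exact: measurable_entry.
by apply: (integral_preserving mr) => // A mA; exact: (hnu.2.2 _ rS A mA).
Qed.

(** The transpose is dictated by the frequency side, where rotating a set by [s] composes its
    transform with [s^T]. *)
Definition haar_mean (F : Rd R d -> \bar R) (xi : 'cV[R]_d) : \bar R :=
  (\int[nu]_s F ((s : 'M[R]_d)^T *m xi))%E.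

Section Mean.
Variable F : Rd R d -> \bar R.
Hypothesis mF : measurable_fun setT F.
Hypothesis F0 : forall x, (0 <= F x)%E.

Let mrot : measurable_fun setT (fun z : Rd R d * Md R d => (z.2 : 'M[R]_d)^T *m z.1 : Rd R d).
Proof.
apply: (measurable_mulmxRd (s := fun z : Rd R d * Md R d => (z.2 : 'M[R]_d)^T : Md R d)) => //.
apply: (@measurable_trmxRd R d _ _ (fun z : Rd R d * Md R d => z.2)).
exact: measurable_snd.
Qed.

Let mrot1 xi : measurable_fun setT (fun s : Md R d => (s : 'M[R]_d)^T *m xi : Rd R d).
Proof.
by have := measurableT_comp mrot (pair1_measurable (xi : Rd R d)).
Qed.

Lemma haar_mean_ge0 xi : (0 <= haar_mean F xi)%E.
Proof. exact: integral_ge0. Qed.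

Lemma measurable_haar_mean : measurable_fun setT (haar_mean F : Rd R d -> \bar R).
Proof.
apply: (measurable_tonelli1 haar_sigma_finite (f := fun (xi : Rd R d) (s : Md R d) => F ((s : 'M[R]_d)^T *m xi))) => //.
exact: (measurableT_comp mF mrot).
Qed.

Lemma SO_tr (r : 'M[R]_d) : SO r -> SO r^T.
Proof. by case=> rr dr; split; rewrite ?trmxK ?det_tr//; exact: mulmx1C. Qed.

(** If [y = r x] with [r] a rotation, then [(r s)^T (r x) = s^T x], so left invariance of [nu]
    suffices. *)
Lemma haar_mean_radial x y : sqn x = sqn y -> haar_mean F x = haar_mean F y.
Proof.
move=> /(SO_transitive hd)[r rS <-]; rewrite /haar_mean.
have := haar_orthogonal_invariant rS (h := fun s : Md R d => F ((s : 'M[R]_d)^T *m (r *m x))).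
move=> <-; last exact: (measurableT_comp mF (mrot1 _)).
apply: eq_integral => s _; rewrite trmx_mul -mulmxA.
by rewrite (mulmxA r^T) rS.1 mul1mx.
Qed.

Lemma haar_mean_cst c xi : (forall s, SO s -> F (s^T *m xi) = c) -> haar_mean F xi = c.
Proof. by move=> H; apply: haar_cst_SO => //; exact: (measurableT_comp mF (mrot1 _)). Qed.

Lemma haar_mean_ge (c : R) xi : 0 <= c ->
  (forall s, SO s -> (c%:E <= F (s^T *m xi))%E) -> (c%:E <= haar_mean F xi)%E.
Proof.
move=> c0 H; have mS := measurable_SO.
have <- : (\int[nu]_s (c * \1_(@SO R d : set (Md R d)) s)%:E = c%:E)%E.
  under eq_integral do rewrite EFinM.
  rewrite ge0_integralZl_EFin//; last by apply/measurable_EFinP; exact: measurable_indic.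
  by rewrite integral_indic// setIT hnu.2.1 mule1.
apply: ge0_le_integral_weak => s _; rewrite indicE; first by rewrite lee_fin mulr_ge0.
by have [/set_mem /H|_] := boolP (s \in _); rewrite ?mulr1 ?mulr0.
Qed.

Lemma integral_haar_mean (lam : {measure set (Rd R d) -> \bar R}) :
  is_lebesgue_Rd lam -> (\int[lam]_x haar_mean F x = \int[lam]_x F x)%E.
Proof.
move=> hlam; have slam := lebesgue_sigma_finite hlam.
have mm := measurableT_comp mF mrot.
rewrite /haar_mean (tonelli slam haar_sigma_finite (f := fun (x : Rd R d) (s : Md R d) => F ((s : 'M[R]_d)^T *m x)))//.
apply: haar_cst_SO => [|s|s sS].
- have msw : measurable_fun setT (fun z : Md R d * Rd R d => F ((z.1 : 'M[R]_d)^T *m z.2)).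
    exact: (measurableT_comp mm (@measurable_swap _ _ (Md R d) (Rd R d))).
  exact: (measurable_tonelli1 slam (f := fun (s : Md R d) (x : Rd R d) => F ((s : 'M[R]_d)^T *m x)) msw).
- exact: integral_ge0.
- by apply: (integral_orthogonal hlam (g := F)) => //; exact: (SO_tr sS).1.
Qed.

End Mean.
End Haar.

(** * From integrals over an annulus to integrals along a ray *)

Lemma lebesgue_measure_dilate {R : realType} (r : R) (g : measurableTypeR R -> \bar R) :
  0 < r -> measurable_fun setT g -> (forall t, 0 <= g t)%E ->
  (\int[lebesgue_measure]_t g (r * t)%R = (r^-1)%:E * \int[lebesgue_measure]_t g t)%E.
Proof.
move=> r0 mg g0; have r0' : 0 <= r by exact: ltW.
have mr : measurable_fun setT (fun t : measurableTypeR R => r * t : measurableTypeR R).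
  by apply: measurable_funM.
have H (A : set (measurableTypeR R)) : measurable A ->
    lebesgue_measure A = mscale (NngNum r0') (push_measure lebesgue_measure mr) A.
  apply: lebesgue_measure_unique => _ [[a b] _ <-].
  rewrite [RHS](_ : _ = (r%:E * lebesgue_measure ((fun t : R => (r * t)%R) @^-1` `]a, b]%classic))%E)//.
  rewrite (_ : _ @^-1` _ = `]r^-1 * a, r^-1 * b]%classic); last first.
    apply/seteqP; split => t /=; rewrite !in_itv/=.
      by rewrite ltr_pdivrMl// ler_pdivlMl.
    by rewrite ltr_pdivrMl// ler_pdivlMl.
  rewrite !lebesgue_measure_itv/= !lte_fin ltr_pM2l ?invr_gt0//.
  case: ifP => _; last by rewrite mule0.
  by rewrite -!EFinB -EFinM mulrBr !mulrA divff ?gt_eqF// !mul1r.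
rewrite -(ge0_integral_push lebesgue_measure mr mg g0).
have -> : (\int[lebesgue_measure]_t g t = r%:E * \int[push_measure lebesgue_measure mr]_t g t)%E.
  have <- := ge0_integral_mscale (push_measure lebesgue_measure mr) measurableT (NngNum r0') mg (fun x _ => g0 x).
  by apply: eq_measure_integral => A mA _; exact: H.
by rewrite muleA -EFinM mulVf ?gt_eqF// mul1e.
Qed.

Section Polar.
Context {R : realType} {d : nat} (lam : {measure set (Rd R d) -> \bar R}).
Hypothesis hlam : is_lebesgue_Rd lam.
Hypothesis hd : (2 <= d)%N.
Variable nu : {measure set (Md R d) -> \bar R}.
Hypothesis hnu : is_haar_SO nu.
Variable F : Rd R d -> R.
Hypothesis mF : measurable_fun setT F.
Hypothesis F0 : forall x, 0 <= F x.

Variables (P Q : R) (xi : 'cV[R]_d).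
Hypotheses (P0 : 0 < P) (Q0 : 0 < Q).
Hypothesis xi0 : 0 < sqn xi.

Let n := sqn xi.
Let n0 : 0 < n. Proof. exact: xi0. Qed.
Let G : Rd R d -> \bar R := fun eta => (annulus P Q n^-1 eta * F eta)%:E.
Let h : Rd R d -> \bar R := haar_mean nu G.
Let B : Rd R d -> \bar R := haar_mean nu (EFin \o F).

Let G0 x : (0 <= G x)%E.
Proof. by rewrite lee_fin mulr_ge0 ?annulus_ge0. Qed.

Let mG : measurable_fun setT G.
Proof. by apply/measurable_EFinP; apply: measurable_funM => //; exact: measurable_annulus. Qed.

Let mh : measurable_fun setT h.
Proof. exact: (measurable_haar_mean hnu mG G0). Qed.

Let h0 x : (0 <= h x)%E.
Proof. exact: haar_mean_ge0. Qed.

Let mB : measurable_fun setT B.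
Proof. by apply: (measurable_haar_mean hnu) => //; exact/measurable_EFinP. Qed.

Let B0 x : (0 <= B x)%E.
Proof. by apply: haar_mean_ge0 => y; rewrite lee_fin. Qed.

Let hB x : (h x <= B x)%E.
Proof.
apply: ge0_le_integral_weak => s _; first exact: G0.
by rewrite lee_fin /annulus; case: (_ && _); rewrite ?mul1r ?mul0r.
Qed.

Let h_out x : ~~ (P <= n^-1 * sqn x <= Q) -> h x = 0%E.
Proof.
move=> nx; apply: (haar_mean_cst hnu mG G0) => s sS.
by rewrite /G /annulus (sqn_orthogonal _ (SO_tr sS).1) (negPf nx) mul0r.
Qed.

(** The three factors come from the dilations by [t <= 2], from the change of variable along the
    ray, and from the volume of the ball of [eta] whose dilates can meet the annulus. *)
Let K : R := 2 ^+ d * (2 / Num.sqrt P) * fine (lam (@sball R d (2 * Q))).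

Let mline : measurable_fun setT (fun t : measurableTypeR R => t *: xi : Rd R d).
Proof.
apply: (@measurable_scaleRd R d _ (measurableTypeR R) (fun t => t) (fun=> xi)).
- exact: measurable_id.
- exact: measurable_cst.
Qed.

Let J : \bar R := (\int[lebesgue_measure]_(t in `[Num.sqrt P, Num.sqrt Q]) B (t *: xi))%E.

Let J0 : (0 <= J)%E. Proof. exact: integral_ge0. Qed.

(** As [h] is radial, [h (t eta) = h (r t xi)] with [r = |eta| / |xi|], and the substitution
    [t -> r t] leads to the ray of [xi] at the price [1 / r]. For [r < sqrt P / 2] the segment
    misses the annulus, so only [1 / r <= 2 / sqrt P] has to be paid. *)
Let ray (eta : 'cV[R]_d) :
  (\int[lebesgue_measure]_(t in `[1%R, 2%R]) h (t *: eta) <=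
   (2 / Num.sqrt P)%:E * J * (\1_(@sball R d (n * (2 * Q))) eta)%:E)%E.
Proof.
have sP0 : 0 < Num.sqrt P by rewrite sqrtr_gt0.
have C0 : 0 <= 2 / Num.sqrt P by rewrite divr_ge0.
have rhs0 : (0 <= (2 / Num.sqrt P)%:E * J * (\1_(@sball R d (n * (2 * Q))) eta)%:E)%E.
  by rewrite !mule_ge0// ?lee_fin// indicE.
have vanish : (forall t : R, 1 <= t <= 2 -> ~~ (P <= n^-1 * (t ^+ 2 * sqn eta) <= Q)) ->
  (\int[lebesgue_measure]_(t in `[1%R, 2%R]) h (t *: eta) <=
   (2 / Num.sqrt P)%:E * J * (\1_(@sball R d (n * (2 * Q))) eta)%:E)%E.
  move=> H; rewrite integral0_eq// => t; rewrite /= in_itv/= => /H Ht.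
  by apply: h_out; rewrite sqnZ.
(* The factor 2 gives room for strictness: [sball] is open and the annulus is closed. *)
have [eQ|Qe] := ltP (sqn eta) (n * (2 * Q)); last first.
  apply: vanish => t /andP[t1 t2]; apply/negP => /andP[_].
  rewrite ler_pdivrMl//; apply/negP; rewrite -ltNge.
  have : n * Q < sqn eta by apply: lt_le_trans Qe; rewrite (ltr_pM2l n0) ltr_pMl// ltr1n.
  move=> /lt_le_trans; apply; rewrite ler_peMl ?sqn_ge0// expr_ge1//.
  by apply: le_trans t1.
rewrite indicE mem_set// mule1.
pose r := Num.sqrt (sqn eta / n).
have rn : r ^+ 2 = sqn eta / n by rewrite sqr_sqrtr// divr_ge0 ?sqn_ge0// ltW.
have r0 : 0 <= r by exact: sqrtr_ge0.
have [rs|rb] := ltP r (Num.sqrt P / 2).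
  have {}vanish : (\int[lebesgue_measure]_(t in `[1%R, 2%R]) h (t *: eta) <= 0)%E.
    rewrite integral0_eq// => t; rewrite /= in_itv/= => /andP[t1 t2].
    apply: h_out; rewrite sqnZ; apply/negP => /andP[+ _].
    apply/negP; rewrite -ltNge (_ : n^-1 * _ = (t * r) ^+ 2); last first.
      by rewrite exprMn rn; ring.
    rewrite -[ltRHS](sqr_sqrtr (ltW P0)) ltr_pXn2r ?nnegrE ?sqrtr_ge0//; first by nra.
    by rewrite mulr_ge0//; lra.
  by apply: le_trans vanish _; rewrite mule_ge0.
have rp : 0 < r by apply: lt_le_trans rb; rewrite divr_gt0.
pose H t : \bar R := (B (t *: xi) * (\1_(`[Num.sqrt P, Num.sqrt Q]%classic : set (measurableTypeR R)) t)%:E)%E.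
have mH : measurable_fun setT H.
  apply: emeasurable_funM; first exact: (measurableT_comp mB mline).
  by apply/measurable_EFinP; exact: measurable_indic.
have H0 t : (0 <= H t)%E by rewrite mule_ge0// lee_fin indicE.
have JE : J = (\int[lebesgue_measure]_t H t)%E.
  rewrite /J integral_mkcond; apply: eq_integral => t _.
  by rewrite /H /patch indicE; case: ifP => _; rewrite ?mule1 ?mule0.
have step : (\int[lebesgue_measure]_(t in `[1%R, 2%R]) h (t *: eta) <=
   \int[lebesgue_measure]_t H (r * t)%R)%E.
  apply: (@le_trans _ _ (\int[lebesgue_measure]_(t in `[1%R, 2%R]) H (r * t)%R)%E).
    apply: ge0_le_integral_weak => t; rewrite /= in_itv/= => /andP[t1 t2]; first exact: h0.
    have t0 : 0 < t by lra.
    have -> : h (t *: eta) = h ((r * t) *: xi).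
      rewrite /h; apply: (haar_mean_radial hd hnu mG); rewrite !sqnZ exprMn rn -/n.
      by field; exact: lt0r_neq0.
    have [ain|aout] := boolP (P <= n^-1 * sqn ((r * t) *: xi) <= Q); last by rewrite h_out.
    rewrite /H indicE mem_set ?mule1//= in_itv/=.
    move: ain; rewrite sqnZ -/n mulrCA mulVf ?gt_eqF// mulr1 => /andP[aP aQ].
    have rt0 : 0 <= r * t by rewrite mulr_ge0// ltW.
    have -> : r * t = Num.sqrt ((r * t) ^+ 2) by rewrite sqrtr_sqr ger0_norm.
    by rewrite !ler_wsqrtr.
  apply: ge0_subset_integral => //.
  apply: (measurableT_comp mH); exact: measurable_funM.
apply: le_trans step _; rewrite (lebesgue_measure_dilate rp mH H0) -JE.
apply: lee_wpmul2r => //; rewrite lee_fin.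
by rewrite -[leRHS]invf_div lef_pV2 ?posrE// divr_gt0.
Qed.

(** A substitute for polar coordinates. The integral equals that of the rotational mean [h];
    dilating by [t] in [[1, 2]] changes it by the factor [t ^- d] only. Averaging over [t] and
    exchanging the integrals leaves integrals along rays, which [ray] bounds. *)
Lemma polar_le : (\int[lam]_eta (annulus P Q n^-1 eta * F eta)%:E <=
   (K * Num.sqrt n ^+ d)%:E * J)%E.
Proof.
have slam := lebesgue_sigma_finite hlam.
have -> : (\int[lam]_eta (annulus P Q n^-1 eta * F eta)%:E = \int[lam]_x h x)%E.
  by rewrite (integral_haar_mean hnu mG G0 hlam).
have sleb : sigma_finite setT (@lebesgue_measure R) by exact: sigma_finiteT.
have lebI : (\int[lebesgue_measure]_(t in `[1%R, 2%R]) (cst 1%E t) = 1%:E :> \bar R)%E.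
  rewrite integral_cst//= lebesgue_measure_itv/= lte_fin ltr1n mul1e -EFinB.
  by congr (_%:E); ring.
have -> : (\int[lam]_x h x = \int[lebesgue_measure]_(t in `[1%R, 2%R]) \int[lam]_x h x)%E.
  have hh : (0 <= \int[lam]_x h x)%E by exact: integral_ge0.
  rewrite -[LHS]mule1 -lebI -ge0_integralZl//.
  by apply: eq_integral => t _; rewrite mule1.
pose I t : \bar R := (\1_(`[1%R, 2%R]%classic : set (measurableTypeR R)) t)%:E.
have mI : measurable_fun setT I by apply/measurable_EFinP; exact: measurable_indic.
have mth : measurable_fun setT (fun z : measurableTypeR R * Rd R d => h (z.1 *: (z.2 : 'cV[R]_d))).
  apply: (measurableT_comp mh).
  apply: (@measurable_scaleRd R d _ (measurableTypeR R * Rd R d)%type fst snd).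
  - exact: measurable_fst.
  - exact: measurable_snd.
have mth1 t : measurable_fun setT (fun x : Rd R d => h (t *: (x : 'cV[R]_d))).
  exact: (measurableT_comp mh (measurable_scale t)).
apply: (@le_trans _ _ ((2 ^+ d)%:E * \int[lebesgue_measure]_t \int[lam]_x (I t * h (t *: x))))%E.
  rewrite -ge0_integralZl//; last 2 first.
  - apply: (measurable_tonelli1 slam (f := fun t x => I t * h (t *: x))%E).
      by apply: emeasurable_funM => //; exact: (measurableT_comp mI).
    by move=> t x; rewrite mule_ge0// lee_fin indicE.
  - by move=> t _; apply: integral_ge0 => x _; rewrite mule_ge0// lee_fin indicE.
  rewrite [leLHS]integral_mkcond; apply: ge0_le_integral_weak => t _.
    by apply: erestrict_ge0 => u _; exact: integral_ge0.
  rewrite /patch; case: ifPn => [|_]; last first.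
    apply: mule_ge0 => //; apply: integral_ge0 => x _.
    by rewrite mule_ge0// lee_fin indicE.
  rewrite inE/= in_itv/= => /andP[t1 t2]; have t0 : 0 < t by lra.
  have -> : (\int[lam]_x (I t * h (t *: x)) = (t ^- d)%:E * \int[lam]_x h x)%E.
    rewrite -(integral_scale hlam t0 mh); apply: eq_integral => x _.
    by rewrite /I indicE mem_set ?mul1e//= in_itv/= t1.
  rewrite muleA -EFinM -[leLHS]mul1e; apply: lee_wpmul2r; first exact: integral_ge0.
  rewrite lee_fin ler_pdivlMr ?exprn_gt0// mul1r; apply: lerXn2r => //; rewrite nnegrE//.
  exact: ltW.
rewrite (tonelli sleb slam (f := fun t x => I t * h (t *: x))%E); last 2 first.
- by apply: emeasurable_funM => //; exact: (measurableT_comp mI).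
- by move=> t x; rewrite mule_ge0// lee_fin indicE.
apply: (@le_trans _ _ ((2 ^+ d)%:E * \int[lam]_x ((2 / Num.sqrt P)%:E * J * (\1_(@sball R d (n * (2 * Q))) x)%:E)))%E.
  apply: lee_wpmul2l => //; apply: ge0_le_integral_weak => x _.
    by apply: integral_ge0 => t _; rewrite mule_ge0// lee_fin indicE.
  apply: le_trans (ray x); rewrite [leRHS]integral_mkcond.
  rewrite le_eqVlt; apply/orP; left; apply/eqP; apply: eq_integral => t _.
  by rewrite /patch /I indicE; case: ifP => _; rewrite ?mul1e ?mul0e.
have C0 : 0 <= 2 / Num.sqrt P by rewrite divr_ge0// sqrtr_ge0.
rewrite ge0_integralZl//; last 2 first.
- by apply/measurable_EFinP; apply: measurable_indic; exact: measurable_sball.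
- exact: mule_ge0.
rewrite integral_indic ?setIT//; last exact: measurable_sball.
rewrite -[n in sball (n * _)](sqr_sqrtr (ltW xi0)) sball_scale// ?sqrtr_gt0//.
rewrite -[lam _]fineK ?ge0_fin_numE ?lebesgue_sball_lty//.
rewrite (_ : (K * _)%:E = ((2 ^+ d)%:E * ((2 / Num.sqrt P)%:E *
  ((Num.sqrt (sqn xi) ^+ d)%:E * (fine (lam (@sball R d (2 * Q))))%:E)))%E); last first.
  by rewrite -!EFinM; congr (_%:E); rewrite /K; ring.
by rewrite -!muleA (muleC J) -!muleA.
Qed.

End Polar.

Section AveragedPower.
Context {R : realType} {d : nat} (lam : {measure set (Rd R d) -> \bar R}).
Hypothesis hlam : is_lebesgue_Rd lam.
Hypothesis hd : (2 <= d)%N.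
Variable nu : {measure set (Md R d) -> \bar R}.
Hypothesis hnu : is_haar_SO nu.
Variable Om : set (Rd R d).
Hypothesis mOm : measurable Om.
Hypothesis Ombd : ebounded Om.
Hypothesis Om0 : (0 < lam Om)%E.

Lemma ebounded_lty : (lam Om < +oo)%E.
Proof.
have [M HM] := Ombd.
apply: le_lt_trans (lebesgue_sball_lty hlam (`|M| ^+ 2 + 1)).
apply: le_measure; rewrite ?inE//; first exact: measurable_sball.
move=> x /HM xM; rewrite /sball/= -enorm_sqr.
apply: (@le_lt_trans _ _ (`|M| ^+ 2)); last by rewrite ltrDl.
apply: lerXn2r; rewrite ?nnegrE ?enorm_ge0//.
exact: le_trans (ler_norm _).
Qed.

Let Omoo := ebounded_lty.

Lemma vol_gt0 : 0 < vol lam Om.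
Proof. by rewrite fine_gt0// Om0 Omoo. Qed.

(** For small [eta] the cosine is at least [1 / 2] on the bounded set [Om], so the cosine transform
    keeps half of its value at 0. *)
Lemma power_low : exists2 rho, 0 < rho &
  forall eta : 'cV[R]_d, sqn eta <= rho -> vol lam Om ^+ 2 / 4 <= power lam Om eta.
Proof.
have [M HM] := Ombd.
have [e /= e0 He] : \forall u \near (0 : R), `|cos 0 - cos u| < 2^-1.
  by have /cvgrPdist_lt := @continuous_cos R 0; apply; rewrite invr_gt0.
pose k := e / (M ^+ 2 + 1).
have M1 : 0 < M ^+ 2 + 1 by rewrite ltr_wpDl// sqr_ge0.
have k0 : 0 < k by rewrite divr_gt0.
exists (k * (e / 2)); first by rewrite mulr_gt0// divr_gt0.
move=> eta Heta.
have C : vol lam Om / 2 <= cos_transform lam \1_Om eta.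
  rewrite -(Rintegral_indicR lam mOm) -RintegralZr//; last exact: integrable_indicR.
  apply: le_Rintegral => //.
  - by apply: Rintegrable_mulr; exact: integrable_indicR.
  - by apply: integrable_cos_transform; exact: integrable_indicR.
  move=> y _; rewrite indicE; have [|] := boolP (y \in Om); last by rewrite !mul0r.
  rewrite inE => /HM yM; rewrite !mul1r.
  suff : `|cos 0 - cos (dot y eta)| < 2^-1 by rewrite cos0 ltr_norml => /andP[_]; lra.
  apply: He; rewrite /= sub0r normrN.
  have yM2 : sqn y <= M ^+ 2.
    by rewrite -enorm_sqr; apply: lerXn2r; rewrite ?nnegrE ?enorm_ge0// (le_trans _ yM) ?enorm_ge0.
  have := dot_young y eta k0.
  have h1 : k * sqn y <= e.
    by rewrite /k mulrAC ler_pdivrMr// ler_pM2l// (le_trans yM2)// lerDl.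
  have h2 : k^-1 * sqn eta <= e / 2 by rewrite ler_pdivrMl.
  lra.
rewrite /power; apply: (@le_trans _ _ (cos_transform lam \1_Om eta ^+ 2)).
  rewrite (_ : _ / 4 = (vol lam Om / 2) ^+ 2); last by field.
  apply: lerXn2r => //; rewrite nnegrE; first by rewrite divr_ge0// ltW// vol_gt0.
  by apply: le_trans C; rewrite divr_ge0// ltW// vol_gt0.
by rewrite lerDl sqr_ge0.
Qed.

Let B : Rd R d -> \bar R := haar_mean nu (EFin \o power lam Om).

Let p0 y : (0 <= (EFin \o power lam Om) y)%E.
Proof. by rewrite lee_fin power_ge0. Qed.

Let mp : measurable_fun setT (EFin \o power lam Om : Rd R d -> \bar R).
Proof. by apply/measurable_EFinP; exact: measurable_power. Qed.

Let B0 x : (0 <= B x)%E.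
Proof. exact: haar_mean_ge0. Qed.

Let mB : measurable_fun setT B.
Proof. exact: (measurable_haar_mean hnu mp). Qed.

(** The weight [t ^+ (2 * d)] is the squared Jacobian that appears in the squared transform of a set
    dilated by [t]. *)
Definition averaged_power (a b : R) (xi : 'cV[R]_d) : \bar R :=
  (\int[lebesgue_measure]_(t in `[a, b]) ((t ^+ (2 * d))%:E * B (t *: xi)))%E.

Let mline (xi : 'cV[R]_d) : measurable_fun setT (fun t : measurableTypeR R => t *: xi : Rd R d).
Proof.
apply: (@measurable_scaleRd R d _ (measurableTypeR R) (fun t => t) (fun=> xi)).
- exact: measurable_id.
- exact: measurable_cst.
Qed.

Let averaged_sub (a b a' b' : R) xi : 0 <= a -> a <= a' -> b' <= b ->
  ((a ^+ (2 * d))%:E * \int[lebesgue_measure]_(t in `[a', b']) B (t *: xi) <=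
   averaged_power a b xi)%E.
Proof.
move=> a0 aa bb.
have mBl : measurable_fun setT (fun t : measurableTypeR R => B (t *: xi)).
  exact: (measurableT_comp mB (mline xi)).
have mI : measurable (`[a', b']%classic : set (measurableTypeR R)) by exact: measurable_itv.
have aE : (0 <= (a ^+ (2 * d))%:E :> \bar R)%E by rewrite lee_fin exprn_ge0.
have mT := measurable_funS measurableT (@subsetT _ `[a', b']%classic) mBl.
rewrite -(ge0_integralZl lebesgue_measure mI mT (fun t _ => B0 (t *: xi)) aE).
apply: (@le_trans _ _ (\int[lebesgue_measure]_(t in `[a', b']) ((t ^+ (2 * d))%:E * B (t *: xi)))%E).
  apply: ge0_le_integral_weak => t; rewrite /= in_itv/= => /andP[t1 t2].
    by rewrite mule_ge0// lee_fin exprn_ge0.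
  apply: lee_wpmul2r => //; rewrite lee_fin; apply: lerXn2r; rewrite ?nnegrE//.
    by apply: le_trans a0 (le_trans aa t1).
  exact: le_trans aa t1.
apply: ge0_subset_integral => //.
- apply: emeasurable_funM; last exact: measurable_funTS.
  by apply/measurable_EFinP; apply: measurable_funX; exact: measurable_funTS.
- move=> t; rewrite /= in_itv/= => /andP[t1 t2]; rewrite mule_ge0// lee_fin exprn_ge0//.
  exact: le_trans a0 t1.
- by move=> t; rewrite /= !in_itv/= => /andP[t1 t2]; rewrite (le_trans aa t1) (le_trans t2 bb).
Qed.

(** The decay [|xi|^(-d - 2 b)] in Gaussian form: for [delta <= 1],
    [delta^(d + 2 b) gauss (delta^2) xi] lies below a multiple of both 1 and [|xi|^(-d - 2 b)].
    Frequencies with [s0 |xi|^2 <= 1] are handled by [power_low], the others by [polar_le] and the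
    annulus bound at [s = |xi|^(-2)]. *)
Lemma averaged_power_ge (b c C s0 : R) : 0 < b <= 2^-1 -> 0 < c -> 0 < C -> 0 < s0 ->
  (forall s, 0 < s <= s0 -> c * s `^ b <= gphi lam Om s) ->
  (forall s, 0 < s -> gphi lam Om s <= C * s `^ b) ->
  exists a a' c', [/\ 0 < a, a < a', 0 < c' &
    forall (delta : R) (xi : 'cV[R]_d), 0 < delta <= 1 ->
      ((c' * (delta ^+ d * (delta ^+ 2) `^ b) * gauss (delta ^+ 2) xi)%:E <=
       averaged_power a a' xi)%E].
Proof.
move=> hb c0 C0 s00 lo up; have /andP[b0 b2] := hb.
have [P [Q [c1 [hP Q1 c10 ann]]]] := annulus_power hlam mOm Omoo hb c0 C0 s00 lo up.
have [rho rho0 low] := power_low.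
have /andP[P0 _] := hP; have Q0 : 0 < Q by exact: lt_le_trans Q1.
pose K : R := 2 ^+ d * (2 / Num.sqrt P) * fine (lam (@sball R d (2 * Q))).
have K0 : 0 < K.
  rewrite !mulr_gt0// ?invr_gt0 ?sqrtr_gt0//.
  by rewrite fine_gt0// lebesgue_sball_lty// lebesgue_sball_gt0// mulr_gt0.
(* The first entry puts [[sqrt P, sqrt Q]] inside [[a, a']]; the second gives [(2 a)^2 <= rho * s0],
   so that [t xi] stays in the range of [power_low] for [t <= 2 a]. *)
pose a := Num.min (Num.sqrt P) (Num.sqrt (rho * s0) / 2).
have a0 : 0 < a.
  by rewrite lt_min sqrtr_gt0 P0/= divr_gt0// sqrtr_gt0 mulr_gt0.
pose a' := Num.max (Num.sqrt Q) (2 * a).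
have aa' : a < a' by rewrite lt_max ltr_pMl// ltr1n orbT.
(* An upper bound of [x^(d/2) x^b expR (-x)], through [(1 + x)^(d+1) <= (d+1)^(d+1) expR x]. *)
pose D : R := (d.+1)%:R ^+ d.+1.
have D0 : 0 < D by rewrite exprn_gt0.
pose c2 := a ^+ (2 * d) * (vol lam Om ^+ 2 / 4 * a).
have v0 := vol_gt0.
have c20 : 0 < c2 by rewrite mulr_gt0 ?exprn_gt0// mulr_gt0// divr_gt0// exprn_gt0.
pose c3 := a ^+ (2 * d) * (c1 / K) / D.
have c30 : 0 < c3 by rewrite divr_gt0// mulr_gt0 ?exprn_gt0// divr_gt0.
exists a, a', (Num.min c2 c3); split => //; first by rewrite lt_min c20.
move=> delta xi /andP[d0 d1].
have db0 : 0 <= delta ^+ d * (delta ^+ 2) `^ b by rewrite mulr_ge0 ?powR_ge0// exprn_ge0// ltW.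
have [small|large] := leP (s0 * sqn xi) 1.
  apply: (@le_trans _ _ (c2%:E)).
    rewrite lee_fin -mulrA -[leRHS]mulr1; apply: ler_pM => //.
    - by rewrite le_min (ltW c20) ltW.
    - by rewrite mulr_ge0 ?gauss_ge0.
    - by rewrite ge_min lexx.
    - apply: mulr_ile1 => //; rewrite ?gauss_ge0 ?gauss_le1 ?sqr_ge0//.
      apply: mulr_ile1; rewrite ?powR_ge0 ?exprn_ge0 ?exprn_ile1 ?(ltW d0)//.
      have <- : (1 : R) `^ b = 1 by rewrite powR1.
      by apply: ge0_ler_powR; rewrite ?nnegrE ?(ltW b0) ?exprn_ge0 ?exprn_ile1 ?(ltW d0).
  have a2a : 2 * a <= a' by rewrite le_max lexx orbT.
  apply: le_trans (averaged_sub xi (ltW a0) (lexx a) a2a).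
  rewrite /c2 EFinM; apply: lee_wpmul2l; first by rewrite lee_fin exprn_ge0// ltW.
  have <- : (\int[lebesgue_measure]_(t in `[a, (2 * a)%R]) (cst (vol lam Om ^+ 2 / 4)%:E t) = (vol lam Om ^+ 2 / 4 * a)%:E :> \bar R)%E.
    rewrite integral_cst//= lebesgue_measure_itv/= lte_fin ltr_pMl// ltr1n -EFinB -EFinM.
    by congr (_%:E); ring.
  have v4 : 0 <= vol lam Om ^+ 2 / 4 by rewrite divr_ge0 ?sqr_ge0.
  apply: ge0_le_integral_weak => t; first by rewrite lee_fin.
  rewrite /= in_itv/= => /andP[t1 t2].
  have aP : (2 * a) ^+ 2 <= rho * s0.
    have rs : 0 <= rho * s0 by rewrite ltW// mulr_gt0.
    rewrite -[leRHS](sqr_sqrtr rs); apply: lerXn2r; rewrite ?nnegrE ?sqrtr_ge0 ?mulr_ge0 ?(ltW a0)//.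
    by rewrite mulrC -ler_pdivlMr// ge_min lexx orbT.
  have tb : t ^+ 2 * sqn xi <= rho.
    apply: (@le_trans _ _ ((rho * s0) * sqn xi)).
      rewrite ler_wpM2r ?sqn_ge0//; apply: le_trans aP; apply: lerXn2r; rewrite ?nnegrE ?mulr_ge0 ?(ltW a0)//.
      by apply: le_trans t1; exact: ltW.
    by rewrite -mulrA ler_piMr// ltW.
  apply: (haar_mean_ge hnu p0 v4) => s sS; rewrite lee_fin; apply: low.
  by rewrite (sqn_orthogonal _ (SO_tr sS).1) sqnZ.
have n0 : 0 < sqn xi by rewrite -(pmulr_rgt0 _ s00); exact: lt_trans large.
have aP : a <= Num.sqrt P by rewrite ge_min lexx.
have aQ : Num.sqrt Q <= a' by rewrite le_max lexx.
apply: le_trans (averaged_sub xi (ltW a0) aP aQ).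
set n := sqn xi in n0 *.
have sn : 0 < Num.sqrt n by rewrite sqrtr_gt0.
have nV : 0 < n^-1 by rewrite invr_gt0.
have J1 : ((c1 * n^-1 `^ b)%:E <=
   (K * Num.sqrt n ^+ d)%:E * \int[lebesgue_measure]_(t in `[Num.sqrt P, Num.sqrt Q]) B (t *: xi))%E.
  have H := polar_le hlam hd hnu (measurable_power hlam mOm Omoo) (power_ge0 lam Om) P0 Q0 n0.
  apply: le_trans H; rewrite -EFin_Rintegral; last exact: integrable_annulus_power.
  rewrite lee_fin; apply: ann; rewrite nV -div1r ler_pdivrMr//.
  exact: ltW.
have KN : 0 < K * Num.sqrt n ^+ d by rewrite mulr_gt0// exprn_gt0.
apply: (@le_trans _ _ ((a ^+ (2 * d))%:E * ((K * Num.sqrt n ^+ d)^-1 * (c1 * n^-1 `^ b))%:E)%E); last first.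
  apply: lee_wpmul2l; first by rewrite lee_fin exprn_ge0// ltW.
  by rewrite EFinM lee_pdivrMl.
rewrite -EFinM lee_fin.
apply: (@le_trans _ _ (c3 * (delta ^+ d * (delta ^+ 2) `^ b) * gauss (delta ^+ 2) xi)).
  by rewrite ler_wpM2r ?gauss_ge0// ler_wpM2r// ge_min lexx orbT.
pose x := delta ^+ 2 * n; have x0 : 0 < x by rewrite mulr_gt0// exprn_gt0.
have e1 : (delta ^+ 2) `^ b = x `^ b * n^-1 `^ b.
  rewrite -powRM ?(ltW x0) ?(ltW nV)//; congr (_ `^ _).
  by rewrite /x mulfK// gt_eqF.
have e2 : delta = Num.sqrt x / Num.sqrt n.
  by rewrite /x sqrtrM ?sqr_ge0// sqrtr_sqr gtr0_norm// mulfK// gt_eqF.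
have e3 : delta ^+ d = Num.sqrt x ^+ d * Num.sqrt n ^- d by rewrite {1}e2 exprMn exprVn.
have key : Num.sqrt x ^+ d * x `^ b * expR (- x) <= D.
  rewrite expRN -ler_pdivlMr ?invr_gt0 ?expR_gt0// invrK.
  have x1 : 0 <= 1 + x by rewrite addr_ge0// ltW.
  apply: (@le_trans _ _ ((1 + x) ^+ d.+1)).
    rewrite exprSr; apply: ler_pM; rewrite ?exprn_ge0 ?sqrtr_ge0 ?powR_ge0//.
      apply: lerXn2r; rewrite ?nnegrE ?sqrtr_ge0//.
      rewrite -(@ler_pXn2r _ 2) ?nnegrE ?sqrtr_ge0// sqr_sqrtr ?(ltW x0)//.
      by rewrite sqrrD; nra.
    by apply: powR_le1D; rewrite ?(ltW b0) ?(ltW x0)//; lra.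
  rewrite /D; have -> : expR x = expR (x / d.+1%:R) ^+ d.+1.
    by rewrite -expRM_natl; congr expR; rewrite mulrC divfK// pnatr_eq0.
  rewrite -exprMn; apply: lerXn2r; rewrite ?nnegrE ?mulr_ge0 ?expR_ge0//.
  apply: (@le_trans _ _ (d.+1%:R * (1 + x / d.+1%:R))); last first.
    by rewrite ler_wpM2l// expR_ge1Dx.
  rewrite mulrDr mulr1 mulrCA divff ?pnatr_eq0// mulr1.
  by rewrite lerD2r ler1n.
rewrite e1 e3 /gauss -/n -/x /c3.
rewrite [leLHS](_ : _ = a ^+ (2 * d) * (c1 / K) / D * (Num.sqrt n ^- d * n^-1 `^ b) *
  (Num.sqrt x ^+ d * x `^ b * expR (- x))); last by ring.
rewrite [leRHS](_ : _ = a ^+ (2 * d) * (c1 / K) / D * (Num.sqrt n ^- d * n^-1 `^ b) * D); last first.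
  by rewrite invfM; field; rewrite !gt_eqF ?exprn_gt0.
apply: ler_wpM2l => //; apply: mulr_ge0; first exact: ltW.
by rewrite mulr_ge0 ?powR_ge0// invr_ge0 exprn_ge0// ltW.
Qed.

End AveragedPower.

(** * The measure [mu]: total mass and Gaussian potentials *)

Section FrostmanMeasure.
Context {R : realType} {d : nat} (mu : {measure set (Rd R d) -> \bar R}).
Hypothesis hsupp1 : mu (msupport mu) = 1%E.
Implicit Types x y z : 'cV[R]_d.

Lemma eballE x (r : R) : 0 <= r -> eball x r = [set y | sqn (y - x) < r ^+ 2].
Proof. by move=> r0; apply/seteqP; split => y; rewrite /eball/= enorm_ltE. Qed.

Lemma measurable_eball x (r : R) : 0 <= r -> measurable (eball x r : set (Rd R d)).
Proof.
move=> r0; rewrite eballE//.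
have mb : measurable_fun setT (fun y : Rd R d => sqn ((y : 'cV[R]_d) - x) < r ^+ 2).
  by apply: measurable_fun_ltr => //; apply: measurable_sqn; exact: measurable_subRd.
by have := mb measurableT [set true] I; rewrite setTI; exact.
Qed.

Lemma sqn_add_le x y : sqn (x + y) <= 2 * sqn x + 2 * sqn y.
Proof.
have := sqn_ge0 (x - y); rewrite !sqnD sqnN dotNr; lra.
Qed.

(* The complement of the support is covered by countably many null balls with
   rational centres. *)
Lemma msupportC_null : measurable (msupport mu : set (Rd R d)) /\
  mu (~` msupport mu) = 0%E.
Proof.
pose ctr (q : 'cV[rat]_d) : 'cV[R]_d := map_mx ratr q.
pose F (p : 'cV[rat]_d * nat) : set (Rd R d) :=
  if `[< mu (eball (ctr p.1) p.2.+1%:R^-1) = 0%E >] then eball (ctr p.1) p.2.+1%:R^-1 else set0.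
have r0 (k : nat) : 0 <= (k.+1%:R : R)^-1 by rewrite invr_ge0.
have mF p : measurable (F p).
  by rewrite /F; case: asboolP => // _; exact: measurable_eball.
have F0 p : mu (F p) = 0%E by rewrite /F; case: asboolP => // _; rewrite measure0.
suff E : ~` msupport mu = \bigcup_p F p.
  have mU : measurable (\bigcup_p F p) by exact: countable_bigcupT_measurable.
  split; first by rewrite -[msupport mu]setCK E; exact: measurableC.
  rewrite E; apply/eqP; rewrite eq_le measure_ge0 andbT.
  (* Lists the countable index set as a sequence, the form in which sigma-subadditivity applies. *)
  pose G n := if @unpickle ('cV[rat]_d * nat)%type n is Some p then F p else set0.
  have -> : \bigcup_p F p = \bigcup_n G n.
    apply/seteqP; split => [x [p _ Fp]|x [n _]].
      by exists (pickle p) => //; rewrite /G pickleK.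
    by rewrite /G; case: unpickle => // p Fp; exists p.
  have mG n : measurable (G n) by rewrite /G; case: unpickle.
  apply: le_trans (measure_sigma_subadditive mu mG (bigcupT_measurable _ mG) (@subset_refl _ _)) _.
  by rewrite eseries0// => n _ _; rewrite /G; case: unpickle => [p|]; [exact: F0|exact: measure0].
apply/seteqP; split => [x nx|x [p _]]; last first.
  rewrite /F; case: asboolP => // null xp H.
  set c := ctr p.1 in null xp; set r := p.2.+1%:R^-1 in null xp.
  have rp : 0 < r by rewrite invr_gt0.
  set s := sqn (x - c).
  have s0 : 0 <= s by exact: sqn_ge0.
  have sr : s < r ^+ 2 by move: xp; rewrite eballE// ltW.
  pose g := (r ^+ 2 - s) / 2; have g0 : 0 < g by rewrite divr_gt0// subr_gt0.
  (* With this Young weight and the squared radius [g / (1 + k)], points near [x] have squared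
     distance to [c] below [s + 2 g = r ^+ 2], hence stay in the null ball. *)
  pose k := (s + 1) / g; have k0 : 0 < k by rewrite divr_gt0// ltr_wpDl.
  have rho0 : 0 < g / (1 + k) by rewrite divr_gt0// addr_gt0.
  have := H _ (_ : 0 < Num.sqrt (g / (1 + k))); rewrite sqrtr_gt0 => /(_ rho0).
  apply/negP; rewrite -leNgt -null; apply: le_measure; rewrite ?inE.
  - by apply: measurable_eball; exact: sqrtr_ge0.
  - by apply: measurable_eball; exact: ltW.
  rewrite !eballE ?sqrtr_ge0 ?(ltW rp)// => y /=.
  rewrite sqr_sqrtr ?(ltW rho0)// ltr_pdivlMr ?addr_gt0// => h.
  have -> : y - c = (y - x) + (x - c) by rewrite addrA subrK.
  rewrite sqnD -/s.
  have := dot_young (y - x) (x - c) k0; rewrite -/s.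
  have : k^-1 * s <= g.
    rewrite /k invf_div mulrAC ler_pdivrMr ?ltr_wpDl// mulrDr mulr1 lerDl.
    exact: ltW.
  have := ler_norm (dot (y - x) (x - c)).
  move: h; rewrite mulrDr mulr1.
  have -> : r ^+ 2 = s + 2 * g by rewrite /g; field.
  move=> h1 h2 h3 h4; lra.
have [r [rp nr]] : exists r : R, 0 < r /\ mu (eball x r) = 0%E.
  apply: contrapT => /forallNP H; apply: nx => r rp; rewrite lt_neqAle measure_ge0 andbT eq_sym.
  by apply/eqP => E; apply: (H r).
(* A ball of radius below [r / 2] with a rational centre closer than that radius to [x] contains [x]
   and lies in the null ball around [x]. *)
have [k kr] : exists k : nat, k.+1%:R^-1 < r / 2.
  by exists (Num.trunc (r / 2)^-1); rewrite invf_plt ?posrE ?divr_gt0// truncnS_gt.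
set e := k.+1%:R^-1 in kr.
have e0 : 0 < e by rewrite invr_gt0.
pose h := e / d.+1%:R; have h0 : 0 < h by rewrite divr_gt0.
have hq (i : 'I_d) : {q : rat | `|x i ord0 - ratr q| < h}.
  apply: cid.
  have : x i ord0 - h < x i ord0 + h by lra.
  move=> /rat_in_itvoo[q]; rewrite in_itv/= => /andP[q1 q2]; exists q.
  by rewrite ltr_distlC q1 q2.
pose q : 'cV[rat]_d := \col_i sval (hq i).
have cx : sqn (x - ctr q) < e ^+ 2.
  apply: (@le_lt_trans _ _ (\sum_(i < d) h ^+ 2)).
    rewrite sqnE; apply: ler_sum => i _; rewrite !mxE.
    rewrite -real_normK ?num_real//; apply: lerXn2r; rewrite ?nnegrE ?(ltW h0)//.
    by apply: ltW; exact: svalP (hq i).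
  rewrite sumr_const card_ord -[X in X < _]mulr_natr /h exprMn -mulrA gtr_pMr ?exprn_gt0//.
  rewrite exprVn ltr_pdivrMl ?exprn_gt0// mulr1 -natrX ltr_nat.
  by rewrite -mulnn mulSn ltn_addr.
exists (q, k) => //; rewrite /F/= asboolT; last first.
  apply/eqP; rewrite eq_le measure_ge0 andbT -nr; apply: le_measure; rewrite ?inE.
  - by apply: measurable_eball; exact: ltW.
  - by apply: measurable_eball; exact: ltW.
  rewrite !eballE ?(ltW rp) ?(ltW e0)// => y /= yc.
  have -> : y - x = (y - ctr q) + (ctr q - x) by rewrite addrA subrK.
  apply: le_lt_trans (sqn_add_le _ _) _; rewrite (sqnB_sym (ctr q)).
  have : 4 * e ^+ 2 < r ^+ 2.
    rewrite (_ : 4 * _ = (2 * e) ^+ 2); last by ring.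
    by rewrite ltr_pXn2r ?nnegrE ?mulr_ge0 ?(ltW e0) ?(ltW rp)//; lra.
  by move: cx yc; rewrite -/e; lra.
by rewrite eballE ?(ltW e0).
Qed.

Lemma frostman_total : mu setT = 1%E.
Proof.
have [mS nS] := msupportC_null.
have H : (mu (msupport mu `|` ~` msupport mu) = mu (msupport mu) + mu (~` msupport mu))%E.
  by apply: measureU => //; [exact: measurableC|exact: setICr].
by move: H; rewrite setUv hsupp1 nS adde0.
Qed.

Variables (alpha c0 : R).
Hypothesis alpha0 : 0 < alpha.
Hypothesis c00 : 0 < c0.
Hypothesis hball : forall x (r : R), 0 < r ->
  (mu (eball x r) <= (c0 * r `^ alpha)%:E)%E.

(* Comparing the Gaussian at scale [delta] with the one at scale [2 delta]
   reduces the estimate to large scales, where it is trivial. *)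
Lemma frostman_gauss : exists2 K, 1 <= K & forall (delta : R) z, 0 < delta ->
  (\int[mu]_y (gauss (8 * delta ^+ 2)^-1 (z - y))%:E <= (K * delta `^ alpha)%:E)%E.
Proof.
(* So that the estimate at scale [2 delta] contributes exactly half:
   [eps (2 delta)^alpha = delta^alpha / 2]. *)
pose eps : R := (2 `^ alpha)^-1 / 2.
have ta0 : 0 < (2 : R) `^ alpha by rewrite powR_gt0.
have eps0 : 0 < eps by rewrite divr_gt0// invr_gt0.
(* The quotient of the Gaussians at scales [delta] and [2 delta] has rate [(1/8 - 1/32) / delta^2 =
   3 / (32 delta^2)]. It is at most [eps] at distance [rho * delta] or more, since
   [3 * rho2 / 32 = eps^-1]. *)
pose rho2 := 32 / (3 * eps).
have rho20 : 0 < rho2 by rewrite divr_gt0// mulr_gt0.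
pose rho := Num.sqrt rho2; have rho0 : 0 < rho by rewrite sqrtr_gt0.
(* The entry 1 settles [delta >= 1] by total mass; the other one makes the share of the ball at most
   half of the bound. *)
pose K := Num.max 1 (2 * (c0 * rho `^ alpha)).
have K1 : 1 <= K by rewrite le_max lexx.
exists K => //.
have mg s z : measurable_fun setT (fun y : Rd R d => (gauss s (z - y : 'cV[R]_d))%:E : \bar R).
  apply/measurable_EFinP; apply: (measurableT_comp (measurable_gauss s)).
  exact: measurable_subRd.
have base (delta : R) z : 1 <= delta ->
    (\int[mu]_y (gauss (8 * delta ^+ 2)^-1 (z - y))%:E <= (K * delta `^ alpha)%:E)%E.
  move=> d1; apply: (@le_trans _ _ (\int[mu]_y cst 1%E y)%E).
    apply: ge0_le_integral_weak => y _; rewrite lee_fin ?gauss_ge0//.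
    by rewrite gauss_le1// invr_ge0 mulr_ge0 ?sqr_ge0.
  rewrite integral_cst// frostman_total mule1 lee_fin -[1]mulr1; apply: ler_pM => //.
  have -> : 1 = (1 : R) `^ alpha by rewrite powR1.
  by apply: ge0_ler_powR; rewrite ?nnegrE ?(ltW alpha0)// (le_trans _ d1).
(* Induction on the number of doublings that bring [delta] above 1. *)
suff H (n : nat) (delta : R) z : 0 < delta -> 1 <= delta * 2 ^+ n ->
    (\int[mu]_y (gauss (8 * delta ^+ 2)^-1 (z - y))%:E <= (K * delta `^ alpha)%:E)%E.
  move=> delta z d0; apply: (H (Num.trunc delta^-1).+1) => //.
  rewrite mulrC -ler_pdivrMr// mul1r; apply: le_trans (ltW (truncnS_gt _)) _.
  by rewrite -natrX ler_nat ltnW// ltn_expl.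
elim: n delta => [|n IH] delta d0 hn; first by apply: base; rewrite expr0 mulr1 in hn.
have d20 : 0 < 2 * delta by rewrite mulr_gt0.
have {}IH := IH (2 * delta) d20.
rewrite exprS mulrA (mulrC delta) in hn; have {IH hn} IH := IH hn.
have pw y : gauss (8 * delta ^+ 2)^-1 (z - y) <=
    \1_(eball z (rho * delta) : set (Rd R d)) y + eps * gauss (8 * (2 * delta) ^+ 2)^-1 (z - y).
  have g0 : 0 <= eps * gauss (8 * (2 * delta) ^+ 2)^-1 (z - y).
    by rewrite mulr_ge0 ?gauss_ge0// ltW.
  rewrite indicE; have [|] := boolP (y \in _) => yb.
    rewrite -[leLHS]addr0 lerD// gauss_le1// invr_ge0 mulr_ge0 ?sqr_ge0//.
  rewrite add0r; have rd0 : 0 <= rho * delta by rewrite mulr_ge0 ?(ltW rho0) ?(ltW d0).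
  have big : rho2 * delta ^+ 2 <= sqn (z - y).
    move: yb; rewrite notin_setE eballE//= => /negP; rewrite -leNgt.
    by rewrite exprMn /rho sqr_sqrtr ?(ltW rho20)// sqnB_sym.
  set v := sqn (z - y) in big *.
  have -> : gauss (8 * delta ^+ 2)^-1 (z - y) =
     expR (- (3 / (32 * delta ^+ 2) * v)) * gauss (8 * (2 * delta) ^+ 2)^-1 (z - y).
    rewrite /gauss -expRD -/v; congr expR; field; exact: lt0r_neq0.
  rewrite ler_wpM2r ?gauss_ge0// expRN -[eps]invrK lef_pV2 ?posrE ?expR_gt0 ?invr_gt0//.
  have : eps^-1 <= 3 / (32 * delta ^+ 2) * v.
    have -> : eps^-1 = 3 / (32 * delta ^+ 2) * (rho2 * delta ^+ 2).
      by rewrite /rho2; field; rewrite ?lt0r_neq0.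
    by rewrite ler_wpM2l// divr_ge0// mulr_ge0 ?sqr_ge0.
  by have := expR_ge1Dx (3 / (32 * delta ^+ 2) * v); lra.
have rd0 : 0 < rho * delta by rewrite mulr_gt0.
have mb : measurable (eball z (rho * delta) : set (Rd R d)) by apply: measurable_eball; exact: ltW.
apply: (@le_trans _ _ (\int[mu]_y ((\1_(eball z (rho * delta) : set (Rd R d)) y)%:E + eps%:E * (gauss (8 * (2 * delta) ^+ 2)^-1 (z - y))%:E))%E).
  apply: ge0_le_integral_weak => y _; first by rewrite lee_fin gauss_ge0.
  by rewrite -EFinM -EFinD lee_fin.
rewrite ge0_integralD//; last 3 first.
- by apply/measurable_EFinP; exact: measurable_indic.
- by move=> y _; rewrite -EFinM lee_fin mulr_ge0 ?gauss_ge0// ltW.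
- by apply: emeasurable_funM => //; exact: measurable_cst.
rewrite integral_indic// setIT ge0_integralZl_EFin ?(ltW eps0)//; last first.
  by move=> y _; rewrite lee_fin gauss_ge0.
apply: (@le_trans _ _ ((c0 * (rho * delta) `^ alpha)%:E + eps%:E * (K * (2 * delta) `^ alpha)%:E)%E).
  by apply: leeD; [exact: hball|apply: lee_wpmul2l; rewrite ?lee_fin ?(ltW eps0)].
rewrite -EFinM -EFinD lee_fin !powRM ?(ltW rho0) ?(ltW d0)//.
have : 2 * (c0 * rho `^ alpha) <= K by rewrite le_max lexx orbT.
have : 0 <= delta `^ alpha by exact: powR_ge0.
have -> : eps * (K * (2 `^ alpha * delta `^ alpha)) = K / 2 * delta `^ alpha.
  by rewrite /eps; field; exact: lt0r_neq0.
move=> da h; have := ler_wpM2r da h; lra.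
Qed.

End FrostmanMeasure.

(** * Transform of the measure of a moving set *)

Section CountTransform.
Context {R : realType} {d : nat} (lam : {measure set (Rd R d) -> \bar R}).
Hypothesis hlam : is_lebesgue_Rd lam.
Variable Om : set (Rd R d).
Hypothesis mOm : measurable Om.
Hypothesis Ombd : ebounded Om.
Variables (tau : R) (s : 'M[R]_d).
Hypothesis tau0 : 0 < tau.
Hypothesis ss : s^T *m s = 1%:M.

Let ss' : s *m s^T = 1%:M. Proof. exact: mulmx1C. Qed.

Lemma movedE (x : 'cV[R]_d) :
  moved x tau s Om = [set y | Om (tau^-1 *: (s^T *m (y - x)))].
Proof.
apply/seteqP; split => [_ [w Ow <-]|y /= Oy].
  rewrite /= addrC addKr -scalemxAr mulmxA ss mul1mx scalerA mulVf ?scale1r//.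
  exact: lt0r_neq0.
exists (tau^-1 *: (s^T *m (y - x))) => //.
rewrite -scalemxAr mulmxA ss' mul1mx scalerA divff ?scale1r; last exact: lt0r_neq0.
by rewrite addrC subrK.
Qed.

(** The indicator of [moved x tau s Om] at [y] is [moved_indic (y - x)], which makes [moved_count] a
    convolution. *)
Definition moved_indic (v : 'cV[R]_d) : R := \1_Om (tau^-1 *: (s^T *m v)).

Lemma moved_indic_ge0 v : 0 <= moved_indic v.
Proof. by rewrite /moved_indic indicE. Qed.

Lemma moved_indic_le1 v : moved_indic v <= 1.
Proof. by rewrite /moved_indic indicE; case: (_ \in _). Qed.

Lemma measurable_moved_indic : measurable_fun setT (moved_indic : Rd R d -> R).
Proof.
apply: (measurableT_comp (f := \1_Om : Rd R d -> R)); first exact: measurable_indic.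
by apply: measurable_scaleRd => //; exact: measurable_mul.
Qed.

Let mg := measurable_moved_indic.

Lemma measurable_moved (x : 'cV[R]_d) : measurable (moved x tau s Om : set (Rd R d)).
Proof.
rewrite movedE -[X in measurable X]setTI.
have mf : measurable_fun setT (fun y : Rd R d => tau^-1 *: (s^T *m ((y : 'cV[R]_d) - x)) : Rd R d).
  apply: (measurableT_comp (measurable_scale tau^-1)).
  by apply: (measurableT_comp (measurable_mul s^T)); exact: measurable_subRd.
exact: mf.
Qed.

(** The substitution [x = y - tau s w], carried out as a translation, a reflection, a rotation and a
    dilation. *)
Lemma Rintegral_moved_indic (K : Rd R d -> R) (y : 'cV[R]_d) : measurable_fun setT K ->
  \int[lam]_x (moved_indic (y - x) * K x) =
  tau ^+ d * \int[lam]_w (\1_Om w * K (y - s *m (tau *: w) : 'cV[R]_d)).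
Proof.
move=> mK.
have mys : measurable_fun setT (fun x : Rd R d => y - (x : 'cV[R]_d) : Rd R d).
  exact: measurable_subRd.
have mh : measurable_fun setT (fun x : Rd R d => moved_indic (y - x : 'cV[R]_d) * K x).
  by apply: measurable_funM => //; exact: (measurableT_comp mg mys).
rewrite -(Rintegral_translate hlam y mh).
have mh1 : measurable_fun setT (fun x : Rd R d => moved_indic (y - (y + x) : 'cV[R]_d) * K (y + x : 'cV[R]_d)).
  exact: (measurableT_comp mh (measurable_addl y)).
rewrite -(Rintegral_opp hlam mh1).
have mk : measurable_fun setT (fun x : Rd R d => moved_indic x * K (y - x : 'cV[R]_d)).
  by apply: measurable_funM => //; exact: (measurableT_comp mK mys).
transitivity (\int[lam]_x (moved_indic x * K (y - x : 'cV[R]_d))).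
  by apply: eq_Rintegral => x _; congr (moved_indic _ * _); rewrite opprB addrCA subrr addr0.
rewrite -(Rintegral_orthogonal hlam ss mk).
have ml : measurable_fun setT (fun x : Rd R d => moved_indic (s *m x) * K (y - s *m x : 'cV[R]_d)).
  exact: (measurableT_comp mk (measurable_mul s)).
have := Rintegral_scale hlam tau0 ml => /(congr1 (fun z => tau ^+ d * z)).
rewrite mulrA divff ?mul1r; last by rewrite expf_neq0// gt_eqF.
move=> <-; congr (_ * _); apply: eq_Rintegral => w _.
rewrite /moved_indic (mulmxA s^T) ss mul1mx scalerA mulVf ?scale1r//.
exact: lt0r_neq0.
Qed.

Section Measure.
Variable m : {measure set (Rd R d) -> \bar R}.
Hypothesis mfin : (m setT < +oo)%E.

Definition moved_count (x : 'cV[R]_d) : R := fine (m (moved x tau s Om)).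

Lemma finite_sigma_finite : sigma_finite setT m.
Proof.
exists (fun=> setT); first by rewrite bigcup_const//; exists 0%N.
by move=> _; split.
Qed.

Let sm := finite_sigma_finite.
Let slam := lebesgue_sigma_finite hlam.

Lemma integrable_cst_finite (c : R) : m.-integrable setT (EFin \o (fun _ : Rd R d => c)).
Proof.
apply/integrableP; split; first exact: measurable_cst.
by rewrite integral_cst//= lte_mul_pinfty.
Qed.

Let msub : measurable_fun setT (fun z : Rd R d * Rd R d => (z.2 : 'cV[R]_d) - z.1 : Rd R d).
Proof. exact: measurable_subRd. Qed.

Lemma moved_countE x : moved_count x = \int[m]_y moved_indic (y - x).
Proof.
rewrite /moved_count /Rintegral.
rewrite -(setIT (moved _ _ _ _)) -integral_indic//; last exact: measurable_moved.
congr fine; apply: eq_integral => y _; rewrite /moved_indic !indicE.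
by congr ((nat_of_bool _)%:R%:E); rewrite movedE; apply/idP/idP; rewrite !inE.
Qed.

Lemma moved_count_ge0 x : 0 <= moved_count x.
Proof. exact: fine_ge0. Qed.

Lemma moved_count_le x : moved_count x <= fine (m setT).
Proof.
apply: fine_le; rewrite ?ge0_fin_numE//.
  apply: le_lt_trans mfin; apply: le_measure; rewrite ?inE//; exact: measurable_moved.
by apply: le_measure; rewrite ?inE//; exact: measurable_moved.
Qed.

Section Kernel.
Variable K : Rd R d -> R.
Hypothesis mK : measurable_fun setT K.
Hypothesis K1 : forall x, `|K x| <= 1.

Let f (x y : Rd R d) : R := moved_indic ((y : 'cV[R]_d) - x) * K x.

Let mf : measurable_fun setT (fun z : Rd R d * Rd R d => f z.1 z.2).
Proof.
apply: measurable_funM; first exact: (measurableT_comp mg msub).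
exact: (measurableT_comp mK).
Qed.

Let fle x y : `|f x y| <= moved_indic ((y : 'cV[R]_d) - x).
Proof. by rewrite normrM (ger0_norm (moved_indic_ge0 _)) ler_piMr// moved_indic_ge0. Qed.

(** Boundedness of [Om] provides a Gaussian majorant in [y - x], whose integral in [x] is the same
    for all [y]; the double integral against the finite measure [m] is therefore finite. *)
Let gauss_dom : exists2 C, 0 <= C & forall v, moved_indic v <= C * gauss 1 v.
Proof.
have [M HM] := Ombd.
exists (expR (tau ^+ 2 * M ^+ 2)); first exact: expR_ge0.
move=> v; rewrite /moved_indic indicE /gauss mul1r -expRD; have [|_] := boolP (_ \in _); last exact: expR_ge0.
rewrite inE => /HM vM; rewrite -expR0 ler_expR subr_ge0.
have : sqn (tau^-1 *: (s^T *m v)) <= M ^+ 2.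
  by rewrite -enorm_sqr; apply: lerXn2r; rewrite ?nnegrE ?enorm_ge0// (le_trans _ vM) ?enorm_ge0.
rewrite sqnZ sqn_orthogonal ?trmxK// exprVn ler_pdivrMl ?exprn_gt0//.
Qed.

Let i2 y : lam.-integrable setT (EFin \o (fun x : Rd R d => gauss 1 (y - x : 'cV[R]_d) : R)).
Proof.
rewrite (_ : (fun x : Rd R d => _) = fun x : Rd R d => gauss 1 (x - y : 'cV[R]_d)); last first.
  by apply/funext => x; rewrite /gauss sqnB_sym.
by apply: (integrable_subr hlam y); exact: integrable_gauss.
Qed.

Let sl1 y : lam.-integrable setT (EFin \o f ^~ y).
Proof.
have [C C0 HC] := gauss_dom.
apply: integrable_le (Rintegrable_mull C (i2 y)) => [|x].
  by have := measurableT_comp mf (pair2_measurable y).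
by apply: le_trans (fle x y) (HC _).
Qed.

Let sl2 x : m.-integrable setT (EFin \o f x).
Proof.
apply: integrable_le (integrable_cst_finite 1) => [|y].
  by have := measurableT_comp mf (pair1_measurable x).
exact: le_trans (fle x y) (moved_indic_le1 _).
Qed.

Let ffin : (\int[lam]_x \int[m]_y `|(f x y)%:E| < +oo)%E.
Proof.
have [C C0 HC] := gauss_dom.
rewrite (tonelli slam sm (f := fun x y => `|(f x y)%:E|%E))//; last first.
  by apply/measurable_EFinP; exact: measurableT_comp.
apply: (@le_lt_trans _ _ (\int[m]_y cst (C * Zg lam 1)%:E y)%E).
  apply: ge0_le_integral_weak => y _; first exact: integral_ge0.
  have -> : C * Zg lam 1 = \int[lam]_x (C * gauss 1 (y - x : 'cV[R]_d)).
    rewrite (RintegralZl C measurableT (i2 y)); congr (C * _).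
    rewrite /Zg -(Rintegral_subr hlam y (measurable_gauss 1)).
    by apply: eq_Rintegral => x _; rewrite /gauss sqnB_sym.
  rewrite EFin_Rintegral; last exact: (Rintegrable_mull C (i2 y)).
  apply: ge0_le_integral_weak => x _ //=.
  by rewrite lee_fin; apply: le_trans (fle x y) (HC _).
have Z0 : 0 <= C * Zg lam 1 by rewrite mulr_ge0// ltW// Zg_gt0.
by rewrite integral_cst//= lte_mul_pinfty.
Qed.

Let countK x : moved_count x * K x = \int[m]_y f x y.
Proof.
rewrite moved_countE -RintegralZr//.
apply: integrable_le (integrable_cst_finite 1) => [|y].
  by apply: (measurableT_comp mg); exact: measurable_subRd.
by rewrite ger0_norm ?moved_indic_ge0 ?moved_indic_le1.
Qed.

Lemma integrable_moved_countM :
  lam.-integrable setT (EFin \o (fun x : Rd R d => moved_count x * K x)).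
Proof.
rewrite (_ : (fun x : Rd R d => _) = fun x => \int[m]_y f x y); last exact/funext.
exact: (integrable_iterated1 slam sm mf sl2 ffin).
Qed.

Lemma Rintegral_moved_countM :
  \int[lam]_x (moved_count x * K x) =
  \int[m]_y (tau ^+ d * \int[lam]_w (\1_Om w * K (y - s *m (tau *: w) : 'cV[R]_d))).
Proof.
transitivity (\int[lam]_x \int[m]_y f x y); first by apply: eq_Rintegral => x _.
rewrite (Rfubini_iterated slam sm mf sl2 sl1 ffin).
by apply: eq_Rintegral => y _; rewrite -Rintegral_moved_indic.
Qed.

End Kernel.

Lemma integrable_moved_count : lam.-integrable setT (EFin \o (moved_count : Rd R d -> R)).
Proof.
have := integrable_moved_countM (K := fun=> 1) (measurable_cst _).
rewrite (_ : (fun x => _) = moved_count); last by apply/funext => x; rewrite mulr1.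
by apply => x; rewrite normr1.
Qed.

Let O1 := integrable_indicR mOm (ebounded_lty hlam mOm Ombd).
Let w1 := integrable_cst_finite 1.

(** Convolution becomes multiplication: the complex transform of the count is [tau ^+ d] times that
    of [m] at [xi] times the conjugate of that of [1_Om] at [tau s^T xi]. This is the real part;
    [sin_transform_moved_count] is the imaginary part. *)
Lemma cos_transform_moved_count xi :
  cos_transform lam (moved_count) xi = tau ^+ d *
   (cos_transform m (cst 1) xi * cos_transform lam \1_Om (tau *: (s^T *m xi)) +
    sin_transform m (cst 1) xi * sin_transform lam \1_Om (tau *: (s^T *m xi))).
Proof.
have mdot : measurable_fun setT (fun x : Rd R d => dot x xi).
  exact: (@measurable_dot _ _ _ _ id (cst xi : _ -> Rd R d)).
rewrite /cos_transform Rintegral_moved_countM; last 2 first.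
- exact: measurable_cos.
- by move=> x; exact: normr_cos_le1.
set eta := tau *: (s^T *m xi).
have E (y : 'cV[R]_d) : \int[lam]_w (\1_Om w * cos (dot (y - s *m (tau *: w)) xi)) =
    cos (dot y xi) * cos_transform lam \1_Om eta + sin (dot y xi) * sin_transform lam \1_Om eta.
  have oc := integrable_cos_transform O1 eta; have os := integrable_sin_transform O1 eta.
  rewrite /cos_transform /sin_transform -(RintegralZl _ measurableT oc) -(RintegralZl _ measurableT os).
  rewrite -RintegralD//; [|exact: Rintegrable_mull|exact: Rintegrable_mull].
  apply: eq_Rintegral => w _.
  rewrite dotBl dot_mull dotZl -dotZr -/eta cosB; ring.
under eq_Rintegral do rewrite E.
have ic := integrable_cos_transform w1 xi; have is' := integrable_sin_transform w1 xi.
have -> : (fun y : Rd R d => tau ^+ d * (cos (dot y xi) * cos_transform lam \1_Om eta + sin (dot y xi) * sin_transform lam \1_Om eta)) =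
  (fun y : Rd R d => tau ^+ d * (((cst 1 : Rd R d -> R) y * cos (dot y xi)) * cos_transform lam \1_Om eta + ((cst 1 : Rd R d -> R) y * sin (dot y xi)) * sin_transform lam \1_Om eta)).
  by apply/funext => y; rewrite /= !mul1r.
rewrite RintegralZl//; last by apply: Rintegrable_add; apply: Rintegrable_mulr.
rewrite RintegralD//; [|exact: Rintegrable_mulr|exact: Rintegrable_mulr].
by rewrite !RintegralZr.
Qed.

Lemma sin_transform_moved_count xi :
  sin_transform lam (moved_count) xi = tau ^+ d *
   (sin_transform m (cst 1) xi * cos_transform lam \1_Om (tau *: (s^T *m xi)) -
    cos_transform m (cst 1) xi * sin_transform lam \1_Om (tau *: (s^T *m xi))).
Proof.
have mdot : measurable_fun setT (fun x : Rd R d => dot x xi).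
  exact: (@measurable_dot _ _ _ _ id (cst xi : _ -> Rd R d)).
rewrite /sin_transform Rintegral_moved_countM; last 2 first.
- exact: measurable_sin.
- by move=> x; exact: normr_sin_le1.
set eta := tau *: (s^T *m xi).
have E (y : 'cV[R]_d) : \int[lam]_w (\1_Om w * sin (dot (y - s *m (tau *: w)) xi)) =
    sin (dot y xi) * cos_transform lam \1_Om eta - cos (dot y xi) * sin_transform lam \1_Om eta.
  have oc := integrable_cos_transform O1 eta; have os := integrable_sin_transform O1 eta.
  rewrite /cos_transform /sin_transform -(RintegralZl _ measurableT oc) -(RintegralZl _ measurableT os).
  rewrite -RintegralB//; [|exact: Rintegrable_mull|exact: Rintegrable_mull].
  apply: eq_Rintegral => w _.
  rewrite dotBl dot_mull dotZl -dotZr -/eta sinB; ring.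
under eq_Rintegral do rewrite E.
have ic := integrable_cos_transform w1 xi; have is' := integrable_sin_transform w1 xi.
have -> : (fun y : Rd R d => tau ^+ d * (sin (dot y xi) * cos_transform lam \1_Om eta - cos (dot y xi) * sin_transform lam \1_Om eta)) =
  (fun y : Rd R d => tau ^+ d * (((cst 1 : Rd R d -> R) y * sin (dot y xi)) * cos_transform lam \1_Om eta - ((cst 1 : Rd R d -> R) y * cos (dot y xi)) * sin_transform lam \1_Om eta)).
  by apply/funext => y; rewrite /= !mul1r.
rewrite RintegralZl//; last by apply: Rintegrable_sub; apply: Rintegrable_mulr.
rewrite RintegralB//; [|exact: Rintegrable_mulr|exact: Rintegrable_mulr].
by rewrite !RintegralZr.
Qed.

End Measure.
End CountTransform.

(** * Signed combinations of measures and the discrepancy *)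

Section FiniteSums.
Context {dd} {T : measurableType dd} {R : realType} (m : {measure set T -> \bar R}).
Variables (I : finType) (f : I -> T -> R).
Hypothesis fi : forall i, m.-integrable setT (EFin \o f i).

Lemma Rintegrable_sum_Rintegral_sum (r : seq I) :
  m.-integrable setT (EFin \o (fun x => \sum_(i <- r) f i x)) /\
  \int[m]_x (\sum_(i <- r) f i x) = \sum_(i <- r) \int[m]_x f i x.
Proof.
elim: r => [|i r [ih1 ih2]].
  rewrite (_ : (fun x => _) = cst 0); last by apply/funext => x; rewrite big_nil.
  split; first by rewrite (_ : _ \o _ = cst 0%E)//; exact: integrable0.
  by rewrite big_nil /Rintegral integral0.
rewrite (_ : (fun x => _) = fun x => f i x + \sum_(i <- r) f i x); last first.
  by apply/funext => x; rewrite big_cons.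
split; first exact: Rintegrable_add.
by rewrite RintegralD// ih2 big_cons.
Qed.

Lemma Rintegrable_sum :
  m.-integrable setT (EFin \o (fun x => \sum_i f i x)).
Proof. by have [] := Rintegrable_sum_Rintegral_sum (index_enum I). Qed.

Lemma Rintegral_sum : \int[m]_x (\sum_i f i x) = \sum_i \int[m]_x f i x.
Proof. by have [] := Rintegrable_sum_Rintegral_sum (index_enum I). Qed.

End FiniteSums.

Section SignedFamily.
Context {R : realType} {d : nat} (lam : {measure set (Rd R d) -> \bar R}).
Hypothesis hlam : is_lebesgue_Rd lam.
Variables (I : finType) (M : I -> {measure set (Rd R d) -> \bar R}) (a : I -> R).
Hypothesis Mfin : forall i, (M i setT < +oo)%E.

(** The signed measure [sum_i a_i M_i] is kept as weights and positive finite measures, so the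
    results for positive measures extend by finite sums. *)
Definition family_cos (xi : 'cV[R]_d) : R := \sum_i a i * cos_transform (M i) (cst 1) xi.
Definition family_sin (xi : 'cV[R]_d) : R := \sum_i a i * sin_transform (M i) (cst 1) xi.
Definition family_power (xi : 'cV[R]_d) : R := family_cos xi ^+ 2 + family_sin xi ^+ 2.

Let sM i := finite_sigma_finite (Mfin i).
Let w1 i := integrable_cst_finite (Mfin i) 1.

Lemma measurable_family_power : measurable_fun setT (family_power : Rd R d -> R).
Proof.
apply: measurable_funD; apply: measurable_funX; apply: measurable_sum => i;
  apply: measurable_funM => //.
- exact: (measurable_cos_transform hlam (sM i) (w1 i)).
- exact: (measurable_sin_transform hlam (sM i) (w1 i)).
Qed.

Lemma family_power_ge0 xi : 0 <= family_power xi.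
Proof. by rewrite addr_ge0// sqr_ge0. Qed.

Lemma integrable_gauss_transformM (u : R) i j : 0 < u ->
  lam.-integrable setT (EFin \o (fun xi : Rd R d => gauss u xi *
    (cos_transform (M i) (cst 1) xi * cos_transform (M j) (cst 1) xi +
     sin_transform (M i) (cst 1) xi * sin_transform (M j) (cst 1) xi))).
Proof.
move=> u0; pose K i := \int[M i]_y `|(cst 1 : Rd R d -> R) y|.
apply: integrable_le (Rintegrable_mulr (2 * (K i * K j)) (integrable_gauss hlam u0)) => [|xi].
  apply: measurable_funM; first exact: measurable_gauss.
  have mc k := measurable_cos_transform hlam (sM k) (w1 k).
  have ms k := measurable_sin_transform hlam (sM k) (w1 k).
  by apply: measurable_funD; apply: measurable_funM.
rewrite normrM (ger0_norm (gauss_ge0 _ _)); apply: ler_wpM2l; first exact: gauss_ge0.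
rewrite mulr2n mulrDl mul1r; apply: le_trans (ler_normD _ _) _.
have lec k : `|cos_transform (M k) (cst 1) xi| <= K k by exact: (cos_transform_le (w1 k)).
have les k : `|sin_transform (M k) (cst 1) xi| <= K k by exact: (sin_transform_le (w1 k)).
by apply: lerD; rewrite normrM; apply: ler_pM; rewrite ?normr_ge0.
Qed.

Lemma gauss_family_power (u : R) : 0 < u ->
  \int[lam]_xi (gauss u xi * family_power xi) =
  Zg lam u * \sum_i \sum_j a i * a j *
    \int[M i]_y \int[M j]_z gauss (4 * u)^-1 (y - z).
Proof.
move=> u0.
have E (xi : Rd R d) : gauss u xi * family_power xi = \sum_i \sum_j a i * a j * (gauss u xi *
    (cos_transform (M i) (cst 1) xi * cos_transform (M j) (cst 1) xi +
     sin_transform (M i) (cst 1) xi * sin_transform (M j) (cst 1) xi)).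
  rewrite /family_power !expr2 /family_cos /family_sin !big_distrlr -big_split/= mulr_sumr.
  apply: eq_bigr => i _; rewrite -big_split/= mulr_sumr; apply: eq_bigr => j _; ring.
under eq_Rintegral do rewrite E.
rewrite Rintegral_sum => [|i]; last first.
  by apply: Rintegrable_sum => j; apply: Rintegrable_mull; exact: integrable_gauss_transformM.
rewrite mulr_sumr; apply: eq_bigr => i _.
rewrite Rintegral_sum => [|j]; last first.
  by apply: Rintegrable_mull; exact: integrable_gauss_transformM.
rewrite mulr_sumr; apply: eq_bigr => j _.
rewrite RintegralZl//; last exact: integrable_gauss_transformM.
rewrite (gauss_transform_bilinear hlam (sM i) (sM j) (w1 i) (w1 j) u0) mulrCA.
congr (_ * (_ * _)); apply: eq_Rintegral => y _; rewrite mul1r.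
by apply: eq_Rintegral => z _; rewrite mul1r.
Qed.

Lemma integrable_gauss_family_power (u : R) : 0 < u ->
  lam.-integrable setT (EFin \o (fun xi : Rd R d => gauss u xi * family_power xi)).
Proof.
move=> u0.
rewrite (_ : (fun xi : Rd R d => _) = fun xi => \sum_i \sum_j a i * a j * (gauss u xi *
    (cos_transform (M i) (cst 1) xi * cos_transform (M j) (cst 1) xi +
     sin_transform (M i) (cst 1) xi * sin_transform (M j) (cst 1) xi))).
  apply: Rintegrable_sum => i; apply: Rintegrable_sum => j.
  by apply: Rintegrable_mull; exact: integrable_gauss_transformM.
apply/funext => xi.
rewrite /family_power !expr2 /family_cos /family_sin !big_distrlr -big_split/= mulr_sumr.
apply: eq_bigr => i _; rewrite -big_split/= mulr_sumr; apply: eq_bigr => j _; ring.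
Qed.

Variable Om : set (Rd R d).
Hypothesis mOm : measurable Om.
Hypothesis Ombd : ebounded Om.

Definition family_count (tau : R) (s : 'M[R]_d) (x : 'cV[R]_d) : R :=
  \sum_i a i * moved_count Om tau s (M i) x.

Section Moved.
Variables (tau : R) (s : 'M[R]_d).
Hypothesis tau0 : 0 < tau.
Hypothesis ss : s^T *m s = 1%:M.
Local Notation F := (family_count tau s).

Let ic i : lam.-integrable setT (EFin \o (moved_count Om tau s (M i) : Rd R d -> R)).
Proof. exact: integrable_moved_count. Qed.

Lemma integrable_family_count : lam.-integrable setT (EFin \o (F : Rd R d -> R)).
Proof. by apply: Rintegrable_sum => i; exact: Rintegrable_mull. Qed.

Let B : R := \sum_i `|a i| * fine (M i setT).

Lemma family_count_bounded x : `|F x| <= B.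
Proof.
apply: le_trans (ler_norm_sum _ _ _) _; apply: ler_sum => i _.
rewrite normrM; apply: ler_wpM2l => //.
by rewrite ger0_norm ?moved_count_ge0// moved_count_le.
Qed.

(** The modulus of a product is the product of the moduli: [(c c' + s s')^2 + (s c' - c s')^2 = (c^2
    + s^2) (c'^2 + s'^2)]. *)
Lemma family_count_power xi :
  cos_transform lam F xi ^+ 2 + sin_transform lam F xi ^+ 2 =
  family_power xi * (tau ^+ (2 * d) * power lam Om (tau *: (s^T *m xi))).
Proof.
have icos i := integrable_cos_transform (ic i) xi.
have isin i := integrable_sin_transform (ic i) xi.
have -> : cos_transform lam F xi = \sum_i a i * cos_transform lam (moved_count Om tau s (M i)) xi.
  rewrite /cos_transform.
  under eq_Rintegral do rewrite /family_count mulr_suml.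
  rewrite Rintegral_sum => [|i]; last first.
    apply: integrable_le (Rintegrable_mull `|a i| (integrable_norm (icos i))) => [|y].
      have /integrableP[/measurable_EFinP mi _] := icos i.
      rewrite (_ : (fun x => _) = fun x => a i * (moved_count Om tau s (M i) x * cos (dot x xi))).
        exact: measurable_funM.
      by apply/funext => x; rewrite mulrA.
    by rewrite -mulrA normrM.
  apply: eq_bigr => i _; under eq_Rintegral do rewrite -mulrA.
  by rewrite RintegralZl.
have -> : sin_transform lam F xi = \sum_i a i * sin_transform lam (moved_count Om tau s (M i)) xi.
  rewrite /sin_transform.
  under eq_Rintegral do rewrite /family_count mulr_suml.
  rewrite Rintegral_sum => [|i]; last first.
    apply: integrable_le (Rintegrable_mull `|a i| (integrable_norm (isin i))) => [|y].
      have /integrableP[/measurable_EFinP mi _] := isin i.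
      rewrite (_ : (fun x => _) = fun x => a i * (moved_count Om tau s (M i) x * sin (dot x xi))).
        exact: measurable_funM.
      by apply/funext => x; rewrite mulrA.
    by rewrite -mulrA normrM.
  apply: eq_bigr => i _; under eq_Rintegral do rewrite -mulrA.
  by rewrite RintegralZl.
set eta := tau *: (s^T *m xi).
set cO := cos_transform lam \1_Om eta; set sO := sin_transform lam \1_Om eta.
have -> : \sum_i a i * cos_transform lam (moved_count Om tau s (M i)) xi =
    tau ^+ d * (family_cos xi * cO + family_sin xi * sO).
  rewrite !mulr_suml -big_split/= mulr_sumr; apply: eq_bigr => i _.
  rewrite (cos_transform_moved_count hlam mOm Ombd tau0 ss (Mfin i)) -/eta -/cO -/sO; ring.
have -> : \sum_i a i * sin_transform lam (moved_count Om tau s (M i)) xi =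
    tau ^+ d * (family_sin xi * cO - family_cos xi * sO).
  rewrite !mulr_suml -sumrB mulr_sumr; apply: eq_bigr => i _.
  rewrite (sin_transform_moved_count hlam mOm Ombd tau0 ss (Mfin i)) -/eta -/cO -/sO; ring.
rewrite /family_power /power -/cO -/sO mulnC exprM; ring.
Qed.

(** This is [bessel] for the count, whose constant [Zg_mul] makes independent of the test scale
    [u]. *)
Lemma family_count_bessel (u : R) : 0 < u ->
  (\int[lam]_xi (gauss u xi * (family_power xi *
     (tau ^+ (2 * d) * power lam Om (tau *: (s^T *m xi)))))%:E <=
   (gconst lam)%:E * \int[lam]_x (F x ^+ 2)%:E)%E.
Proof.
move=> u0; have iF := integrable_family_count.
have mF : measurable_fun setT (F : Rd R d -> R) by have /integrableP[/measurable_EFinP] := iF.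
have iF2 := integrable_sqr iF family_count_bounded.
have K0 := bessel hlam iF family_count_bounded u0.
rewrite -(EFin_Rintegral iF2) -EFinM.
have -> : gconst lam = Zg lam u * Zg lam (4 * u)^-1.
  by rewrite /gconst -(Zg_mul hlam 4^-1 u0) invfM.
apply: le_trans (_ : (_ <= (\int[lam]_xi (gauss u xi * (cos_transform lam F xi ^+ 2 + sin_transform lam F xi ^+ 2)))%:E)%E) _; last by rewrite lee_fin.
under eq_integral do rewrite -family_count_power.
rewrite EFin_Rintegral//.
have sl := lebesgue_sigma_finite hlam.
pose W := \int[lam]_y `|F y|.
apply: integrable_le (Rintegrable_mulr (2 * W ^+ 2) (integrable_gauss hlam u0)) => [|xi].
  apply: measurable_funM; first exact: measurable_gauss.
  apply: measurable_funD; apply: measurable_funX.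
  - exact: (measurable_cos_transform hlam sl iF).
  - exact: (measurable_sin_transform hlam sl iF).
have W0 : 0 <= W by exact: Rintegral_ge0.
have sq (v : R) : `|v| <= W -> v ^+ 2 <= W ^+ 2.
  by move=> h; rewrite -[v ^+ 2]real_normK ?num_real// ler_pXn2r// nnegrE.
rewrite normrM (ger0_norm (gauss_ge0 _ _)); apply: ler_wpM2l; first exact: gauss_ge0.
rewrite ger0_norm ?addr_ge0 ?sqr_ge0// mulr2n mulrDl mul1r.
by apply: lerD; apply: sq; [exact: cos_transform_le|exact: sin_transform_le].
Qed.

End Moved.
End SignedFamily.

Section PointMass.
Context {R : realType} {d : nat} (a : Rd R d).

Definition point_mass : {measure set (Rd R d) -> \bar R} := \d_a.

Lemma point_massE (A : set (Rd R d)) : point_mass A = (a \in A)%:R%:E.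
Proof. exact: diracE. Qed.

Lemma Rintegral_point_mass (f : Rd R d -> R) : measurable_fun setT f ->
  \int[point_mass]_y f y = f a.
Proof.
move=> mf; rewrite /Rintegral.
have -> : (\int[point_mass]_y (f y)%:E = \d_a setT * (f a)%:E)%E.
  by apply: (integral_dirac a measurableT (f := EFin \o f)); exact/measurable_EFinP.
by rewrite diracT mul1e.
Qed.

End PointMass.

Section PointsMinusMeasure.
Context {R : realType} {d : nat}.
Variables (mu : {measure set (Rd R d) -> \bar R}) (N : nat) (z : 'I_N -> 'cV[R]_d).
Hypothesis muT : mu setT = 1%E.

(* The discrepancy as a signed family of measures: index [ord0] is [mu] with
   weight [-N], the others are unit masses at the points. *)
Definition disc_measure (i : 'I_N.+1) : {measure set (Rd R d) -> \bar R} :=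
  if unlift ord0 i is Some j then point_mass (z j) else mu.

Definition disc_weight (i : 'I_N.+1) : R :=
  if unlift ord0 i is Some j then 1 else - N%:R.

Lemma disc_measure_fin i : (disc_measure i setT < +oo)%E.
Proof.
rewrite /disc_measure; case: unlift => [j|]; last by rewrite muT ltry.
by rewrite point_massE ltry.
Qed.

Lemma discrepancyE (Om : set (Rd R d)) (tau : R) (s : 'M[R]_d) (x : 'cV[R]_d) :
  discrepancy mu z (moved x tau s Om) =
  family_count disc_measure disc_weight Om tau s x.
Proof.
rewrite /family_count big_ord_recl /disc_measure /disc_weight unlift_none.
rewrite /discrepancy addrC mulNr; congr (_ + _).
under eq_bigr do rewrite liftK mul1r /moved_count point_massE.
rewrite -sum1_card natr_sum big_mkcond/=; apply: eq_bigr => i _.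
set A := moved _ _ _ _.
have -> : (i \in in_set [set i0 | `[< A (z i0) >]]) = ((z i : Rd R d) \in A).
  apply/idP/idP; rewrite [_ \in in_set _]unfold_in.
    by move=> /set_mem/= /asboolP Az; rewrite mem_set.
  by move=> /set_mem Az; apply/asboolP; apply/asboolP.
by case: (_ \in _).
Qed.

(** Expand the square. The energy of [mu] with itself is nonnegative and dropped, mixed pairs occur
    twice with weight [- N], and pairs of points contribute nonnegative terms, equal to 1 on the
    diagonal. *)
Lemma disc_energy_ge (c : R) : 0 < c ->
  N%:R - 2 * N%:R * \sum_i \int[mu]_y gauss c (z i - y) <=
  \sum_i \sum_j disc_weight i * disc_weight j *
    \int[disc_measure i]_y \int[disc_measure j]_w gauss c (y - w).
Proof.
move=> c0.
have mg (a : 'cV[R]_d) : measurable_fun setT (fun y : Rd R d => gauss c (a - y : 'cV[R]_d)).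
  by apply: (measurableT_comp (measurable_gauss c)); exact: measurable_subRd.
have mg' (a : 'cV[R]_d) : measurable_fun setT (fun y : Rd R d => gauss c (y - a : 'cV[R]_d)).
  by apply: (measurableT_comp (measurable_gauss c)); exact: measurable_subRd.
have muoo : (mu setT < +oo)%E by rewrite muT ltry.
have mG : measurable_fun setT (fun y : Rd R d => \int[mu]_w gauss c (y - w : 'cV[R]_d)).
  have sm := finite_sigma_finite muoo.
  apply: (measurable_fubini1 sm sm (f := fun y w : Rd R d => gauss c ((y : 'cV[R]_d) - w)) (u := cst 1) (v := cst 1)).
  - by apply: (measurableT_comp (measurable_gauss c)); exact: measurable_subRd.
  - exact: integrable_cst_finite.
  - exact: integrable_cst_finite.
  - by move=> y w; rewrite ger0_norm ?gauss_ge0//= mulr1 gauss_le1// ltW.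
pose W i j : R := \int[disc_measure i]_y \int[disc_measure j]_w gauss c (y - w).
pose T i : R := \int[mu]_y gauss c (z i - y).
have W00 : 0 <= W ord0 ord0.
  by apply: Rintegral_ge0 => y _; apply: Rintegral_ge0 => w _; exact: gauss_ge0.
have W0l j : W ord0 (lift ord0 j) = T j.
  rewrite /W /disc_measure unlift_none liftK; apply: eq_Rintegral => y _.
  by rewrite Rintegral_point_mass// /gauss sqnB_sym.
have Wl0 i : W (lift ord0 i) ord0 = T i.
  by rewrite /W /disc_measure unlift_none liftK Rintegral_point_mass.
have Wll i j : W (lift ord0 i) (lift ord0 j) = gauss c (z i - z j).
  rewrite /W /disc_measure !liftK.
  under eq_Rintegral do rewrite Rintegral_point_mass//.
  by rewrite Rintegral_point_mass.
rewrite -/(\sum_i T i).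
have -> : \sum_i \sum_j disc_weight i * disc_weight j * W i j =
    N%:R ^+ 2 * W ord0 ord0 - 2 * N%:R * (\sum_i T i) + \sum_i \sum_j gauss c (z i - z j).
  have w0 : disc_weight ord0 = - N%:R by rewrite /disc_weight unlift_none.
  have wl i : disc_weight (lift ord0 i) = 1 by rewrite /disc_weight liftK.
  rewrite big_ord_recl big_ord_recl w0.
  under eq_bigr do rewrite wl W0l mulr1.
  under [X in _ + X]eq_bigr => i _.
    rewrite big_ord_recl w0 wl Wl0 mul1r.
    under eq_bigr => j _ do rewrite wl Wll mulr1 mul1r.
    over.
  rewrite big_split/= -!mulr_sumr; ring.
have : N%:R <= \sum_i \sum_j gauss c (z i - z j).
  rewrite -[X in X%:R <= _]card_ord -sum1_card natr_sum; apply: ler_sum => i _.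
  rewrite (bigD1 i)//= subrr {1}/gauss sqn0 mulr0 oppr0 expR0 lerDl.
  by apply: sumr_ge0 => j _; exact: gauss_ge0.
have : 0 <= N%:R ^+ 2 * W ord0 ord0 by rewrite mulr_ge0 ?sqr_ge0.
lra.
Qed.

End PointsMinusMeasure.

(** * Assembling the lower bound *)

Section EnergyChain.
Context {R : realType} {d : nat} (lam : {measure set (Rd R d) -> \bar R}).
Hypothesis hlam : is_lebesgue_Rd lam.
Hypothesis hd : (2 <= d)%N.
Variable nu : {measure set (Md R d) -> \bar R}.
Hypothesis hnu : is_haar_SO nu.
Variable Om : set (Rd R d).
Hypothesis mOm : measurable Om.
Hypothesis Ombd : ebounded Om.
Variables (I : finType) (M : I -> {measure set (Rd R d) -> \bar R}) (w : I -> R).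
Hypothesis Mfin : forall i, (M i setT < +oo)%E.
Variables (a a' : R).
Hypothesis a0 : 0 < a.

Local Notation F := (family_count M w Om).
Local Notation fpower := (family_power M w).
Let Omoo := ebounded_lty hlam mOm Ombd.

Let X (u tau : R) (s : 'M[R]_d) (xi : 'cV[R]_d) : \bar R :=
  (gauss u xi * (fpower xi * (tau ^+ (2 * d) * power lam Om (tau *: (s^T *m xi)))))%:E.

Let tau2d (tau : R) : 0 <= tau ^+ (2 * d).
Proof. by rewrite exprM exprn_ge0// sqr_ge0. Qed.

Let X0 u tau s xi : (0 <= X u tau s xi)%E.
Proof.
rewrite lee_fin; apply: mulr_ge0; first exact: gauss_ge0.
apply: mulr_ge0; first exact: family_power_ge0.
by apply: mulr_ge0 => //; exact: power_ge0.
Qed.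

Let mX u tau : measurable_fun setT (fun p : Md R d * Rd R d => X u tau p.1 p.2).
Proof.
apply/measurable_EFinP.
apply: measurable_funM; first exact: (measurableT_comp (measurable_gauss u)).
apply: measurable_funM; first exact: (measurableT_comp (measurable_family_power hlam w Mfin)).
apply: measurable_funM => //.
apply: (measurableT_comp (measurable_power hlam mOm Omoo)).
apply: (@measurable_scaleRd R d _ (Md R d * Rd R d)%type (fun=> tau)); first exact: measurable_cst.
apply: (@measurable_mulmxRd R d _ (Md R d * Rd R d)%type (fun p => (p.1 : 'M[R]_d)^T) snd).
  apply: (@measurable_trmxRd R d _ (Md R d * Rd R d)%type fst).
  exact: measurable_fst.
exact: measurable_snd.
Qed.

Let slam := lebesgue_sigma_finite hlam.
Let snu := haar_sigma_finite hnu.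

(** Apply [family_count_bessel] for each dilation and rotation, integrate, and exchange integrals:
    the rotations and dilations act only on [power], whose average in [s] and [tau] at frequency
    [xi] is [averaged_power]. *)
Lemma energy_ge (u : R) : 0 < u ->
  ((gconst lam)^-1%:E * \int[lam]_xi ((gauss u xi * fpower xi)%:E * averaged_power lam nu Om a a' xi) <=
   \int[lebesgue_measure]_(tau in `[a, a'])
     \int[nu]_s \int[lam]_x ((F tau s x) ^+ 2)%:E)%E.
Proof.
move=> u0.
have K0 : 0 < gconst lam by rewrite mulr_gt0 ?Zg_gt0// invr_gt0.
pose g (tau : R) (s : Md R d) : \bar R := (\int[lam]_xi X u tau s xi)%E.
have g0 tau s : (0 <= g tau s)%E by exact: integral_ge0.
have mgt tau : measurable_fun setT (g tau : Md R d -> \bar R).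
  exact: (measurable_tonelli1 slam (f := fun (s : Md R d) (xi : Rd R d) => X u tau s xi) (mX u tau)).
have step1 tau : a <= tau -> ((gconst lam)^-1%:E * \int[nu]_s g tau s <=
   \int[nu]_s \int[lam]_x ((F tau s x) ^+ 2)%:E)%E.
  move=> at'; have tau0 : 0 < tau by exact: lt_le_trans at'.
  have Ki : (0 <= (gconst lam)^-1%:E :> \bar R)%E by rewrite lee_fin invr_ge0 ltW.
  rewrite -ge0_integralZl//; apply: (haar_integral_le hnu).
  - by apply: emeasurable_funM => //; exact: measurable_cst.
  - by move=> s; exact: mule_ge0.
  - by move=> s; apply: integral_ge0 => x _; rewrite lee_fin sqr_ge0.
  - move=> s [ss _]; rewrite lee_pdivrMl//.
    exact: (family_count_bessel hlam w Mfin mOm Ombd tau0 ss u0).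
pose B : Rd R d -> \bar R := haar_mean nu (EFin \o power lam Om).
have p0 y : (0 <= (EFin \o power lam Om) y)%E by rewrite lee_fin power_ge0.
have mp : measurable_fun setT (EFin \o power lam Om : Rd R d -> \bar R).
  by apply/measurable_EFinP; exact: measurable_power.
have mB : measurable_fun setT B by exact: (measurable_haar_mean hnu mp).
have B0 x : (0 <= B x)%E by exact: haar_mean_ge0.
have gM0 xi : 0 <= gauss u xi * fpower xi.
  by apply: mulr_ge0; [exact: gauss_ge0|exact: family_power_ge0].
pose Y (tau : measurableTypeR R) (xi : Rd R d) : \bar R :=
  ((\1_(`[a, a']%classic : set (measurableTypeR R)) tau)%:E *
   ((gauss u xi * fpower xi)%:E * ((tau ^+ (2 * d))%:E * B ((tau : R) *: (xi : 'cV[R]_d)))))%E.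
have Y0 tau xi : (0 <= Y tau xi)%E.
  rewrite !mule_ge0// lee_fin ?indicE//.
(* For fixed [xi] only [power] depends on the rotation, and its Haar integral is [B (tau xi)]. *)
have gE tau : a <= tau <= a' -> (\int[nu]_s g tau s = \int[lam]_xi Y tau xi)%E.
  move=> ta; rewrite /g (tonelli snu slam (f := fun (s : Md R d) (xi : Rd R d) => X u tau s xi) (mX u tau)) => [|s xi]; last exact: X0.
  apply: eq_integral => xi _; rewrite /Y indicE mem_set ?mul1e; last by rewrite /= in_itv.
  rewrite /B /haar_mean.
  have mr : measurable_fun setT (fun s : Md R d => (EFin \o power lam Om) ((s : 'M[R]_d)^T *m (tau *: (xi : 'cV[R]_d)))).
    apply: (measurableT_comp mp).
    apply: (@measurable_mulmxRd R d _ (Md R d) (fun s : Md R d => (s : 'M[R]_d)^T) (fun=> tau *: (xi : 'cV[R]_d))).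
      by apply: (@measurable_trmxRd R d _ (Md R d) id); exact: measurable_id.
    exact: measurable_cst.
  rewrite muleA -EFinM -ge0_integralZl//; last by rewrite lee_fin mulr_ge0.
  by apply: eq_integral => s _; rewrite /= -EFinM /X -scalemxAr mulrA mulrA.
have mY : measurable_fun setT (fun p : measurableTypeR R * Rd R d => Y p.1 p.2).
  apply: emeasurable_funM.
    apply/measurable_EFinP.
    exact: (measurableT_comp (measurable_indic (measurable_itv `[a, a'])) measurable_fst).
  apply: emeasurable_funM.
    apply/measurable_EFinP.
    apply: (measurableT_comp (f := fun xi : Rd R d => gauss u xi * fpower xi)) => //.
    by apply: measurable_funM; [exact: measurable_gauss|exact: (measurable_family_power hlam w Mfin)].
  apply: emeasurable_funM.
    by apply/measurable_EFinP; apply: measurable_funX.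
  apply: (measurableT_comp mB).
  apply: (@measurable_scaleRd R d _ (measurableTypeR R * Rd R d)%type fst snd).
  - exact: measurable_fst.
  - exact: measurable_snd.
have sleb : sigma_finite setT (@lebesgue_measure R) by exact: sigma_finiteT.
have mline (xi : 'cV[R]_d) : measurable_fun setT (fun t : measurableTypeR R => B (t *: xi)).
  apply: (measurableT_comp mB).
  apply: (@measurable_scaleRd R d _ (measurableTypeR R) (fun t => t) (fun=> xi)).
  - exact: measurable_id.
  - exact: measurable_cst.
have -> : (\int[lam]_xi ((gauss u xi * fpower xi)%:E * averaged_power lam nu Om a a' xi) =
    \int[lebesgue_measure]_tau \int[lam]_xi Y tau xi)%E.
  rewrite (tonelli sleb slam mY Y0); apply: eq_integral => xi _.
  rewrite /averaged_power -ge0_integralZl//; last 3 first.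
  - apply: emeasurable_funM; last exact: (measurable_funTS (mline xi)).
    by apply/measurable_EFinP; apply: measurable_funX; exact: measurable_funTS.
  - by move=> t _; rewrite mule_ge0// lee_fin.
  - by rewrite lee_fin.
  rewrite integral_mkcond; apply: eq_integral => t _.
  by rewrite /patch /Y indicE; case: ifP => _; rewrite ?mul1e ?mul0e.
have Ki : 0 <= (gconst lam)^-1 by rewrite invr_ge0 ltW.
have mYt := measurable_tonelli1 slam mY Y0.
have Yt0 t : (0 <= \int[lam]_xi Y t xi)%E by exact: integral_ge0.
rewrite -(ge0_integralZl_EFin _ measurableT (fun t _ => Yt0 t) mYt Ki).
rewrite [leRHS]integral_mkcond; apply: ge0_le_integral_weak => t _.
  by rewrite mule_ge0 ?lee_fin// integral_ge0.
rewrite /patch; case: ifPn => [|tn].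
  rewrite inE /= in_itv/= => ta; rewrite -gE//; apply: step1.
  by case/andP: ta.
rewrite integral0_eq ?mule0// => xi _.
by rewrite /Y indicE (negPf tn) mul0e.
Qed.

End EnergyChain.

(** [E] is extended because it will be the triple integral, whose finiteness is not established. *)
Lemma le_poweR_half {R : realType} (c : R) (E : \bar R) :
  0 <= c -> ((c ^+ 2)%:E <= E -> c%:E <= E `^ 2^-1)%E.
Proof.
move=> c0 cE.
have -> : c%:E = ((c ^+ 2)%:E `^ 2^-1)%E.
  rewrite poweR_EFin -powR_mulrn// -powRrM divff ?powRr1// pnatr_eq0//.
have c20 : (0 <= (c ^+ 2)%:E :> \bar R)%E by rewrite lee_fin sqr_ge0.
apply: gt0_ler_poweR => //; rewrite in_itv/= leey andbT//.
exact: le_trans cE.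
Qed.

Lemma decreasing_cvg0_gt0 {R : realType} (t : nat -> R) :
  (forall n, t n.+1 < t n) -> t @ \oo --> 0 -> forall n, 0 < t n.
Proof.
move=> td t0 n.
have nt : nonincreasing_seq t by apply/nonincreasing_seqP => k; exact/ltW.
have := nonincreasing_cvgn_ge nt (cvgP _ t0) n.+1.
by rewrite (cvg_lim _ t0)// => /le_lt_trans; apply.
Qed.

Section EnergyLowerBound.
Context {R : realType} {d : nat} (lam : {measure set (Rd R d) -> \bar R}).
Hypothesis hlam : is_lebesgue_Rd lam.
Variable nu : {measure set (Md R d) -> \bar R}.
Hypothesis hnu : is_haar_SO nu.
Variable Om : set (Rd R d).
Hypothesis mOm : measurable Om.
Hypothesis Ombd : ebounded Om.
Variables (mu : {measure set (Rd R d) -> \bar R}) (N : nat) (z : 'I_N -> 'cV[R]_d).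
Hypothesis muT : mu setT = 1%E.
Variables (a a' b c' : R).
Hypothesis a0 : 0 < a.
Hypothesis c'0 : 0 < c'.
Hypothesis avg : forall (delta : R) (xi : 'cV[R]_d), 0 < delta <= 1 ->
  ((c' * (delta ^+ d * (delta ^+ 2) `^ b) * gauss (delta ^+ 2) xi)%:E <=
   averaged_power lam nu Om a a' xi)%E.

(** The test weight [gauss (delta^2)] meets a second one from [avg], giving rate [2 delta^2] and
    hence an interaction kernel of rate [(8 delta^2)^-1], the one estimated in [frostman_gauss]. The
    mass [Zg (2 delta^2) = delta^(-d) Zg 2] cancels the factor [delta^d]. *)
Lemma discrepancy_energy_ge (delta C : R) : 0 < delta <= 1 ->
  (forall x, \int[mu]_y gauss (8 * delta ^+ 2)^-1 (x - y) <= C) ->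
  (((gconst lam)^-1 * c' * Zg lam 2 * (delta ^+ 2) `^ b *
     (N%:R - 2 * N%:R ^+ 2 * C))%:E <=
   \int[lebesgue_measure]_(tau in `[a, a'])
     \int[nu]_s \int[lam]_x (discrepancy mu z (moved x tau s Om) ^+ 2)%:E)%E.
Proof.
move=> /[dup] d01 /andP[d0 d1] HC.
pose M := disc_measure mu z.
have Mfin : forall i, (M i setT < +oo)%E by move=> i; exact: disc_measure_fin.
have u0 : 0 < delta ^+ 2 by rewrite exprn_gt0.
have u20 : 0 < 2 * delta ^+ 2 by rewrite mulr_gt0.
have K0 : 0 < gconst lam by rewrite mulr_gt0 ?Zg_gt0// invr_gt0.
have -> : (\int[lebesgue_measure]_(tau in `[a, a'])
     \int[nu]_s \int[lam]_x (discrepancy mu z (moved x tau s Om) ^+ 2)%:E =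
   \int[lebesgue_measure]_(tau in `[a, a'])
     \int[nu]_s \int[lam]_x (family_count M (@disc_weight R N) Om tau s x ^+ 2)%:E)%E.
  apply: eq_integral => tau _; apply: eq_integral => s _; apply: eq_integral => x _.
  by rewrite discrepancyE.
apply: le_trans (energy_ge hlam hnu mOm Ombd (@disc_weight R N) Mfin a' a0 u0).
set k := c' * (delta ^+ d * (delta ^+ 2) `^ b).
have k0 : 0 <= k by rewrite !mulr_ge0 ?exprn_ge0 ?powR_ge0// ltW.
pose G (xi : 'cV[R]_d) := gauss (2 * delta ^+ 2) xi * family_power M (@disc_weight R N) xi.
have G0 xi : 0 <= G xi by rewrite mulr_ge0 ?gauss_ge0 ?family_power_ge0.
have iG := integrable_gauss_family_power hlam (@disc_weight R N) Mfin u20.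
apply: (@le_trans _ _ ((gconst lam)^-1%:E * \int[lam]_xi (k * G xi)%:E)%E).
  rewrite -EFin_Rintegral; last exact: Rintegrable_mull.
  rewrite RintegralZl// -EFinM lee_fin (gauss_family_power hlam (@disc_weight R N) Mfin u20).
  rewrite (_ : 2 * delta ^+ 2 = delta ^+ 2 * 2); last by rewrite mulrC.
  rewrite (Zg_scale hlam)//.
  set S := (\sum_i \sum_j _).
  have dd : delta != 0 by rewrite gt_eqF.
  have -> : (gconst lam)^-1 * (k * (delta ^- d * Zg lam 2 * S)) =
      (gconst lam)^-1 * c' * Zg lam 2 * (delta ^+ 2) `^ b * S.
    by rewrite /k; field; rewrite ?dd ?expf_neq0 ?gt_eqF.
  apply: ler_wpM2l; first by rewrite !mulr_ge0 ?invr_ge0 ?powR_ge0// ltW// Zg_gt0.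
  have c0 : 0 < (4 * (delta ^+ 2 * 2))^-1 by rewrite invr_gt0; lra.
  apply: le_trans (disc_energy_ge z muT c0).
  rewrite lerD2l lerN2 (_ : 2 * N%:R ^+ 2 * C = 2 * N%:R * \sum_(i < N) C); last first.
    by rewrite sumr_const card_ord -mulr_natl; ring.
  apply: ler_wpM2l; first by rewrite mulr_ge0.
  apply: ler_sum => i _.
  by rewrite (_ : 4 * (delta ^+ 2 * 2) = 8 * delta ^+ 2)//; ring.
apply: lee_wpmul2l; first by rewrite lee_fin invr_ge0 ltW.
apply: ge0_le_integral_weak => xi _; first by rewrite lee_fin mulr_ge0.
have -> : (k * G xi)%:E = ((gauss (delta ^+ 2) xi * family_power M (@disc_weight R N) xi)%:E * (k * gauss (delta ^+ 2) xi)%:E)%E.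
  rewrite -EFinM /G (_ : gauss (2 * delta ^+ 2) xi = gauss (delta ^+ 2) xi * gauss (delta ^+ 2) xi); last first.
    by rewrite /gauss -expRD; congr expR; ring.
  by congr EFin; ring.
apply: lee_wpmul2l; first by rewrite lee_fin mulr_ge0 ?gauss_ge0 ?family_power_ge0.
exact: avg.
Qed.

End EnergyLowerBound.

Theorem theorem2 (R : realType) (d : nat) (hd : (2 <= d)%N)
  (lam : {measure set (Rd R d) -> \bar R}) (hlam : is_lebesgue_Rd lam)
  (nu : {measure set (Md R d) -> \bar R}) (hnu : is_haar_SO nu)
  (mu : {measure set (Rd R d) -> \bar R})
  (hsupp_bd : ebounded (msupport mu)) (hsupp1 : mu (msupport mu) = 1%E)
  (alpha c0 : R) (halpha : 0 < alpha <= d%:R) (hc0 : 0 < c0)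
  (hball : forall (x : 'cV[R]_d) (r : R), 0 < r ->
     (mu (eball x r) <= (c0 * r `^ alpha)%:E)%E)
  (Omega : set (Rd R d)) (hOm_meas : measurable Omega)
  (hOm_bd : ebounded Omega) (hOm_pos : (0 < lam Omega)%E)
  (beta kappa1 : R) (hbeta : 0 < beta <= 1) (hk1 : 0 < kappa1)
  (hupper : exists delta : R, 0 < delta /\
     forall h : 'cV[R]_d, enorm h < delta ->
       (lam (symdiff (translate h Omega) Omega)
          <= (kappa1 * enorm h `^ beta)%:E)%E)
  (kappa2 kappa3 : R) (Theta : 'cV[R]_d) (t : nat -> R)
  (hk2 : 0 < kappa2) (hk3 : 0 < kappa3) (hTheta : enorm Theta = 1)
  (ht_dec : forall n, t n.+1 < t n) (ht_lim : t @ \oo --> 0)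
  (ht_ratio : forall n, t n <= kappa3 * t n.+1)
  (hlower : forall n,
     ((kappa2 * t n `^ beta)%:E
        <= lam (symdiff (translate (t n *: Theta) Omega) Omega))%E) :
  exists a b c : R, [/\ 0 < a, a < b, 0 < c &
    forall (N : nat) (z : 'I_N -> 'cV[R]_d), (0 < N)%N ->
      ((c * N%:R `^ (2^-1 - beta / (2 * alpha)))%:E
       <= (\int[lebesgue_measure]_(tau in `[a, b])
             \int[nu]_(s in [set: Md R d])
               \int[lam]_(x in [set: Rd R d])
                 ((discrepancy mu z (moved x tau s Omega)) ^+ 2)%:E)
          `^ 2^-1)%E].
Proof.
have [alpha0 _] := andP halpha; have [beta0 beta1] := andP hbeta.
have Omoo := ebounded_lty hlam hOm_meas hOm_bd.
have [delta0 [delta00 hup]] := hupper.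
(* The exponent is halved because the moduli are expressed through squared norms. *)
pose b := beta / 2.
have b0 : 0 < b by rewrite divr_gt0.
have b2 : 0 < b <= 2^-1 by rewrite b0/= ler_piMl.
have b1 : 0 <= b <= 1 by lra.
have [k k0 phik] := phi_upper hlam hOm_meas Omoo beta0 hk1 delta00 hup.
have [C C0 gC] := gphi_upper hlam hOm_meas Omoo b1 k0 phik.
have t0 := decreasing_cvg0_gt0 ht_dec ht_lim.
have T1 : sqn Theta = 1 by rewrite -enorm_sqr hTheta expr1n.
have tlow n : kappa2 * (t n ^+ 2) `^ b <= phi lam Omega (t n *: Theta).
  rewrite -lee_fin -(phiE hlam hOm_meas Omoo).
  suff -> : (t n ^+ 2) `^ b = t n `^ beta by exact: hlower.
  by rewrite -powR_mulrn ?ltW// -powRrM /b mulrC divfK// pnatr_eq0.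
have [c [s0 [c0' s00 gc]]] := gphi_lower hlam hOm_meas Omoo b0 k0 phik hk2 hk3 T1
  ht_dec ht_lim ht_ratio tlow.
have [a [a' [c' [a0 aa' c'0 avg]]]] := averaged_power_ge hlam hd hnu hOm_meas hOm_bd
  hOm_pos b2 c0' C0 s00 gc gC.
have muT := frostman_total hsupp1.
have [K K1 HK] := frostman_gauss hsupp1 alpha0 hball.
have K0 : 0 < K by lra.
have g0 : 0 < gconst lam by rewrite mulr_gt0 ?Zg_gt0// invr_gt0.
(* The factor [(4 K)^(- beta / alpha)] is the constant part of [delta^beta], and the final 2 is the
   half of the diagonal lost to the cross terms. *)
pose A := (gconst lam)^-1 * c' * Zg lam 2 * (4 * K) `^ (- (beta / alpha)) / 2.
have A0 : 0 < A by rewrite !mulr_gt0 ?invr_gt0 ?Zg_gt0// powR_gt0// mulr_gt0.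
exists a, a', (Num.sqrt A); split => //; first by rewrite sqrtr_gt0.
move=> N z N0.
have N1 : 1 <= N%:R :> R by rewrite ler1n.
(* With [delta^alpha = 1 / L] the cross terms are at most [2 N^2 K / L = N / 2]. Since [K >= 1] and
   [N >= 1], also [L >= 1], so [delta <= 1] lies in the range of [avg]. *)
pose L := 4 * K * N%:R : R.
have L0 : 0 < L by rewrite !mulr_gt0//; lra.
have L1 : 1 <= L.
  rewrite /L -[1]mulr1; apply: ler_pM => //; lra.
pose delta := L `^ (- alpha^-1).
have d0 : 0 < delta by exact: powR_gt0.
have d1 : delta <= 1.
  rewrite /delta powRN invf_le1 ?powR_gt0//.
  have -> : 1 = 1 `^ alpha^-1 :> R by rewrite powR1.
  by apply: ge0_ler_powR; rewrite ?nnegrE ?invr_ge0 ?(ltW alpha0) ?(ltW L0).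
have da : delta `^ alpha = L^-1.
  by rewrite /delta -powRrM mulNr mulVf ?gt_eqF// powR_inv1// ltW.
have db : (delta ^+ 2) `^ b = L `^ (- (beta / alpha)).
  rewrite /delta -powR_mulrn ?powR_ge0// -!powRrM /b; congr (_ `^ _).
  by field; rewrite gt_eqF.
have HC x : \int[mu]_y gauss (8 * delta ^+ 2)^-1 (x - y) <= K / L.
  have := HK delta x d0; rewrite da.
  have u0 : 0 <= (8 * delta ^+ 2)^-1 by rewrite invr_ge0 mulr_ge0// sqr_ge0.
  move: (8 * _)^-1 u0 => u u0.
  rewrite -EFin_Rintegral ?lee_fin//.
  have mufin : (mu setT < +oo)%E by rewrite muT ltry.
  apply: integrable_le (integrable_cst_finite mufin 1) => [|y].
    by apply: (measurableT_comp (measurable_gauss u)); exact: measurable_subRd.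
  by rewrite ger0_norm ?gauss_ge0// gauss_le1.
apply: le_poweR_half; first by rewrite mulr_ge0 ?sqrtr_ge0 ?powR_ge0.
have d01 : 0 < delta <= 1 by rewrite d0.
apply: le_trans (discrepancy_energy_ge hlam hnu hOm_meas hOm_bd z muT a0 c'0 avg d01 HC).
rewrite lee_fin exprMn sqr_sqrtr ?(ltW A0)// db.
have -> : (N%:R `^ (2^-1 - beta / (2 * alpha))) ^+ 2 = N%:R * N%:R `^ (- (beta / alpha)) :> R.
  rewrite -powR_mulrn ?powR_ge0// -powRrM.
  rewrite (_ : (2^-1 - _) * _ = 1 + - (beta / alpha)); last by field; rewrite gt_eqF.
  by rewrite powRD ?powRr1//; apply/implyP => _; rewrite gt_eqF//; lra.
have -> : N%:R - 2 * N%:R ^+ 2 * (K / L) = N%:R / 2 :> R.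
  have Nn : N%:R != 0 :> R by rewrite pnatr_eq0 -lt0n.
  have Kn : K != 0 by rewrite gt_eqF.
  by rewrite /L; field; rewrite ?Nn ?Kn.
rewrite /L powRM; [|lra|lra].
rewrite (_ : A * _ = (gconst lam)^-1 * c' * Zg lam 2 * ((4 * K) `^ (- (beta / alpha)) * N%:R `^ (- (beta / alpha))) * (N%:R / 2)) ?lexx//.
by rewrite /A; field; rewrite gt_eqF.
Qed.
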